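(* Let $X$ be a proper CAT$(-1)$ space, $x\in X$, and let $\Gamma\le\operatorname{Isom}(X)$ be a finitely generated discrete group with $0<\delta:=\delta_X(\Gamma)<\infty$. Suppose that $\Gamma$ is equipped with a Grushko decomposition $\Gamma=G_1*\cdots*G_p*F_r$ with $p+r\ge2$, a free basis $x_1,\dots,x_r$ of $F_r$, finite relative JSJ representatives (finite graph-of-groups decompositions) for any selected noncyclic factors, and finitely many further relative splittings, forming a finite graph-of-groups hierarchy. Then: (1) With $W_i(s)=\sum_{g\in G_i\setminus\{1\}}e^{-sd(x,gx)}$ and $U_j(s)=\sum_{n\in\mathbb Z\setminus\{0\}}e^{-sd(x,x_j^nx)}$, $$\sum_{i=1}^p\frac{W_i(\delta)}{1+W_i(\delta)}+\sum_{j=1}^r\frac{U_j(\delta)}{1+U_j(\delta)}\le1.$$ (2) At every (nonterminal) descendant node $H$, for every strongly connected component $C$ containing a directed cycle, every entry of $K_{C,x}(\delta)$ is finite and $\rho(K_{C,x}(\delta))\le1$. Every finite choice $\mathcal F$ of hyperbolic representatives in $C$ gives a comparison matrix $A^{\mathcal F}_{C,x}$ whose critical parameter is at most $\delta$. (3) The following inequalities hold at each node with the same value $\delta$: (a) (multiplicity and cycle) If for each retained transition $e\to f$ of $\mathcal F$ there are $N_{ef}$ selected distinct cosets whose chosen representatives satisfy $a_x(g_{ef,c})\le R_{ef}$, then $B(\delta)=(N_{ef}e^{-\delta R_{ef}})$ has $\rho(B(\delta))\le1$; if all $R_{ef}\le R$ and $\rho(N)>1$ for $N=(N_{ef})$,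 then $\delta R\ge\log\rho(N)$; and along a directed cycle with successive retained multiplicities $N_j$ and bounds $R_j$, $\delta\sum_jR_j\ge\sum_j\log N_j$. (b) (amalgam) If the node decomposition is a nondegenerate amalgam $A*_{C_0}B$, then $Z_{A/C_0}(\delta)<\infty$, $Z_{B/C_0}(\delta)<\infty$ and $Z_{A/C_0}(\delta)Z_{B/C_0}(\delta)\le1$; and if finite sets $F_A,F_B$ of relative cosets are represented by hyperbolic elements $g_c$ in their coordinate classes, then $\big(\sum_{c\in F_A}e^{-\delta a_x(g_c)}\big)\big(\sum_{c\in F_B}e^{-\delta a_x(g_c)}\big)\le1$. (c) (HNN) If the node decomposition is a one-edge HNN extension, every diagonal entry of its $2\times2$ relative matrix at $\delta$ lying on a one-cycle is finite and at most one, and if both mixed (off-diagonal) transitions are nonzero, both mixed entries are finite and their product is at most one; the same holds for every finite choice of hyperbolic representatives with each exact relative entry replaced by the corresponding finite sum of weights $e^{-\delta a_x(g)}$. (d) (weighted Hashimoto) If $Y$ is the quotient graph of the node decomposition and for every $e,f$ with $t(e)=\iota(f)$, $f\ne\bar e$, one hyperbolic relative-coset representative $g_{ef}$ is chosen, with $R_{ef}=a_x(g_{ef})$, then the matrix $H_{ef}=e^{-\delta R_{ef}}$ if $t(e)=\iota(f)$ and $f\ne\bar e$, $H_{ef}=0$ otherwise, has $\rho(H)\le1$; and if $R_{ef}\le R$ on every transition belonging to a strongly connected component of the Hashimoto matrix $B_Y$ containing a directed cycle, then $\delta R\ge\log\rho(B_Y)$ whenever $\rho(B_Y)>1$. (4)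 If the action of $\Gamma$ is non-elementary and discrete with $\delta<1$ ($\Gamma$ finitely generated), or if it is convex-cobounded, then every one of these critical parameters is bounded above by $\dim_H(\Lambda_\Gamma,\rho_x)=\delta_X(\Gamma)$.
   Context: $\delta_X(\Gamma)=\inf\{s>0:\sum_{g\in\Gamma}e^{-sd(x,gx)}<\infty\}$; $\Lambda_\Gamma$ is the limit set; $\rho_x(\xi,\eta)=e^{-(\xi\mid\eta)_x}$ is the Bourdon metric; $\rho(M)$ is the spectral radius of a matrix. The action is convex-cobounded if there is $R'<\infty$ with $\bigcup_{g,h\in\Gamma}[gx,hx]\subseteq\bigcup_{g\in\Gamma}gB_X(x,R')$ (considered for non-elementary properly discontinuous actions). In a Grushko decomposition each $G_i$ is nontrivial, freely indecomposable and not infinite cyclic, and $F_r$ is free of rank $r$. A finite graph-of-groups hierarchy is a finite rooted tree of subgroups in which every nonterminal node $H$ carries a finite graph-of-groups decomposition with fundamental group $H$ and selected vertex groups become its children; later splittings may be relative to incident edge groups. A JSJ representative is the finite graph of groups obtained from a JSJ tree (in the sense of Guirardel–Levitt, relative to a chosen family of allowed edge groups and peripheral structure) with finite quotient. Data at a node $H$. Let $Y$ be the finite underlying graph and $T$ the Bass–Serre tree of the decomposition ($H$ acts without inversions, $H\backslash T=Y$). For an oriented edge $f$ of $Y$: origin $\iota(f)$, terminus $t(f)$, reverse $\bar f$. Fix a base vertex $v_*$ of $Y$, a lift $\tilde v\in T$ of each vertex $v$, a lift $\tilde f$ of each oriented edge $f$ with origin $\widetilde{\iota(f)}$, and $\tau_f\in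 H$ with $t(\tilde f)=\tau_f\widetilde{t(f)}$, chosen so that $\widetilde{\bar f}=\tau_f^{-1}\overline{\tilde f}$ and $\tau_{\bar f}=\tau_f^{-1}$. Put $G_v=\operatorname{Stab}_H(\tilde v)$, $G_f=\operatorname{Stab}_H(\tilde f)\le G_{\iota(f)}$. For $c=rG_f\in G_{\iota(f)}/G_f$ let $L_{f,x}(c)=\min_{h\in G_f}d(x,rh\tau_fx)$. An allowed transition is a triple $(e,f,c)$ with $t(e)=\iota(f)$ and $c\in G_{\iota(f)}/G_f$, where $c\ne G_f$ is required if $f=\bar e$. The relative matrix is $K_{ef,x}(s)=\sum_{c:(e,f,c)\text{ allowed}}e^{-sL_{f,x}(c)}$. A reduced coset-labelled loop based at $v_*$ is a sequence $(f_1,c_1;\dots;f_n,c_n)$, $c_j\in G_{\iota(f_j)}/G_{f_j}$, with $\iota(f_1)=v_*=t(f_n)$ and all $(f_j,f_{j+1},c_{j+1})$ allowed. The state set $E_*$ consists of the oriented edges occurring in some such loop; components $C$ are strongly connected components of the support digraph of $K_x$ restricted to $E_*$, and $K_{C,x}(s)$ is the diagonal block on $C$. An isometry $g$ is hyperbolic if $\tau_X(g)=\inf_zd(z,gz)$ is positive and attained; it has a unique axis $\operatorname{Ax}(g)$, and $a_x(g)=\tau_X(g)+2d(x,\operatorname{Ax}(g))$. A hyperbolic representative of $c=rG_f$ is a hyperbolic element of the form $rh\tau_f$, $h\in G_f$. A finite choice $\mathcal F$ of hyperbolic representatives in $C$ consists, for each $e,f\in C$, of a finite set $\mathcal F_{ef}$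 of distinct cosets $c$ with $(e,f,c)$ allowed and one hyperbolic representative $g_{ef,c}$ for each $c\in\mathcal F_{ef}$; $e\to f$ is retained if $\mathcal F_{ef}\ne\varnothing$. $A^{\mathcal F}_{C,x}(s)_{ef}=\sum_{c\in\mathcal F_{ef}}e^{-sa_x(g_{ef,c})}$, with critical parameter $\inf\{s>0:\rho(A^{\mathcal F}_{C,x}(s))<1\}$. Amalgams: $A*_{C_0}B$ is nondegenerate if the images $C_A\le A$, $C_B\le B$ of $C_0$ are proper subgroups. $Z_{A/C_0}(s)=\sum_{aC_A\ne C_A}e^{-s\min_{c\in C_A}d(x,acx)}$ and $Z_{B/C_0}(s)=\sum_{bC_B\ne C_B}e^{-s\min_{c\in C_B}d(x,bcx)}$; $F_A,F_B$ are finite sets of nontrivial left cosets of $C_A$ in $A$, resp. $C_B$ in $B$, and $g_c$ is an element of the coset $c$. For a one-edge HNN extension $Y$ has one vertex and one unoriented loop, giving two oriented-edge states. The Hashimoto matrix $B_Y$ on oriented edges has $(B_Y)_{ef}=1$ if $t(e)=\iota(f)$ and $f\ne\bar e$, and $0$ otherwise. *)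

(* Defs.v *)
From HB Require Import structures.
From mathcomp Require Import all_boot all_order all_algebra.
From mathcomp Require Import finmap.
From mathcomp Require Import all_classical all_reals all_analysis.
From mathcomp Require Import complex.

Set Implicit Arguments.
Unset Strict Implicit.
Unset Printing Implicit Defensive.

Import Order.TTheory GRing.Theory Num.Theory.
Import numFieldNormedType.Exports.

Local Open Scope classical_set_scope.
Local Open Scope ring_scope.

Section HyperbolicPlane.
Variable R : realType.

Definition arcosh (t : R) : R := ln (t + Num.sqrt (t ^+ 2 - 1)).

(* Upper half-plane model, curvature -1. *)
Definition hplane : Type := {z : R * R | 0 < z.2}.

Definition hdist (z w : hplane) : R :=
  arcosh (1 + (((val z).1 - (val w).1) ^+ 2 + ((val z).2 - (val w).2) ^+ 2)
              / (2 * (val z).2 * (val w).2)).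

End HyperbolicPlane.

Section Geometry.
Variables (R : realType) (X : metricType R).
Implicit Types (a b p q x z : X).

Definition proper_space : Prop :=
  forall z (r : R), compact [set y | mdist z y <= r].

Definition geodesic a b (c : R -> X) : Prop :=
  [/\ c 0 = a, c (mdist a b) = b &
      forall s t, 0 <= s <= mdist a b -> 0 <= t <= mdist a b ->
        mdist (c s) (c t) = `|s - t| ].

Definition geodesic_space : Prop := forall a b, exists c, geodesic a b c.

(* By symmetry in the vertices it suffices to compare a point on [p, q] with
   a point on [p, r]; [u'] is the comparison point of [c s]. *)
Definition comparison_inequality : Prop :=
  forall (p q r : X) (c c' : R -> X) (p' q' r' : hplane R),
  geodesic p q c -> geodesic p r c' ->
  hdist p' q' = mdist p q -> hdist p' r' = mdist p r ->
  hdist q' r' = mdist q r ->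
  forall (s t : R) (u' v' : hplane R),
  0 <= s <= mdist p q -> 0 <= t <= mdist p r ->
  hdist p' u' = s -> hdist u' q' = mdist p q - s ->
  hdist p' v' = t -> hdist v' r' = mdist p r - t ->
  mdist (c s) (c' t) <= hdist u' v'.

Definition CATm1 : Prop := geodesic_space /\ comparison_inequality.

Definition segment a b : set X :=
  [set z | exists c t, [/\ geodesic a b c, 0 <= t <= mdist a b & z = c t] ].

Definition set_dist x (A : set X) : R := inf [set mdist x z | z in A].

End Geometry.

Record isom (R : realType) (X : metricType R) := Isom {
  isom_fun :> X -> X;
  isom_inv : X -> X;
  isom_funK : cancel isom_fun isom_inv;
  isom_invK : cancel isom_inv isom_fun;
  isom_dist : forall a b, mdist (isom_fun a) (isom_fun b) = mdist a b }.

Section IsomGroup.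
Variables (R : realType) (X : metricType R).

Lemma isom_eq (g h : isom X) : (forall z, g z = h z) -> g = h.
Proof.
case: g h => [f fi fK fiK fd] [f' fi' fK' fiK' fd'] /= /funext ff'.
subst f'; have ffi : fi = fi'.
  by apply/funext => z; rewrite -{1}(fiK' z) fK.
subst fi'; congr Isom; exact: Prop_irrelevance.
Qed.

Definition isom_one : isom X :=
  @Isom R X id id (fun _ => erefl) (fun _ => erefl) (fun _ _ => erefl).

Lemma isom_mul_dist (g h : isom X) a b :
  mdist ((g \o h) a) ((g \o h) b) = mdist a b.
Proof. by rewrite /= !isom_dist. Qed.

Definition isom_mul (g h : isom X) : isom X :=
  Isom (can_comp (isom_funK g) (isom_funK h))
       (can_comp (isom_invK h) (isom_invK g)) (isom_mul_dist g h).

Lemma isom_inv_dist (g : isom X) a b :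
  mdist (isom_inv g a) (isom_inv g b) = mdist a b.
Proof. by rewrite -(isom_dist g) !isom_invK. Qed.

Definition isom_invg (g : isom X) : isom X :=
  Isom (isom_invK g) (isom_funK g) (isom_inv_dist g).

HB.instance Definition _ := gen_eqMixin (isom X).
HB.instance Definition _ := gen_choiceMixin (isom X).

Fact isom_mulA : associative isom_mul.
Proof. by move=> f g h; apply: isom_eq. Qed.
Fact isom_mul1 : left_id isom_one isom_mul.
Proof. by move=> f; apply: isom_eq. Qed.
Fact isom_mulr1 : right_id isom_one isom_mul.
Proof. by move=> f; apply: isom_eq. Qed.
Fact isom_mulV : left_inverse isom_one isom_invg isom_mul.
Proof. by move=> f; apply: isom_eq => z /=; rewrite isom_funK. Qed.
Fact isom_mulrV : right_inverse isom_one isom_invg isom_mul.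
Proof. by move=> f; apply: isom_eq => z /=; rewrite isom_invK. Qed.

HB.instance Definition _ := isGroup.Build (isom X)
  isom_mulA isom_mul1 isom_mulr1 isom_mulV isom_mulrV.

End IsomGroup.

Section GroupTheory.
Variable gT : groupType.
Implicit Types (A B H K : set gT) (g h : gT).

Definition is_subgroup H : Prop :=
  [/\ H 1%g, forall g h, H g -> H h -> H (g * h)%g & forall g, H g -> H g^-1%g].

Definition generated A : set gT :=
  [set g | forall H, is_subgroup H -> A `<=` H -> H g].

Definition finitely_generated H : Prop :=
  exists A, finite_set A /\ H = generated A.

Definition trivial_group H : Prop := H = [set 1%g].

Definition conjugate g H : set gT := [set (g * h * g^-1)%g | h in H].

Definition word_prod (w : seq gT) : gT := foldr (fun g h => (g * h)%g) 1%g w.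

(* H is the internal free product of the subgroups [K i]: they generate H and
   no nonempty reduced alternating word represents 1. *)
Definition free_product (I : eqType) H (K : I -> set gT) : Prop :=
  [/\ forall i, is_subgroup (K i),
      H = generated (\bigcup_i K i) &
      forall w : seq (I * gT), w <> [::] ->
        (forall l, l \in w -> K l.1 l.2 /\ l.2 <> 1%g) ->
        sorted (fun l l' => l.1 != l'.1) w ->
        word_prod (map snd w) <> 1%g].

(* Letters are pairs (basis index, sign), [true] standing for an inverse. *)
Definition free_basis (r : nat) (b : 'I_r -> gT) H : Prop :=
  H = generated (range b) /\
  forall w : seq ('I_r * bool), w <> [::] ->
    sorted (fun l l' => ~~ ((l.1 == l'.1) && (l.2 != l'.2))) w ->
    word_prod [seq if l.2 then (b l.1)^-1%g else b l.1 | l <- w] <> 1%g.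

Definition freely_indecomposable H : Prop :=
  forall A B, free_product H (fun k : bool => if k then A else B) ->
    trivial_group A \/ trivial_group B.

Definition infinite_cyclic H : Prop :=
  exists g, H = generated [set g] /\ forall n : nat, (g ^+ n.+1)%g <> 1%g.

Definition grushko_decomposition (p r : nat) (G : 'I_p -> set gT)
    (b : 'I_r -> gT) H : Prop :=
  (exists F : set gT, free_basis b F /\
     free_product H (fun k : option 'I_p => if k is Some i then G i else F)) /\
  forall i, [/\ ~ trivial_group (G i), freely_indecomposable (G i) &
                ~ infinite_cyclic (G i)].

Definition zpow g (n : int) : gT :=
  match n with Posz m => (g ^+ m)%g | Negz m => (g ^- m.+1)%g end.

Definition lcoset_of g K : set gT := [set (g * k)%g | k in K].

Definition lcosets_of H K : set (set gT) := [set lcoset_of g K | g in H].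

End GroupTheory.

Record sgraph (V E : Type) := SGraph {
  org : E -> V;
  erev : E -> E;
  erevK : involutive erev;
  erev_neq : forall e, erev e <> e }.

Section Graphs.
Variables (V E : Type) (Y : sgraph V E).

Definition ter (e : E) : V := org Y (erev Y e).

Fixpoint edge_path (S : set V) (u : V) (es : seq E) (v : V) : Prop :=
  match es with
  | [::] => S u /\ u = v
  | e :: es' => [/\ S u, org Y e = u & edge_path S (ter e) es' v]
  end.

Fixpoint reduced (es : seq E) : Prop :=
  match es with
  | e :: ((f :: _) as es') => f <> erev Y e /\ reduced es'
  | _ => True
  end.

Definition connected_in (S : set V) : Prop :=
  forall u v, S u -> S v -> exists es, edge_path S u es v.

Definition is_tree : Prop :=
  [/\ exists v : V, True, connected_in setT &
      forall u es, edge_path setT u es u -> reduced es -> es = [::] ].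

End Graphs.

(* An action of the subgroup H of gT on a tree, without inversions; only the
   values of the action maps at elements of H are meaningful. *)
Record gtree (gT : groupType) (H : set gT) := GTree {
  tV : Type;
  tE : Type;
  tG : sgraph tV tE;
  tG_tree : is_tree tG;
  actV : gT -> tV -> tV;
  actE : gT -> tE -> tE;
  actV1 : forall v, actV 1%g v = v;
  actE1 : forall e, actE 1%g e = e;
  actVM : forall g h v, H g -> H h -> actV (g * h)%g v = actV g (actV h v);
  actEM : forall g h e, H g -> H h -> actE (g * h)%g e = actE g (actE h e);
  act_org : forall g e, H g -> org tG (actE g e) = actV g (org tG e);
  act_rev : forall g e, H g -> erev tG (actE g e) = actE g (erev tG e);
  act_noinv : forall g e, H g -> actE g e <> erev tG e }.

Section Trees.
Variables (gT : groupType) (H : set gT).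
Implicit Types (T : gtree H) (S : set gT).

Definition stabV T (v : tV T) : set gT := [set h | H h /\ actV h v = v].
Definition stabE T (e : tE T) : set gT := [set h | H h /\ actE h e = e].

Definition elliptic T S : Prop :=
  exists v : tV T, forall g, S g -> actV g v = v.

Definition minimal_tree T : Prop :=
  forall S : set (tV T), S !=set0 -> connected_in (tG T) S ->
    (forall h v, H h -> S v -> S (actV h v)) -> S = setT.

Definition edge_group_family (Ed : set (set gT)) : Prop :=
  [/\ forall K, Ed K -> is_subgroup K /\ K `<=` H,
      forall h K, H h -> Ed K -> Ed (conjugate h K) &
      forall K L, Ed K -> is_subgroup L -> L `<=` K -> Ed L].

Definition relative_tree (Ed Per : set (set gT)) T : Prop :=
  [/\ minimal_tree T, forall e : tE T, Ed (stabE e) &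
      forall Q, Per Q -> elliptic T Q].

Definition universally_elliptic (Ed Per : set (set gT)) T : Prop :=
  forall T', relative_tree Ed Per T' -> forall e : tE T, elliptic T' (stabE e).

(* An equivariant map on vertices extends to a map of trees by sending each
   edge to the reduced path between the images of its endpoints. *)
Definition dominates T T' : Prop :=
  exists phi : tV T -> tV T',
    forall h v, H h -> phi (actV h v) = actV h (phi v).

(* In the sense of Guirardel and Levitt: a universally elliptic tree that
   dominates all universally elliptic ones, among the minimal trees with edge
   stabilizers in Ed relative to Per. *)
Definition JSJ_tree (Ed Per : set (set gT)) T : Prop :=
  [/\ relative_tree Ed Per T, universally_elliptic Ed Per T &
      forall T', relative_tree Ed Per T' -> universally_elliptic Ed Per T' ->
        dominates T T'].

End Trees.

(* A finite graph-of-groups decomposition of H, given by its Bass--Serre tree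
   [dT] with finite quotient graph [dY] (the projections [pV], [pE] have the
   H-orbits as fibres), together with the choice of a base vertex, lifts of
   vertices and oriented edges, and connecting elements tau. *)
Record decomposition (gT : groupType) (H : set gT) := Decomposition {
  dT : gtree H;
  dV : finType;
  dE : finType;
  dY : sgraph dV dE;
  pV : tV dT -> dV;
  pE : tE dT -> dE;
  pV_org : forall e, pV (org (tG dT) e) = org dY (pE e);
  pE_rev : forall e, pE (erev (tG dT) e) = erev dY (pE e);
  pV_orbit : forall u v, pV u = pV v <-> exists2 h, H h & v = actV h u;
  pE_orbit : forall e f, pE e = pE f <-> exists2 h, H h & f = actE h e;
  base : dV;
  liftV : dV -> tV dT;
  liftE : dE -> tE dT;
  tau : dE -> gT;
  liftVK : forall v, pV (liftV v) = v;
  liftEK : forall f, pE (liftE f) = f;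
  liftE_org : forall f, org (tG dT) (liftE f) = liftV (org dY f);
  tau_in : forall f, H (tau f);
  liftE_ter : forall f, ter (tG dT) (liftE f) = actV (tau f) (liftV (ter dY f));
  liftE_rev : forall f,
    liftE (erev dY f) = actE (tau f)^-1%g (erev (tG dT) (liftE f));
  tau_rev : forall f, tau (erev dY f) = (tau f)^-1%g }.

Section VertexEdgeGroups.
Variables (gT : groupType) (H : set gT) (D : decomposition H).

Definition vgrp (v : dV D) : set gT := stabV (liftV v).
Definition egrp (f : dE D) : set gT := stabE (liftE f).
Definition dorg (f : dE D) : dV D := org (dY D) f.
Definition dter (f : dE D) : dV D := ter (dY D) f.
Definition drev (f : dE D) : dE D := erev (dY D) f.

End VertexEdgeGroups.

(* Finite rooted trees of subgroups; at a splitting node the vertices v with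
   [kids v = Some _] are the selected ones. *)
Inductive hierarchy (gT : groupType) : set gT -> Type :=
| Terminal (H : set gT) : hierarchy H
| Splitting (H : set gT) (D : decomposition H)
    (kids : forall v : dV D, option (hierarchy (vgrp v))) : hierarchy H.

(* [node h D]: D is the decomposition carried by a nonterminal node of h. *)
Inductive node (gT : groupType) :
    forall H : set gT, hierarchy H -> forall K : set gT, decomposition K -> Prop :=
| node_root (H : set gT) (D : decomposition H) kids :
    node (@Splitting gT H D kids) D
| node_below (H : set gT) (D : decomposition H) kids (v : dV D) k
    (K : set gT) (D' : decomposition K) :
    kids v = Some k -> node k D' -> node (@Splitting gT H D kids) D'.

Definition JSJ_stage (gT : groupType) (H : set gT) (h : hierarchy H) : Prop :=
  match h with
  | Terminal _ => True
  | Splitting _ D _ =>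
      exists Ed Per : set (set gT),
        [/\ edge_group_family H Ed, forall Q, Per Q -> is_subgroup Q /\ Q `<=` H
          & JSJ_tree Ed Per (dT D)]
  end.

(* The root splitting realizes the Grushko decomposition: trivial edge groups,
   the G_i up to conjugacy at distinct vertices, trivial groups at all other
   vertices; only factors are selected, and these carry JSJ representatives.
   Nothing is asked of the decompositions further down. *)
Definition grushko_JSJ_hierarchy (gT : groupType) (p : nat)
    (G : 'I_p -> set gT) (H : set gT) (h : hierarchy H) : Prop :=
  match h with
  | Terminal _ => True
  | Splitting H D kids =>
      (forall f : dE D, trivial_group (egrp f)) /\
      exists nu : 'I_p -> dV D,
      [/\ injective nu,
          forall i, exists2 g, H g & vgrp (nu i) = conjugate g (G i),
          forall v, (forall i, nu i <> v) -> trivial_group (vgrp v) /\ kids v = None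
        & forall v k, kids v = Some k -> JSJ_stage k]
  end.

Definition spectral_radius (R : realType) (n : nat) (M : 'M[R]_n) : R :=
  sup [set Normc.normc z | z in [set z : R[i] |
         eigenvalue (map_mx (fun a : R => real_complex R a) M) z] ].

Section Digraphs.
Variables (R : realType) (E : finType).

Definition block_radius (C : {set E}) (M : E -> E -> R) : R :=
  spectral_radius
    (\matrix_(i < #|C|, j < #|C|) M (enum_val i) (enum_val j)).

Definition strong_component (S : {set E}) (r : rel E) (C : {set E}) : Prop :=
  let rS := [rel e f | [&& e \in S, f \in S & r e f] ] in
  exists2 e, e \in S & C = [set f | connect rS e f && connect rS f e]%SET.

Definition has_directed_cycle (r : rel E) (C : {set E}) : Prop :=
  exists c : seq E, [/\ c <> [::], cycle r c & {subset c <= C}].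

End Digraphs.

Section Dynamics.
Variables (R : realType) (X : metricType R).
Implicit Types (x : X) (Gam A : set (isom X)) (g : isom X).

(* The identity is isolated for uniform convergence on compact sets, i.e. for
   the compact-open topology of Isom(X). *)
Definition discrete_group Gam : Prop :=
  exists (K : set X) (eps : R), [/\ compact K, 0 < eps &
    forall g, Gam g -> (forall z, K z -> mdist (g z) z < eps) -> g = 1%g].

Definition orbit_series x (S : set (isom X)) (s : R) : \bar R :=
  (\esum_(g in S) (expR (- s * mdist x (g x)))%:E)%E.

Definition critical_exponent x Gam : \bar R :=
  ereal_inf [set s%:E | s in [set s : R |
               0 < s /\ (orbit_series x Gam s < +oo)%E] ].

(* The index is the exponent n, not the group element. *)
Definition cyclic_series x g (s : R) : \bar R :=
  (\esum_(n in [set n : int | n <> 0%R]) (expR (- s * mdist x (zpow g n x)))%:E)%E.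

(* w / (1 + w) for w >= 0, with value 1 at w = +oo. *)
Definition ratio1 (w : \bar R) : R :=
  match w with | EFin w' => w' / (1 + w') | _ => 1 end.

Definition translation_length g : R := inf (range (fun z => mdist z (g z))).

Definition hyperbolic g : Prop :=
  0 < translation_length g /\ exists z, mdist z (g z) = translation_length g.

(* The union of all axes of g, hence the axis when it is unique. *)
Definition Ax g : set X :=
  [set z | exists c : R -> X, [/\ forall s t, mdist (c s) (c t) = `|s - t|,
     forall t, g (c t) = c (t + translation_length g) & range c z] ].

Definition axis_weight x g : R := translation_length g + 2 * set_dist x (Ax g).

Definition coset_series x A (C0 : set (isom X)) (s : R) : \bar R :=
  (\esum_(c in [set c | lcosets_of A C0 c /\ c <> C0])
     (expR (- s * inf [set mdist x (g x) | g in c]))%:E)%E.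

Definition gromov_product x p q : R := (mdist x p + mdist x q - mdist p q) / 2.

Definition geodesic_ray (c : R -> X) : Prop :=
  forall s t, 0 <= s -> 0 <= t -> mdist (c s) (c t) = `|s - t|.

Definition asymptotic (c c' : R -> X) : Prop :=
  exists M : R, forall t, 0 <= t -> mdist (c t) (c' t) <= M.

Definition boundary : set (set (R -> X)) :=
  [set xi | exists2 c, geodesic_ray c &
     xi = [set c' | geodesic_ray c' /\ asymptotic c c'] ].

Definition converges_to_boundary x (z : nat -> X) (xi : set (R -> X)) : Prop :=
  forall c, xi c -> forall M : R, exists N : nat,
    forall (n : nat) (t : R), (N <= n)%N -> N%:R <= t ->
      M <= gromov_product x (z n) (c t).

Definition limit_set x Gam : set (set (R -> X)) :=
  [set xi | boundary xi /\ exists g : nat -> isom X,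
     (forall n, Gam (g n)) /\ converges_to_boundary x (fun n => g n x) xi].

(* exp(-(xi | eta)_x), the Gromov product on the boundary being the limit of
   (p | q)_x as p tends to xi and q to eta; the value is 0 when the product
   is infinite. *)
Definition bourdon_metric x (xi eta : set (R -> X)) : R :=
  xget 0 [set rho : R | forall c c', xi c -> eta c' -> forall e : R, 0 < e ->
    exists N : R, forall s t, N <= s -> N <= t ->
      `|expR (- gromov_product x (c s) (c' t)) - rho| < e].

Definition non_elementary x Gam : Prop :=
  exists xi1 xi2 xi3, [/\ limit_set x Gam xi1, limit_set x Gam xi2,
    limit_set x Gam xi3 & [/\ xi1 <> xi2, xi1 <> xi3 & xi2 <> xi3] ].

Definition convex_cobounded x Gam : Prop :=
  exists R' : R, forall g h, Gam g -> Gam h ->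
    segment (g x) (h x) `<=`
      \bigcup_(k in Gam) (k @` [set z | mdist x z < R']).

End Dynamics.

Section HausdorffDimension.
Variables (R : realType) (T : Type) (rho : T -> T -> R).
Implicit Types (A U : set T).

Definition diameter U : \bar R :=
  ereal_sup [set d | d = 0%E \/ exists a b, [/\ U a, U b & d = (rho a b)%:E] ].

Definition hausdorff_content (s eps : R) A : \bar R :=
  ereal_inf [set v | exists U : nat -> set T,
    [/\ A = \bigcup_n U n, forall n, (diameter (U n) <= eps%:E)%E &
        v = (\sum_(0 <= n <oo) poweR (diameter (U n)) s)%E] ].

Definition hausdorff_measure (s : R) A : \bar R :=
  ereal_sup [set hausdorff_content s eps A | eps in [set eps : R | 0 < eps] ].

Definition hausdorff_dim A : \bar R :=
  ereal_inf [set s%:E | s in [set s : R | 0 < s /\ hausdorff_measure s A = 0%E] ].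

End HausdorffDimension.

Section NodeMatrices.
Variables (R : realType) (X : metricType R) (x : X).
Variables (H : set (isom X)) (D : decomposition H).
Implicit Types (e f : dE D) (c : set (isom X)) (C : {set dE D}).

Definition relative_coset f c : Prop := lcosets_of (vgrp (dorg f)) (egrp f) c.

(* For c = r G_f, the elements r h with h in G_f are those of c; in a properly
   discontinuous action the infimum is a minimum. *)
Definition coset_length f c : R := inf [set mdist x ((g * tau f)%g x) | g in c].

Definition allowed e f c : Prop :=
  [/\ dter e = dorg f, relative_coset f c & f = drev e -> c <> egrp f].

Definition rel_matrix (s : R) e f : \bar R :=
  (\esum_(c in allowed e f) (expR (- s * coset_length f c))%:E)%E.

Definition coset_loop (w : seq (dE D * set (isom X))) : Prop :=
  match w with
  | [::] => False
  | l :: w' =>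
      [/\ dorg l.1 = base D, dter (last l w').1 = base D,
          forall l', l' \in w -> relative_coset l'.1 l'.2 &
          path (fun l1 l2 => `[< allowed l1.1 l2.1 l2.2 >]) l w']
  end.

Definition state_set : {set dE D} :=
  [set f | `[< exists2 w, coset_loop w & f \in map fst w >] ]%SET.

(* e -> f when K_ef, as a function of s, is not zero. *)
Definition transition_rel : rel (dE D) :=
  fun e f => `[< exists s : R, rel_matrix s e f <> 0%E >].

Definition component C : Prop := strong_component state_set transition_rel C.

Definition hyperbolic_rep f c (g : isom X) : Prop :=
  hyperbolic g /\ exists2 k, c k & g = (k * tau f)%g.

(* The cosets [F e f] and representatives [rep e f c] matter only for e, f in
   C and c in [F e f]. *)
Definition finite_choice C (F : dE D -> dE D -> {fset set (isom X)})
    (rep : dE D -> dE D -> set (isom X) -> isom X) : Prop :=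
  forall e f c, e \in C -> f \in C -> c \in F e f ->
    allowed e f c /\ hyperbolic_rep f c (rep e f c).

Definition comparison_matrix (F : dE D -> dE D -> {fset set (isom X)})
    (rep : dE D -> dE D -> set (isom X) -> isom X) (s : R) e f : R :=
  \sum_(c <- F e f) expR (- s * axis_weight x (rep e f c)).

Definition critical_parameter C F rep : \bar R :=
  ereal_inf [set s%:E | s in [set s : R |
    0 < s /\ block_radius C (comparison_matrix F rep s) < 1] ].

Definition one_edge_segment f : Prop :=
  [/\ dorg f <> dter f, forall v : dV D, v = dorg f \/ v = dter f &
      forall e, e = f \/ e = drev f].

Definition one_edge_loop f : Prop :=
  (forall v w : dV D, v = w) /\ forall e, e = f \/ e = drev f.

Definition hashimoto_rel : rel (dE D) :=
  fun e f => (dter e == dorg f) && (f != drev e).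

Definition hashimoto e f : R := (hashimoto_rel e f)%:R.

End NodeMatrices.

Arguments transition_rel {R X} x {H} D e f.
Arguments hashimoto_rel {R X H} D e f.
Arguments hashimoto {R X H} D e f.

(* Main.v *)
Require Import Defs.
From mathcomp Require Import all_boot all_order all_algebra.
From mathcomp Require Import finmap.
From mathcomp Require Import all_classical all_reals all_analysis.
From mathcomp Require Import complex.
From mathcomp Require Import ring lra zify.
Set Implicit Arguments.
Unset Strict Implicit.
Unset Printing Implicit Defensive.
Import Order.TTheory GRing.Theory Num.Theory.
Import numFieldNormedType.Exports.
Local Open Scope classical_set_scope.
Local Open Scope ring_scope.

(** All the inequalities come from one counting principle.  A finite automaton
   whose transitions e -> f are labelled by finitely many elements of Gam has,
   at each s, the matrix of the sums of exp(-s d(x, gx)) over the labels g.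
   Because d(x, ghx) <= d(x, gx) + d(x, hx), the row sums of its n-th power are
   at most the sum of exp(-s d(x, wx)) over the words w of length n.  If words
   with the same ends are determined by their value in Gam, that sum is at most
   a constant times the orbit series, which converges for s > delta.  Letting s
   decrease to delta, at the cost of a factor th ^ n with th > 1 arbitrarily
   close to 1, the matrix at delta has row sums growing subexponentially
   (label_matrix_subexponential).  Hence its spectral radius is at most one, the
   weight of every cycle is at most one (cycle_weight_le1), and K v >= S v with
   0 < v <= 1 forces S <= 1 (rowsum_eigvec).

   Unique reading of words has two sources.  In a graph-of-groups
   decomposition, an allowed sequence of coset labels traces a reduced path in
   the Bass--Serre tree, and reduced paths in a tree are determined by their
   ends (tree_words_injective); infinite sums are then exhausted by finite sets
   of labels.  This gives the bounds on the relative matrices, the amalgam, HNN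
   and Hashimoto inequalities.  In a free product, alternating words are
   reduced; applied to the free factors G_i and the cyclic groups generated by
   the x_j, with v_i = 1 / (1 + w_i), the principle is the first inequality.
   Weights of hyperbolic representatives compare with displacements through
   d(x, gx) <= a_x(g) (disp_le_axis_weight), which needs the existence of an
   axis; it is built from the translates of a segment of minimal displacement.

   The geometry of X enters through a single estimate: by comparison with the
   hyperbolic plane, geodesics from o to y and to w are at distance at most
   2 exp(t - (y|w)_o) at time t (geodesic_contraction).  It yields Gromov
   hyperbolicity with explicit constants, rays towards sequences whose Gromov
   products diverge, and the existence of the limit defining the Bourdon
   metric.

   For the Hausdorff dimension of the limit set, upper bounds are covers.  If
   the action is convex-cobounded, every limit point lies in the shadow of an
   orbit point arbitrarily far away, and the shadow of gx has diameter about
   exp(-d(x, gx)), so that the s-th powers of the diameters sum up to a tail of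
   the orbit series.  If delta < 1, take delta < s < 1 and cover by the limit
   sets of the components of a coarse orbit graph outside a large ball; a chain
   of short steps far from x subtends a small visual angle (gp_chain), and for
   s <= 1 the s-th power of the diameter is controlled by the part of the orbit
   series carried by the component.

   The lower bound constructs, for s < delta, a finite set F of elements of Gam,
   of displacement at most Lb and with at least exp(s Lb) elements, all of whose
   words are spread out like the vertices of a regular tree (schottky_family).
   The elements come from a heavy annulus of the orbit by the pigeonhole
   principle on the directions of gx and g^-1 x, after multiplication by an
   element that separates the two common directions.  That finitely many
   elements suffice to separate any two directions (transversality) is where
   the action being non-elementary is used: otherwise some direction would be
   almost fixed by all of Gam, and its Busemann quasi-character would either be
   bounded, leaving a single limit point, or make the orbit grow linearly.
   Infinite words in F form a Cantor set of limit points, of positive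
   s-dimensional Hausdorff measure by a mass distribution argument
   (mass_distribution). *)

(** * Sums over sets and growth of nonnegative matrices *)

Section SumsOverSets.
Variables (R : realType) (T : choiceType).
Implicit Types (S : set T) (a : T -> R) (s : seq T).

Lemma esum_le_seq S a (M : R) :
  (forall s, uniq s -> (forall t, t \in s -> S t) -> \sum_(t <- s) a t <= M) ->
  (\esum_(t in S) (a t)%:E <= M%:E)%E.
Proof.
move=> H; apply: ge_ereal_sup => _ [F [finF FS] <-].
rewrite fsbig_finite //= sumEFin lee_fin; apply: H => //.
by move=> t; rewrite in_fset_set // => /set_mem /FS.
Qed.

Lemma seq_le_esum S a s : uniq s -> (forall t, t \in s -> S t) ->
  ((\sum_(t <- s) a t)%:E <= \esum_(t in S) (a t)%:E)%E.
Proof.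
move=> us sS; apply: ereal_sup_ubound; exists [set` s]; last first.
  by rewrite -fsbig_seq // sumEFin.
by split=> //; exact: finite_seq.
Qed.

Lemma esum_EFin_ge0 S a : (forall t, 0 <= a t) ->
  (0 <= \esum_(t in S) (a t)%:E)%E.
Proof. by move=> a0; apply: esum_ge0 => t _; rewrite lee_fin. Qed.

Lemma esum_fin_approx S a (e : R) : (forall t, 0 <= a t) -> 0 < e ->
  (\esum_(t in S) (a t)%:E < +oo)%E ->
  exists s, [/\ uniq s, forall t, t \in s -> S t &
    (\esum_(t in S) (a t)%:E <= (\sum_(t <- s) a t + e)%:E)%E].
Proof.
move=> a0 e0 fin; apply: contrapT => nex.
have W0 := esum_EFin_ge0 S a0.
have Wf : (\esum_(t in S) (a t)%:E)%E \is a fin_num by rewrite ge0_fin_numE.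
have : (\esum_(t in S) (a t)%:E <= (fine (\esum_(t in S) (a t)%:E) - e)%:E)%E.
  apply: esum_le_seq => s us sS; rewrite leNgt; apply/negP => lt; apply: nex.
  by exists s; split=> //; rewrite -(fineK Wf) lee_fin -lerBlDr ltW.
by rewrite -{1}(fineK Wf) lee_fin; lra.
Qed.

End SumsOverSets.

Section RowSums.
Variables (R : realType) (Q : finType).
Implicit Types (K L : Q -> Q -> R) (e f : Q).

(** The row sums of the n-th power of K. *)
Fixpoint rowsum K n e : R :=
  if n is n'.+1 then \sum_f K e f * rowsum K n' f else 1.

Definition nonneg K := forall e f, 0 <= K e f.

(** Spectral radius at most 1, phrased without eigenvalues: the property
   passes to entrywise smaller matrices and to conjugates by positive diagonal
   matrices. *)
Definition subexponential K :=
  forall th : R, 1 < th -> exists B : R, forall n e, rowsum K n e <= B * th ^+ n.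

Lemma rowsum_ge0 K n e : nonneg K -> 0 <= rowsum K n e.
Proof.
by move=> K0; elim: n e => [|n IH] e //=; apply: sumr_ge0 => f _; rewrite mulr_ge0.
Qed.

(** The factors u telescope along every walk, so that conjugating by a
   diagonal matrix changes row sums only through the end points. *)
Lemma rowsum_conj K L (u : Q -> R) (a m : R) n e :
  nonneg K -> nonneg L -> 0 <= a -> 0 < m -> (forall e, m <= u e) ->
  (forall e f, K e f * u f <= a * (u e * L e f)) ->
  rowsum K n e * m <= a ^+ n * (u e * rowsum L n e).
Proof.
move=> K0 L0 a0 m0 mu KL.
elim: n e => [|n IH] e; first by rewrite /= !mul1r mulr1.
rewrite /= mulr_suml !mulr_sumr; apply: ler_sum => f _.
apply: (@le_trans _ _ (K e f * (a ^+ n * (u f * rowsum L n f)))).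
  by rewrite -mulrA ler_wpM2l.
have -> : K e f * (a ^+ n * (u f * rowsum L n f)) =
  (K e f * u f) * (a ^+ n * rowsum L n f) by ring.
have -> : a ^+ n.+1 * (u e * (L e f * rowsum L n f)) =
  (a * (u e * L e f)) * (a ^+ n * rowsum L n f) by rewrite exprS; ring.
by rewrite ler_wpM2r // mulr_ge0 ?exprn_ge0 // rowsum_ge0.
Qed.

Lemma rowsum_scale K L (a : R) n e :
  nonneg K -> nonneg L -> 0 <= a -> (forall e f, K e f <= a * L e f) ->
  rowsum K n e <= a ^+ n * rowsum L n e.
Proof.
move=> K0 L0 a0 KL.
have := @rowsum_conj K L (fun=> 1) a 1 n e K0 L0 a0 ltr01 (fun=> lexx _).
by rewrite mulr1 mul1r; apply=> i j; rewrite mulr1 mul1r.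
Qed.

Lemma exp_lt_exp (q b B : R) : 0 < b -> 1 < q -> exists n, B < b * q ^+ n.
Proof.
move=> b0 q1.
have bern n : 1 + n%:R * (q - 1) <= q ^+ n.
  elim: n => [|n IH]; first by rewrite mul0r addr0.
  rewrite exprS -natr1; apply: (@le_trans _ _ (q * (1 + n%:R * (q - 1)))).
    have : 0 <= n%:R * (q - 1) * (q - 1) by rewrite !mulr_ge0 // ?subr_ge0 ltW.
    by nra.
  by rewrite ler_pM2l // (lt_trans ltr01).
exists (Num.truncn (`|B| / b / (q - 1))).+1.
set n := (Num.truncn _).+1.
have hn : `|B| / b / (q - 1) < n%:R by apply: truncnS_gt.
have q0 : 0 < q - 1 by rewrite subr_gt0.
rewrite ltr_pdivrMr // ltr_pdivrMr // in hn.
apply: (le_lt_trans (ler_norm B)); apply: (lt_le_trans hn).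
rewrite mulrC ler_pM2l //; apply: le_trans (bern n); lra.
Qed.

(** If q > 1, the hypothesis at th = (1 + q) / 2 is violated for large n. *)
Lemma growth_le (b B q : R) : 0 < b -> 0 <= q ->
  (forall th, 1 < th -> exists B', forall n, b * q ^+ n <= B' * th ^+ n) -> q <= 1.
Proof.
move=> b0 q0 H; rewrite leNgt; apply/negP => q1.
pose th := (1 + q) / 2.
have th1 : 1 < th by rewrite /th; lra.
have [B' HB] := H _ th1.
have r1 : 1 < q / th by rewrite ltr_pdivlMr /th; lra.
have [n] := exp_lt_exp B' b0 r1.
have th0 : 0 < th ^+ n by rewrite exprn_gt0 // (lt_trans ltr01).
rewrite expr_div_n mulrA ltr_pdivlMr // => /lt_le_trans /(_ (HB n)).
by rewrite ltxx.
Qed.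

Lemma subexponential_le K L (u : Q -> R) (a m : R) :
  nonneg K -> nonneg L -> 0 <= a -> 0 < m -> (forall e, m <= u e) ->
  (forall e f, K e f * u f <= a * (u e * L e f)) -> subexponential L ->
  forall th : R, 1 < th -> exists B : R, forall n e, rowsum K n e <= B * (a * th) ^+ n.
Proof.
move=> K0 L0 a0 m0 mu KL sL th th1.
have [B HB] := sL _ th1.
exists ((\sum_e u e) * B / m) => n e.
have u0 i : 0 <= u i by rewrite (le_trans (ltW m0)).
have B0 : 0 <= B by have := HB 0%N e; rewrite /= expr0 mulr1; lra.
rewrite mulrAC ler_pdivlMr // (le_trans (rowsum_conj n e K0 L0 a0 m0 mu KL)) //.
have -> : (\sum_e0 u e0) * B * (a * th) ^+ n = a ^+ n * ((\sum_e0 u e0) * (B * th ^+ n)).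
  by rewrite exprMn; ring.
rewrite ler_wpM2l ?exprn_ge0 //.
apply: ler_pM => //; first exact: rowsum_ge0.
by rewrite (bigD1 e) //= lerDl sumr_ge0.
Qed.

Lemma subexponential_mono K L : nonneg K -> (forall e f, K e f <= L e f) ->
  subexponential L -> subexponential K.
Proof.
move=> K0 KL sL th th1; have [B HB] := sL _ th1.
exists B => n e; apply: le_trans (HB n e).
have L0 : nonneg L by move=> i j; apply: le_trans (KL i j).
by have := @rowsum_scale K L 1 n e K0 L0 ler01; rewrite expr1n mul1r; apply=> i j; rewrite mul1r.
Qed.

Lemma rowsum_walk K (c : nat -> Q) n : nonneg K ->
  \prod_(i < n) K (c i) (c i.+1) <= rowsum K n (c 0%N).
Proof.
move=> K0; elim: n c => [|n IH] c; first by rewrite big_ord0.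
rewrite big_ord_recl /= (bigD1 (c 1%N)) //=.
apply: (@le_trans _ _ (K (c 0%N) (c 1%N) * rowsum K n (c 1%N))); last first.
  by rewrite lerDl sumr_ge0 // => f _; rewrite mulr_ge0 // rowsum_ge0.
by rewrite ler_wpM2l //; exact: (IH (fun i => c i.+1)).
Qed.

(** Going round the cycle k times is a single walk, so the k-th power of the
   weight of the cycle is at most a row sum, and grows subexponentially. *)
Lemma cycle_weight_le1 K m (cyc : 'I_m.+1 -> Q) : nonneg K -> subexponential K ->
  \prod_(i < m.+1) K (cyc i) (cyc (ordS i)) <= 1.
Proof.
move=> K0 sK.
pose c n := cyc (inord (n %% m.+1)).
have cE (i : 'I_m.+1) k : c (k * m.+1 + i)%N = cyc i.
  by rewrite /c modnMDl modn_small // inord_val.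
have cSE (i : 'I_m.+1) k : c (k * m.+1 + i).+1 = cyc (ordS i).
  rewrite /c -addnS modnMDl; congr cyc; apply: val_inj.
  by rewrite /= inordK // ltn_mod.
set p := \prod_(i < m.+1) _.
have pE k : \prod_(i < k * m.+1) K (c i) (c i.+1) = p ^+ k.
  elim: k => [|k IH]; first by rewrite mul0n big_ord0.
  rewrite mulSn addnC -(big_mkord xpredT (fun i => K (c i) (c i.+1))).
  rewrite (@big_cat_nat _ _ _ (k * m.+1)) ?leq_addr //= big_mkord IH exprSr.
  congr (_ * _); rewrite -{1}[(k * m.+1)%N]add0n big_addn addKn big_mkord.
  by apply: eq_bigr => i _; rewrite addnC cE cSE.
have p0 : 0 <= p by apply: prodr_ge0.
rewrite leNgt; apply/negP => p1.
pose th := expR (ln p / (2 * m.+1%:R)).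
have lp : 0 < ln p by rewrite ln_gt0.
have th1 : 1 < th by rewrite -expR0 ltr_expR divr_gt0 // mulr_gt0.
have thm : th ^+ m.+1 = expR (ln p / 2).
  rewrite -expRM_natl; congr expR.
  have : m.+1%:R != 0 :> R by rewrite pnatr_eq0.
  by move: m.+1%:R => M M0; field.
have [B HB] := sK _ th1.
have q1 : 1 < p / th ^+ m.+1.
  rewrite thm ltr_pdivlMr ?expR_gt0 // mul1r -[ltRHS]lnK ?posrE //; last lra.
  by rewrite ltr_expR; lra.
have [k] := exp_lt_exp B ltr01 q1.
have t0 : 0 < (th ^+ m.+1) ^+ k by rewrite !exprn_gt0 // (lt_trans ltr01).
rewrite mul1r expr_div_n ltr_pdivlMr // -exprM => Blt.
have := le_trans (rowsum_walk c (k * m.+1) K0) (HB _ _).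
by rewrite pE mulnC => /(lt_le_trans Blt); rewrite ltxx.
Qed.

(** Iterating the last hypothesis bounds the n-th row sum at e below by
   S ^ n v(e), which grows subexponentially only if S <= 1. *)
Lemma rowsum_eigvec K (v : Q -> R) (S : R) (e : Q) : nonneg K -> subexponential K -> 0 <= S ->
  (forall e, 0 < v e <= 1) -> (forall e, S * v e <= \sum_f K e f * v f) -> S <= 1.
Proof.
move=> K0 sK S0 v01 Kv.
apply: (@growth_le (v e) 0) => //; first by case/andP: (v01 e).
move=> th th1; have [B HB] := sK _ th1; exists B => n; apply: le_trans (HB n e).
elim: n e {HB} => [|n IH] e; first by rewrite expr0 mulr1; case/andP: (v01 e).
have -> : v e * S ^+ n.+1 = S ^+ n * (S * v e) by rewrite exprSr; ring.
apply: (@le_trans _ _ (S ^+ n * \sum_f K e f * v f)).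
  by rewrite ler_wpM2l ?exprn_ge0.
rewrite mulr_sumr /=; apply: ler_sum => f _.
by rewrite mulrCA ler_wpM2l // mulrC IH.
Qed.

End RowSums.

Section SpectralRadius.
Variable R : realType.

(** For a left eigenvector v of z, the triangle inequality gives
   |z|^k sum |v_i| <= sum |v_i| r_i(k), where r_i(k) are the row sums of M^k. *)
Lemma spectral_radius_le n (M : 'M[R]_n) (a : R) : 0 <= a ->
  (forall i j, 0 <= M i j) ->
  (forall th : R, 1 < th -> exists B : R, forall k i, rowsum (fun i j => M i j) k i <= B * (a * th) ^+ k) ->
  spectral_radius M <= a.
Proof.
move=> a0 M0 H; rewrite /spectral_radius.
set A := [set _ | _ in _].
case: (pselect (A !=set0)) => [Ane|/set0P/negP/negPn/eqP ->]; last by rewrite sup0.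
apply: ge_sup => // _ [z /= /eigenvalueP[v vM vn0] <-].
have step j : Normc.normc z * Normc.normc (v 0 j) <= \sum_i Normc.normc (v 0 i) * M i j.
  rewrite -Normc.normcM.
  have -> : z * v 0 j = \sum_i v 0 i * (M i j)%:C%C.
    have := congr1 (fun w : 'rV_n => w 0 j) vM; rewrite !mxE => <-.
    by apply: eq_bigr => i _; rewrite mxE.
  have nsum (I : finType) (F : I -> R[i]) : Normc.normc (\sum_i F i) <= \sum_i Normc.normc (F i).
    elim/big_ind2: _ => [|x1 x2 y1 y2 h1 h2|//]; first by rewrite Normc.normc0.
    by apply: le_trans (le_normcD _ _) _; exact: lerD.
  apply: le_trans (nsum _ _) _; apply: ler_sum => i _.
  rewrite Normc.normcM ler_wpM2l // ?/Normc.normc; first by case: (v 0 i) => p q; exact: sqrtr_ge0.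
  by rewrite /= expr0n /= addr0 sqrtr_sqr ger0_norm.

have nc0 (w : R[i]) : 0 <= Normc.normc w by case: w => p q; exact: sqrtr_ge0.
pose V := \sum_i Normc.normc (v 0 i).
have V0 : 0 < V.
  rewrite lt_neqAle sumr_ge0 ?andbT //; apply: contraNneq vn0 => /esym V0.
  apply/eqP/rowP => i; rewrite mxE; apply: Normc.eq0_normc.
  apply/eqP; rewrite eq_le nc0 andbT -V0 /V (bigD1 i) //= lerDl.
  exact: sumr_ge0.
pose r k i := rowsum (fun i j => M i j) k i.
have grow k : Normc.normc z ^+ k * V <= \sum_i Normc.normc (v 0 i) * r k i.
  elim: k => [|k IH].
    by rewrite expr0 mul1r; apply: ler_sum => i _; rewrite mulr1.
  rewrite exprS -mulrA; apply: le_trans (ler_wpM2l (nc0 z) IH) _.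
  rewrite mulr_sumr; under [leRHS]eq_bigr do rewrite mulr_sumr.
  rewrite exchange_big; apply: ler_sum => j _ /=.
  have rj0 : 0 <= r k j by apply: rowsum_ge0.
  rewrite mulrA; apply: le_trans (ler_wpM2r rj0 (step j)) _.
  by rewrite mulr_suml; apply: ler_sum => i _; rewrite mulrA.
have nth th : 1 < th -> Normc.normc z <= a * th.
  move=> th1; have [B HB] := H _ th1.
  have at0 : 0 <= a * th by rewrite mulr_ge0 // ltW // (lt_trans ltr01).
  have bnd k : Normc.normc z ^+ k <= B * (a * th) ^+ k.
    rewrite -(ler_pM2r V0); apply: le_trans (grow k) _.
    rewrite mulrC mulr_suml; apply: ler_sum => i _.
    by rewrite ler_wpM2l // HB.
  rewrite leNgt; apply/negP => ltz.
  have z0 : 0 < Normc.normc z by apply: le_lt_trans ltz.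
  move: at0; rewrite le_eqVlt => /predU1P[/esym at0|at0].
    have := bnd 1%N; rewrite at0 !expr1 mulr0.
    by rewrite leNgt z0.
  have q1 : 1 < Normc.normc z / (a * th) by rewrite ltr_pdivlMr // mul1r.
  have [k] := exp_lt_exp B ltr01 q1.
  by rewrite mul1r expr_div_n ltr_pdivlMr ?exprn_gt0 // ltNge bnd.
apply/ler_addgt0Pr => e e0.
have ea : 0 < e / (a + 1) by rewrite divr_gt0 // ltr_wpDl.
apply: le_trans (nth (1 + e / (a + 1)) _) _; first by rewrite ltrDl.
rewrite mulrDr mulr1 lerD2l mulrA ler_pdivrMr ?ltr_wpDl //.
by rewrite mulrC ler_pM2l // lerDl.
Qed.

Lemma block_radius_le (E : finType) (C : {set E}) (M : E -> E -> R) (a : R) : 0 <= a ->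
  (forall e f, 0 <= M e f) ->
  (forall th : R, 1 < th -> exists B : R, forall k i,
     rowsum (fun i j : 'I_#|C| => M (enum_val i) (enum_val j)) k i <= B * (a * th) ^+ k) ->
  block_radius C M <= a.
Proof.
move=> a0 M0 H; apply: spectral_radius_le => // [i j|th th1]; first by rewrite mxE.
have [B HB] := H th th1; exists B => k i; apply: le_trans (HB k i).
rewrite le_eqVlt; apply/orP; left; apply/eqP.
elim: k i {HB} => //= k IH i; apply: eq_bigr => j _; by rewrite mxE IH.
Qed.

Lemma block_radius_scale (E : finType) (C : {set E}) (M L : E -> E -> R) (a : R) : 0 <= a ->
  (forall e f, 0 <= M e f) -> (forall e f, 0 <= L e f) ->
  (forall e f, e \in C -> f \in C -> M e f <= a * L e f) ->
  subexponential (fun i j : 'I_#|C| => L (enum_val i) (enum_val j)) ->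
  block_radius C M <= a.
Proof.
move=> a0 M0 L0 ML sL; apply: block_radius_le => //.
apply: (@subexponential_le _ _ _ (fun i j : 'I_#|C| => L (enum_val i) (enum_val j))
  (fun=> 1) a 1) => // i j.
by rewrite mulr1 mul1r ML // enum_valP.
Qed.

End SpectralRadius.

(** * Words in the group and the orbit series *)

Section WordCounting.
Variables (R : realType) (X : metricType R) (x : X) (Gam : set (isom X)).
Implicit Types (g h : isom X) (s : R).

Lemma isomKV g z : g ((g^-1)%g z) = z. Proof. exact: isom_invK. Qed.

Definition disp g : R := mdist x (g x).

Lemma disp_ge0 g : 0 <= disp g. Proof. exact: mdist_ge0. Qed.

Lemma dispM g h : disp (g * h)%g <= disp g + disp h.
Proof. by apply: le_trans (metric_triangle _ (g x) _) _; rewrite /= isom_dist. Qed.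

Lemma disp1 : disp 1%g = 0. Proof. exact: mdistxx. Qed.

Lemma dispV g : disp g^-1%g = disp g.
Proof. by rewrite /disp -[LHS](isom_dist g) isomKV metric_sym. Qed.

Lemma critical_exponent_lt (d : R) : critical_exponent x Gam = d%:E ->
  forall eta, 0 < eta -> exists s,
    [/\ d <= s, s < d + eta, 0 < s & (orbit_series x Gam s < +oo)%E].
Proof.
move=> cE eta eta0.
have : (critical_exponent x Gam < (d + eta)%:E)%E by rewrite cE lte_fin ltrDl.
rewrite /critical_exponent => /ereal_inf_lt [_ [s [s0 sfin] <-]].
rewrite lte_fin => slt; exists s; split=> //.
have : (critical_exponent x Gam <= s%:E)%E by apply: ereal_inf_lbound; exists s.
by rewrite cE lee_fin.
Qed.

Lemma critical_exponent_ge (d s : R) : critical_exponent x Gam = d%:E ->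
  0 < s -> s < d -> ~ (orbit_series x Gam s < +oo)%E.
Proof.
move=> cE s0 sd sfin.
have : (critical_exponent x Gam <= s%:E)%E by apply: ereal_inf_lbound; exists s.
by rewrite cE lee_fin leNgt sd.
Qed.

Lemma orbit_series_le s : (orbit_series x Gam s < +oo)%E ->
  exists P : R, 0 <= P /\ forall l, uniq l -> (forall g, g \in l -> Gam g) ->
    \sum_(g <- l) expR (- s * disp g) <= P.
Proof.
move=> fin; exists (fine (orbit_series x Gam s)).
have P0 : (0 <= orbit_series x Gam s)%E by apply: esum_EFin_ge0 => g; apply: expR_ge0.
split=> [|l ul lG]; first by rewrite fine_ge0.
by rewrite -lee_fin fineK ?ge0_fin_numE //; exact: seq_le_esum.
Qed.

Variables (T : eqType) (Q : finType) (lab : Q -> Q -> seq T) (el : Q -> Q -> T -> isom X).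

(** A finite automaton: in state e one may read a label t of lab e f, which
   stands for the group element el e f t, and pass to state f. *)
Definition label_matrix s e f : R := \sum_(t <- lab e f) expR (- s * disp (el e f t)).

Definition steps e : seq (Q * T) := [seq (q, t) | q <- enum Q, t <- lab e q].

Fixpoint words n e : seq (seq (Q * T)) :=
  if n is n'.+1 then [seq l :: w | l <- steps e, w <- words n' l.1] else [:: [::]].

Fixpoint word_elt e (w : seq (Q * T)) : isom X :=
  if w is l :: w' then (el e l.1 l.2 * word_elt l.1 w')%g else 1%g.

(** Words with the same value may still end in different states; as there are
   finitely many states, this does not affect growth. *)
Definition words_injective := forall n e w w', w \in words n e -> w' \in words n e ->
  last e (map fst w) = last e (map fst w') -> word_elt e w = word_elt e w' -> w = w'.

Hypothesis labU : forall e f, uniq (lab e f).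
Hypothesis elG : forall e f t, t \in lab e f -> Gam (el e f t).
Hypothesis inj : words_injective.
Hypothesis Gsub : is_subgroup Gam.

Lemma label_matrix_nonneg s : nonneg (label_matrix s).
Proof. by move=> e f; apply: sumr_ge0 => t _; exact: expR_ge0. Qed.

Lemma mem_steps e l : (l \in steps e) = (l.2 \in lab e l.1).
Proof.
apply/allpairsPdep/idP => [[q [t [_ ht ->]]] //|].
by case: l => q t /= ht; exists q, t; rewrite mem_enum.
Qed.

Lemma words_uniq n e : uniq (words n e).
Proof.
elim: n e => [|n IH] e //=; apply: allpairs_uniq_dep => //; last first.
  by move=> /= [l w] [l' w'] _ _ /= [-> ->].
apply: allpairs_uniq_dep => //; first exact: enum_uniq.
by move=> /= [q t] [q' t'] _ _ /= [-> ->].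
Qed.

Lemma word_elt_in n e w : w \in words n e -> Gam (word_elt e w).
Proof.
have [G1 GM _] := Gsub.
elim: n e w => [|n IH] e w /=; first by rewrite inE => /eqP ->.
case/allpairsPdep => l [w' [ls w's ->]] /=; apply: GM; last exact: IH.
by apply: elG; rewrite -mem_steps.
Qed.

(** Displacement is subadditive along a word. *)
Lemma rowsum_words s n e : 0 <= s ->
  rowsum (label_matrix s) n e <= \sum_(w <- words n e) expR (- s * disp (word_elt e w)).
Proof.
move=> s0; elim: n e => [|n IH] e.
  by rewrite /= big_seq1 /= disp1 mulr0 expR0.
rewrite /= big_allpairs_dep /= big_allpairs_dep big_enum; apply: ler_sum => f _ /=.
rewrite mulr_suml; apply: ler_sum => t _.
apply: le_trans (ler_wpM2l (expR_ge0 _) (IH f)) _.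
rewrite mulr_sumr; apply: ler_sum => w _.
rewrite -expRD ler_expR -mulrDr !mulNr lerN2 ler_wpM2l //; exact: dispM.
Qed.

(** Words with a given last state have distinct values in Gam, so that their
   total weight is a partial sum of the orbit series. *)
Lemma rowsum_bound s : 0 <= s -> (orbit_series x Gam s < +oo)%E ->
  exists B, forall n e, rowsum (label_matrix s) n e <= B.
Proof.
move=> s0 /orbit_series_le[P [P0 HP]]; exists (#|Q|%:R * P) => n e.
apply: le_trans (rowsum_words n e s0) _.
rewrite (partition_big (fun w => last e (map fst w)) xpredT) //=.
rewrite mulr_natl -sumr_const; apply: ler_sum => q _.
rewrite -big_filter -(big_map (word_elt e) xpredT (fun g => expR (- s * disp g))).
apply: HP => [|g /mapP[w]]; last by rewrite mem_filter => /andP[_ /word_elt_in ? ->].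
rewrite map_inj_in_uniq ?filter_uniq ?words_uniq // => w w'.
rewrite !mem_filter => /andP[/eqP lw wn] /andP[/eqP lw' w'n].
by apply: inj wn w'n _; rewrite lw lw'.
Qed.

(** The comparison at the critical exponent d itself is reached from the
   convergent parameters s > d, at the cost of a factor close to 1. *)
Theorem label_matrix_subexponential d : 0 < d -> critical_exponent x Gam = d%:E ->
  subexponential (label_matrix d).
Proof.
move=> d0 cE th th1.
pose L := 1 + \sum_e \sum_f \sum_(t <- lab e f) disp (el e f t).
have L1 : 1 <= L.
  by rewrite lerDl; do 3!(apply: sumr_ge0 => ? _); exact: disp_ge0.
have hL e f t : t \in lab e f -> disp (el e f t) <= L.
  move=> ht; rewrite /L (bigD1 e) //= (bigD1 f) //= (big_rem t) //=.
  rewrite -!addrA [1 + _]addrCA lerDl !addr_ge0 //; repeat (apply: sumr_ge0 => ? _ //); exact: disp_ge0.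
have lth : 0 < ln th by rewrite ln_gt0.
have [s [ds slt s0 sfin]] := critical_exponent_lt cE (divr_gt0 lth (lt_le_trans ltr01 L1)).
have [B HB] := rowsum_bound (ltW s0) sfin.
exists B => n e.
have th0 : 0 <= th by rewrite ltW // (lt_trans ltr01).
apply: (@le_trans _ _ (th ^+ n * rowsum (label_matrix s) n e)); last first.
  by rewrite mulrC ler_wpM2r ?exprn_ge0.
apply: rowsum_scale => // [||i j]; try exact: label_matrix_nonneg.
rewrite /label_matrix mulr_sumr big_seq [leRHS]big_seq; apply: ler_sum => t ht.
rewrite -{1}[th]lnK ?posrE ?(lt_trans ltr01) // -expRD ler_expR.
have := hL _ _ _ ht; have := disp_ge0 (el i j t).
rewrite -ltrBlDl ltr_pdivlMr ?(lt_le_trans ltr01) // in slt.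
move: (disp _) => D D0 DL; nra.
Qed.

End WordCounting.

(** * Words read off reduced paths in a tree *)

Section TreePaths.
Variables (V E : Type) (Y : sgraph V E).
Implicit Types (u v : V) (es : seq E).

Let turn : rel E := fun e f => `[< f <> erev Y e >].

Lemma reducedE es : reduced Y es <-> sorted turn es.
Proof.
elim: es => [|e [|f es] IH] //=; split.
  by case=> /asboolP ef /IH efs; rewrite /turn ef.
by case/andP => /asboolP ef /IH.
Qed.

Lemma reduced_rev es : sorted turn (rev (map (erev Y) es)) = sorted turn es.
Proof.
rewrite rev_sorted sorted_map; congr (sorted _ es).
apply/funext => e; apply/funext => f; apply: asbool_equiv_eq.
by split=> H H'; apply: H; rewrite H' erevK.
Qed.

Lemma edge_path_rcons u es e v :
  edge_path Y setT u (rcons es e) v <-> edge_path Y setT u es (org Y e) /\ v = ter Y e.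
Proof.
elim: es u => [|f es IH] u /=; first by split=> [[_ <- [_ <-]]|[[_ <-] ->]].
by split=> [[_ fu /IH[? ?]]|[[_ fu ?] ?]]; split=> //; exact/IH.
Qed.

Lemma edge_path_cat u es1 es2 v : edge_path Y setT u (es1 ++ es2) v <->
  exists2 w, edge_path Y setT u es1 w & edge_path Y setT w es2 v.
Proof.
elim: es1 u => [|f es IH] u /=; first by split=> [?|[w [_ <-]]//]; exists u.
split=> [[_ fu /IH[w ? ?]]|[w [_ fu ?] ?]]; first by exists w.
by split=> //; apply/IH; exists w.
Qed.

Lemma edge_path_rev u es v :
  edge_path Y setT u es v -> edge_path Y setT v (rev (map (erev Y) es)) u.
Proof.
elim: es u => [|e es IH] u /=; first by case=> _ ->.
case=> _ eu /IH H; rewrite rev_cons; apply/edge_path_rcons; split => //.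
by rewrite /ter erevK.
Qed.

(** Where two reduced paths first differ, the reverse of one followed by the
   other is a reduced closed path, contradicting acyclicity. *)
Lemma reduced_path_unique u v es es' : is_tree Y ->
  edge_path Y setT u es v -> edge_path Y setT u es' v ->
  reduced Y es -> reduced Y es' -> es = es'.
Proof.
case=> _ _ acyc; elim: es es' u => [|e es IH] [|e' es'] u //=.
- by case=> _ <- p _ r; have := acyc u (e' :: es') p r.
- by move=> p [_ uv] r _; subst v; have := acyc u (e :: es) p r.
move=> [_ eu p] [_ e'u p'] r r'.
have [ee'|nee'] := pselect (e = e').
  subst e'; congr cons; apply: (IH _ (ter Y e)) => //.
    by case: es r {IH p} => //= f es [].
  by case: es' r' {p'} => //= f es' [].
have := acyc v (rev (map (erev Y) (e :: es)) ++ (e' :: es')).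
move=> H; have : rev (map (erev Y) (e :: es)) ++ (e' :: es') = [::].
  apply: H; first by apply/edge_path_cat; exists u => //; exact: (@edge_path_rev u (e :: es)).
  apply/reducedE; have := reduced_rev (e :: es).
  have -> : sorted turn (e :: es) by apply/reducedE.
  have : sorted turn (e' :: es') by apply/reducedE.
  rewrite map_cons rev_cons cat_rcons /=.
  have tee : turn (erev Y e) e' by apply/asboolP; rewrite erevK => /esym.
  move=> se'; case: (rev _) => [|a s] /=; first by rewrite se' tee.
  by rewrite rcons_path cat_path /= se' tee => /andP[-> ->].
by move/(congr1 size); rewrite size_cat /= addnS.
Qed.

End TreePaths.

Lemma actE_ter (gT : groupType) (H : set gT) (T : gtree H) g (e : tE T) :
  H g -> ter (tG T) (actE g e) = actV g (ter (tG T) e).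
Proof. by move=> Hg; rewrite /ter act_rev // act_org. Qed.

Section TreeWords.
Variables (R : realType) (X : metricType R) (H : set (isom X)) (T : gtree H).
Variables (Q : finType) (L : eqType) (lab : Q -> Q -> seq L).
Variables (E : Q -> tE T) (O : Q -> tV T) (tau : Q -> isom X) (kk : Q -> Q -> L -> isom X).
Hypothesis Hsub : is_subgroup H.
Hypothesis tau_in : forall q, H (tau q).
Hypothesis kk_in : forall e f t, t \in lab e f -> H (kk e f t).
Hypothesis ter_E : forall q, ter (tG T) (E q) = actV (tau q) (O q).
Hypothesis kk_org : forall e f t, t \in lab e f -> actV (kk e f t) (org (tG T) (E f)) = O e.
Hypothesis kk_turn : forall e f t, t \in lab e f ->
  actE (kk e f t) (E f) <> actE (tau e)^-1%g (erev (tG T) (E e)).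
Hypothesis kk_inj : forall e f t f' t', t \in lab e f -> t' \in lab e f' ->
  actE (kk e f t) (E f) = actE (kk e f' t') (E f') -> f = f' /\ t = t'.

Let el e f t := (kk e f t * tau f)%g.

(** State e comes with an edge E e ending at tau e (O e); reading the label t
   applies kk e f t, which brings E f to an edge leaving O e.  A word traces a
   path in the tree, and its value carries O of the last state to the end of
   this path. *)
Fixpoint tree_path e (w : seq (Q * L)) : seq (tE T) :=
  if w is l :: w' then
    actE (kk e l.1 l.2) (E l.1) :: map (actE (el e l.1 l.2)) (tree_path l.1 w')
  else [::].

Lemma actE_inj g : H g -> injective (@actE _ _ T g).
Proof.
case: Hsub => _ _ HV Hg e f ef; have := congr1 (actE g^-1%g) ef.
by rewrite -!actEM ?mulVg ?actE1 //; exact: HV.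
Qed.

Lemma edge_path_act g u es v : H g -> edge_path (tG T) setT u es v ->
  edge_path (tG T) setT (actV g u) (map (@actE _ _ T g) es) (actV g v).
Proof.
move=> Hg; elim: es u => [|e es IH] u /=; first by case=> _ ->.
by case=> _ <- /IH; rewrite actE_ter // act_org.
Qed.

Lemma reduced_act g es : H g -> reduced (tG T) es -> reduced (tG T) (map (@actE _ _ T g) es).
Proof.
move=> Hg; elim: es => [|e [|f es] IH] //= [fe /IH r]; split=> // gfe.
by apply: fe; apply: (actE_inj Hg); rewrite gfe act_rev.
Qed.

Let elH e f t : t \in lab e f -> H (el e f t).
Proof. by move=> tl; case: Hsub => _ HM _; apply: HM => //; exact: kk_in tl. Qed.

Let wordH n e w : w \in words lab n e -> H (word_elt el e w).
Proof. exact: (word_elt_in elH Hsub). Qed.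

Lemma tree_path_ends n e w : w \in words lab n e ->
  edge_path (tG T) setT (O e) (tree_path e w)
    (actV (word_elt el e w) (O (last e (map fst w)))).
Proof.
elim: n e w => [|n IH] e w /=; first by rewrite inE => /eqP -> /=; rewrite actV1.
case/allpairsPdep => l [w' [ls w's ->]] /=; rewrite mem_steps in ls.
have kH := kk_in ls; have eH := elH ls.
split=> //; first by rewrite act_org // (kk_org ls).
have wH : H (word_elt el l.1 w') by exact: wordH w's.
rewrite actE_ter // ter_E -actVM // -/(el _ _ _) (actVM _ eH wH).
by apply: edge_path_act => //; exact: IH.
Qed.

(** The edge of the initial state is put in front so that the condition of
   not turning back propagates from one letter to the next. *)
Lemma tree_path_reduced n e w : w \in words lab n e ->
  reduced (tG T) (actE (tau e)^-1%g (E e) :: tree_path e w).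
Proof.
have HV g : H g -> H g^-1%g by case: Hsub => _ _; apply.
elim: n e w => [|n IH] e w; first by rewrite inE => /eqP ->.
case/allpairsPdep => l [w' [ls w's ->]]; rewrite mem_steps in ls.
split; first by rewrite act_rev; [exact: kk_turn | exact: HV].
have := reduced_act (elH ls) (IH _ _ w's); rewrite map_cons -actEM //.
- by rewrite /el mulgK.
- exact: elH ls.
- exact: HV.
Qed.

Lemma tree_path_inj n e w w' : w \in words lab n e -> w' \in words lab n e ->
  tree_path e w = tree_path e w' -> w = w'.
Proof.
elim: n e w w' => [|n IH] e w w'; first by rewrite !inE => /eqP -> /eqP ->.
case/allpairsPdep => -[f t] [v [ls vs ->]]; rewrite mem_steps /= in ls.
case/allpairsPdep => -[f' t'] [v' [ls' vs' ->]]; rewrite mem_steps /= in ls'.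
move=> /= [/(kk_inj ls ls')[ff' tt']]; subst f' t'.
by move/(inj_map (actE_inj (elH ls))) => /(IH _ _ _ vs vs') ->.
Qed.

(** Two words with the same value and last state trace reduced paths with the
   same ends, hence the same path, and each edge of the path determines the
   letter read. *)
Theorem tree_words_injective : words_injective lab (fun e f t => (kk e f t * tau f)%g).
Proof.
move=> n e w w' wn w'n lE pE; apply: (tree_path_inj wn w'n).
have red v : v \in words lab n e -> reduced (tG T) (tree_path e v).
  by move/tree_path_reduced; case: (tree_path e v) => // ? ? [].
apply: (reduced_path_unique (tG_tree T) (tree_path_ends wn)); try exact: red.
have := tree_path_ends w'n; rewrite -lE -[word_elt el e w']pE; exact.
Qed.

End TreeWords.

(** * Cosets and stabilizers *)

(** Each factor is finite because a single positive term of the other one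
   bounds its partial sums. *)
Lemma esum_mul_le1 (R : realType) (T1 T2 : choiceType) (S1 : set T1) (S2 : set T2)
    (a1 : T1 -> R) (a2 : T2 -> R) :
  (forall t, 0 < a1 t) -> (forall t, 0 < a2 t) -> S1 !=set0 -> S2 !=set0 ->
  (forall s1 s2, uniq s1 -> uniq s2 -> (forall t, t \in s1 -> S1 t) -> (forall t, t \in s2 -> S2 t) ->
     (\sum_(t <- s1) a1 t) * (\sum_(t <- s2) a2 t) <= 1) ->
  [/\ (\esum_(t in S1) (a1 t)%:E < +oo)%E, (\esum_(t in S2) (a2 t)%:E < +oo)%E &
      ((\esum_(t in S1) (a1 t)%:E) * (\esum_(t in S2) (a2 t)%:E) <= 1)%E].
Proof.
move=> p1 p2 [t1 St1] [t2 St2] H.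
have b1 s1 : uniq s1 -> (forall t, t \in s1 -> S1 t) -> \sum_(t <- s1) a1 t <= (a2 t2)^-1.
  move=> u1 h1; rewrite -[leRHS]mul1r ler_pdivlMr //.
  have := H s1 [:: t2] u1 isT h1; rewrite big_seq1; apply=> t.
  by rewrite inE => /eqP ->.
have e1 : (\esum_(t in S1) (a1 t)%:E <= ((a2 t2)^-1)%:E)%E by apply: esum_le_seq.
have f1 : (\esum_(t in S1) (a1 t)%:E < +oo)%E by apply: le_lt_trans e1 (ltry _).
have g1 : (\esum_(t in S1) (a1 t)%:E)%E \is a fin_num.
  by rewrite ge0_fin_numE // esum_EFin_ge0 // => t; exact: ltW.
have A0 : 0 < fine (\esum_(t in S1) (a1 t)%:E)%E.
  rewrite -lte_fin fineK //; apply: (@lt_le_trans _ _ (a1 t1)%:E); first by rewrite lte_fin.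
  have := @seq_le_esum _ _ S1 a1 [:: t1] isT; rewrite big_seq1; apply=> t.
  by rewrite inE => /eqP ->.
have b2 s2 : uniq s2 -> (forall t, t \in s2 -> S2 t) ->
    \sum_(t <- s2) a2 t <= (fine (\esum_(t in S1) (a1 t)%:E)%E)^-1.
  move=> u2 h2; rewrite -[leRHS]mul1r ler_pdivlMr // mulrC.
  have [s0|] := ltP 0 (\sum_(t <- s2) a2 t); last first.
    by move=> s0; rewrite (le_trans _ ler01) // pmulr_rle0.
  rewrite -ler_pdivlMr // -lee_fin fineK //; apply: esum_le_seq => s1 u1 h1.
  by rewrite ler_pdivlMr // H.
have e2 : (\esum_(t in S2) (a2 t)%:E <= ((fine (\esum_(t in S1) (a1 t)%:E)%E)^-1)%:E)%E.
  exact: esum_le_seq.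
split=> //; first by apply: le_lt_trans e2 (ltry _).
rewrite -[X in (X * _)%E]fineK //; apply: le_trans (lee_wpmul2l _ e2) _.
  by rewrite lee_fin ltW.
by rewrite -EFinM mulfV // gt_eqF.
Qed.

Section Cosets.
Variables (gT : groupType).
Implicit Types (A K : set gT).

Lemma lcoset_of_mem A K c k : is_subgroup K -> lcosets_of A K c -> c k ->
  c = lcoset_of k K.
Proof.
case=> K1 KM KV [g Ag <-] [h Kh <-].
apply/seteqP; split=> _ [h' Kh' <-].
  by exists (h^-1 * h')%g; [apply: KM => //; exact: KV | rewrite mulgA mulgK].
by exists (h * h')%g; [exact: KM | rewrite mulgA].
Qed.

Lemma lcoset_of_eq K k k' : is_subgroup K -> K (k^-1 * k')%g -> lcoset_of k K = lcoset_of k' K.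
Proof.
move=> Ks Kkk; case: (Ks) => K1 KM KV.
apply: (lcoset_of_mem (A := [set: gT]) Ks); first by exists k.
by exists (k^-1 * k')%g; rewrite // mulVKg.
Qed.

Lemma lcoset_of_id K k : is_subgroup K -> K k -> lcoset_of k K = K.
Proof.
move=> Ks Kk; case: (Ks) => K1 KM KV; apply/seteqP; split=> [_ [h Kh <-]|h Kh]; first exact: KM.
by exists (k^-1 * h)%g; [apply: KM => //; exact: KV | rewrite mulVKg].
Qed.

Lemma lcoset_sub A K c k : is_subgroup A -> K `<=` A -> lcosets_of A K c -> c k -> A k.
Proof. by case=> _ AM _ KA [g Ag <-] [h /KA Ah <-]; exact: AM. Qed.

Lemma lcoset_nonempty A K c : is_subgroup K -> lcosets_of A K c -> exists k, c k.
Proof. by case=> K1 _ _ [g Ag <-]; exists g; exists 1%g; rewrite ?mulg1. Qed.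

Variables (H : set gT) (T : gtree H).
Hypothesis Hsub : is_subgroup H.

Lemma stabV_subgroup (v : tV T) : is_subgroup (stabV v).
Proof.
case: Hsub => H1 HM HV; split; first by split; rewrite ?actV1.
  by move=> g h [Hg gv] [Hh hv]; split; [exact: HM | rewrite actVM // hv].
move=> g [Hg gv]; split; first exact: HV.
by rewrite -{1}gv -actVM ?mulVg ?actV1 //; exact: HV.
Qed.

Lemma stabE_subgroup (e : tE T) : is_subgroup (stabE e).
Proof.
case: Hsub => H1 HM HV; split; first by split; rewrite ?actE1.
  by move=> g h [Hg ge] [Hh he]; split; [exact: HM | rewrite actEM // he].
move=> g [Hg ge]; split; first exact: HV.
by rewrite -{1}ge -actEM ?mulVg ?actE1 //; exact: HV.
Qed.

Lemma stabE_org (e : tE T) : stabE e `<=` stabV (org (tG T) e).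
Proof. by move=> h [Hh he]; split=> //; rewrite -act_org // he. Qed.

Lemma stabE_ter (e : tE T) : stabE e `<=` stabV (ter (tG T) e).
Proof. by move=> h [Hh he]; split=> //; rewrite -actE_ter // he. Qed.

Lemma stabE_transport (e : tE T) k k' : H k -> H k' -> actE k e = actE k' e ->
  stabE e (k^-1 * k')%g.
Proof.
case: Hsub => _ HM HV Hk Hk' E; split; first by apply: HM => //; exact: HV.
by rewrite (actEM e (HV _ Hk) Hk') -E -(actEM e (HV _ Hk) Hk) mulVg actE1.
Qed.

End Cosets.

Lemma node_subgroup (gT : groupType) (H : set gT) (h : hierarchy H) (K : set gT)
  (D : decomposition K) : node h D -> is_subgroup H -> is_subgroup K /\ K `<=` H.
Proof.
elim=> [H' D' kids Hs|H' D' kids v k K' D'' _ _ IH Hs]; first by split.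
have [Ks KH] := IH (stabV_subgroup Hs (liftV v)).
by split=> // g /KH [].
Qed.

(** * Finiteness of orbit balls *)

Lemma seq_argmin (R : realType) (T : eqType) (F : T -> R) (s : seq T) :
  s <> [::] -> exists2 t, t \in s & forall t', t' \in s -> F t <= F t'.
Proof.
elim: s => // a s IH _; have [->|/eqP/IH[t ts tmin]] := eqVneq s [::].
  by exists a; rewrite ?inE // => t'; rewrite inE => /eqP ->.
have [Fat|Fta] := leP (F a) (F t).
  exists a; rewrite ?mem_head // => t'; rewrite inE => /predU1P[->//|/tmin].
  exact: le_trans.
exists t; first by rewrite inE ts orbT.
by move=> t'; rewrite inE => /predU1P[->|/tmin//]; exact: ltW.
Qed.

Section OrbitCounting.
Variables (R : realType) (X : metricType R) (x : X) (Gam : set (isom X)) (d : R).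
Hypothesis cE : critical_exponent x Gam = d%:E.

(** Convergence of the orbit series at one parameter already forces proper
   discontinuity along the orbit of x. *)
Lemma finite_orbit_ball r : finite_set [set g | Gam g /\ disp x g <= r].
Proof.
have [s [_ _ s0 sfin]] := critical_exponent_lt cE ltr01.
have [P [P0 HP]] := orbit_series_le sfin.
apply: contrapT => inf.
have [C CS szC] := infinite_set_fset (Num.truncn (P / expR (- s * r))).+1 inf.
have := HP (enum_fset C) (fset_uniq C) (fun g gC => (CS g gC).1).
apply/negP; rewrite -ltNge.
apply: (@lt_le_trans _ _ (#|` C|%:R * expR (- s * r))); last first.
  rewrite mulr_natl -sum1_size -sumrMnr.
  rewrite big_seq [leRHS]big_seq; apply: ler_sum => g gC; rewrite mulr1n.
  have [_ gr] := CS g gC.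
  by rewrite ler_expR !mulNr lerN2 ler_wpM2l // ltW.
rewrite -ltr_pdivrMr ?expR_gt0 //; apply: lt_le_trans (truncnS_gt _) _.
by rewrite ler_nat.
Qed.

Lemma disp_min (S : set (isom X)) : S !=set0 -> S `<=` Gam ->
  exists2 g, S g & forall h, S h -> disp x g <= disp x h.
Proof.
move=> [g0 Sg0] SG.
have fin : finite_set [set g | S g /\ disp x g <= disp x g0].
  apply: sub_finite_set (finite_orbit_ball (disp x g0)) => g [Sg gr].
  by split=> //; exact: SG.
have mem g : (g \in fset_set [set g | S g /\ disp x g <= disp x g0]) = `[< S g /\ disp x g <= disp x g0 >].
  by rewrite in_fset_set //; apply/idP/asboolP => /set_mem || by move/mem_set.
have ne : enum_fset (fset_set [set g | S g /\ disp x g <= disp x g0]) <> [::].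
  move=> e; have : g0 \in fset_set [set g | S g /\ disp x g <= disp x g0].
    by rewrite mem; exact/asboolP.
  by rewrite -[_ \in _]/(g0 \in enum_fset _) e.
have [g gin gmin] := seq_argmin (disp x) ne.
move: gin; rewrite mem => /asboolP[Sg gg0]; exists g => // h Sh.
have [hg|hg] := leP (disp x h) (disp x g0); first by apply: gmin; rewrite mem; exact/asboolP.
exact: le_trans gg0 (ltW hg).
Qed.

End OrbitCounting.

Lemma inf_attained (R : realType) (T : Type) (F : T -> R) (S : set T) t :
  S t -> (forall t', S t' -> F t <= F t') -> inf [set F t' | t' in S] = F t.
Proof.
move=> St tmin; apply/eqP; rewrite eq_le; apply/andP; split.
  by apply: ge_inf; [exists (F t) => _ [t' St' <-]; exact: tmin | exists t].
by apply: lb_le_inf; [exists (F t), t | move=> _ [t' St' <-]; exact: tmin].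
Qed.

(** * Label matrices of a graph-of-groups decomposition *)

Section NodeEstimates.
Variables (R : realType) (X : metricType R) (x : X) (Gam : set (isom X)) (d : R).
Hypothesis Gsub : is_subgroup Gam.
Hypothesis d0 : 0 < d.
Hypothesis cE : critical_exponent x Gam = d%:E.
Hypothesis axis_disp : forall g : isom X, hyperbolic g -> disp x g <= axis_weight x g.

Variables (H : set (isom X)) (D : decomposition H).
Hypothesis Hsub : is_subgroup H.
Hypothesis HG : H `<=` Gam.

Lemma pE_act (e : tE (dT D)) h : H h -> pE (actE h e) = pE e.
Proof. by move=> Hh; apply/esym/pE_orbit; exists h. Qed.

Lemma allowed_rep (e f : dE D) c k : allowed e f c -> c k ->
  [/\ H k, actV k (liftV (dorg f)) = liftV (dorg f) & c = lcoset_of k (egrp f)].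
Proof.
case=> _ rc _ ck.
have sub : egrp f `<=` vgrp (dorg f).
  by move=> h /stabE_org; rewrite /vgrp /dorg liftE_org.
have [Hk kf] := lcoset_sub (stabV_subgroup Hsub _) sub rc ck.
by split=> //; apply: lcoset_of_mem rc ck; exact: stabE_subgroup.
Qed.

Section Words.
Variables (Q : finType) (m : Q -> dE D) (lab : Q -> Q -> seq (set (isom X))).
Variable (kk : Q -> Q -> set (isom X) -> isom X).
Hypothesis minj : injective m.
Hypothesis lab_allowed : forall e f c, c \in lab e f -> allowed (m e) (m f) c /\ c (kk e f c).

(** A state is represented by the lift of its edge.  An allowed transition
   is exactly one that does not turn back, and two representatives carrying
   the next lifted edge to the same place lie in the same coset. *)
Lemma decomposition_words_injective :
  words_injective lab (fun e f c => kk e f c * tau (m f))%g.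
Proof.
apply: (@tree_words_injective _ _ _ (dT D) _ _ _ (fun q => liftE (m q))
  (fun q => liftV (dter (m q))) (fun q => tau (m q))) => //.
- by move=> q; exact: tau_in.
- by move=> e f c /lab_allowed[al ck]; have [] := allowed_rep al ck.
- by move=> q; exact: liftE_ter.
- move=> e f c /lab_allowed[al ck]; have [Hk kf _] := allowed_rep al ck.
  by rewrite liftE_org kf; case: al => ->.
- move=> e f c /lab_allowed[al ck]; have [Hk _ cE'] := allowed_rep al ck.
  rewrite -liftE_rev => ef; have := congr1 (@pE _ _ D) ef.
  rewrite pE_act // !liftEK => fe; case: al => _ _ /(_ fe); apply.
  rewrite cE' lcoset_of_id //; first exact: stabE_subgroup.
  by split=> //; rewrite ef -fe.
- move=> e f c f' c' /lab_allowed[al ck] /lab_allowed[al' ck'] ff'.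
  have [Hk _ cE1] := allowed_rep al ck; have [Hk' _ cE2] := allowed_rep al' ck'.
  have := congr1 (@pE _ _ D) ff'; rewrite !pE_act // !liftEK => /minj mff.
  subst f'; split=> //; rewrite cE1 cE2; apply: lcoset_of_eq; first exact: stabE_subgroup.
  exact: stabE_transport.
Qed.

Lemma decomposition_subexponential : (forall e f, uniq (lab e f)) ->
  subexponential (label_matrix x lab (fun e f c => kk e f c * tau (m f))%g d).
Proof.
move=> labU; apply: (label_matrix_subexponential (Gam := Gam)) => //.
  move=> e f c /lab_allowed[al ck]; have [Hk _ _] := allowed_rep al ck.
  by apply: HG; case: Hsub => _ HM _; apply: HM => //; exact: tau_in.
exact: decomposition_words_injective.
Qed.

End Words.

Section FiniteFamilies.
Variables (Q : finType) (m : Q -> dE D) (lab : Q -> Q -> seq (set (isom X))).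
Hypothesis minj : injective m.
Hypothesis labU : forall e f, uniq (lab e f).

(** The infimum is attained because orbit balls are finite. *)
Lemma coset_length_rep (e f : dE D) c : allowed e f c ->
  exists2 k, c k & disp x (k * tau f)%g = coset_length x f c.
Proof.
move=> al; have [_ rc _] := al.
have [k0 ck0] := lcoset_nonempty (stabE_subgroup Hsub _) rc.
have [_ [k ck <-] kmin] : exists2 g, [set (k * tau f)%g | k in c] g &
    forall h, [set (k * tau f)%g | k in c] h -> disp x g <= disp x h.
  apply: (disp_min cE); first by exists (k0 * tau f)%g, k0.
  move=> _ [k ck <-]; apply: HG; have [Hk _ _] := allowed_rep al ck.
  by case: Hsub => _ HM _; apply: HM => //; exact: tau_in.
exists k => //; apply/esym/(@inf_attained _ _ (fun g => mdist x ((g * tau f)%g x))) => //.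
by move=> k' ck'; apply: kmin; exists k'.
Qed.

Lemma length_matrix_subexponential :
  (forall e f c, c \in lab e f -> allowed (m e) (m f) c) ->
  subexponential (fun e f => \sum_(c <- lab e f) expR (- d * coset_length x (m f) c)).
Proof.
move=> la.
have ex e f c : exists k, c \in lab e f -> c k /\ disp x (k * tau (m f))%g = coset_length x (m f) c.
  have [/la/coset_length_rep[k ? ?]|] := boolP (c \in lab e f); by [exists k|exists 1%g].
pose kk e f c := projT1 (cid (ex e f c)).
have kkP e f c : c \in lab e f -> c (kk e f c) /\ disp x (kk e f c * tau (m f))%g = coset_length x (m f) c.
  exact: (projT2 (cid (ex e f c))).
apply: (@subexponential_mono _ _ _ (label_matrix x lab (fun e f c => kk e f c * tau (m f))%g d)).
- by move=> e f; apply: sumr_ge0 => c _; exact: expR_ge0.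
- move=> e f; rewrite le_eqVlt; apply/orP; left; apply/eqP.
  by apply: eq_big_seq => c /kkP[_ ->].
- apply: decomposition_subexponential => // e f c cl; split; first exact: la.
  by case: (kkP _ _ _ cl).
Qed.

(** A hyperbolic representative displaces x by at most its axis weight, so
   this matrix is dominated by a label matrix. *)
Lemma axis_matrix_subexponential (rep : Q -> Q -> set (isom X) -> isom X) :
  (forall e f c, c \in lab e f -> allowed (m e) (m f) c /\ hyperbolic_rep (m f) c (rep e f c)) ->
  subexponential (fun e f => \sum_(c <- lab e f) expR (- d * axis_weight x (rep e f c))).
Proof.
move=> la.
pose kk e f c := (rep e f c * (tau (m f))^-1)%g.
apply: (@subexponential_mono _ _ _ (label_matrix x lab (fun e f c => kk e f c * tau (m f))%g d)).
- by move=> e f; apply: sumr_ge0 => c _; exact: expR_ge0.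
- move=> e f; rewrite /label_matrix big_seq [leRHS]big_seq; apply: ler_sum => c.
  move=> /la[_ [hyp _]]; rewrite /kk mulgVK ler_expR !mulNr lerN2 (ler_wpM2l (ltW d0)) //.
  exact: axis_disp.
- apply: decomposition_subexponential => // e f c cl.
  have [al [_ [k ck repE]]] := la _ _ _ cl; split=> //.
  by rewrite /kk repE mulgK.
Qed.

End FiniteFamilies.

End NodeEstimates.

(** * Components of the relative matrix *)

Section RelativeMatrix.
Variables (R : realType) (X : metricType R) (x : X) (Gam : set (isom X)) (d : R).
Hypothesis Gsub : is_subgroup Gam.
Hypothesis d0 : 0 < d.
Hypothesis cE : critical_exponent x Gam = d%:E.
Hypothesis axis_disp : forall g : isom X, hyperbolic g -> disp x g <= axis_weight x g.

Variables (H : set (isom X)) (D : decomposition H).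
Hypothesis Hsub : is_subgroup H.
Hypothesis HG : H `<=` Gam.

Let wt (f : dE D) c : R := expR (- d * coset_length x f c).

Lemma transition_allowed (e f : dE D) : transition_rel x D e f -> exists c, allowed e f c.
Proof.
move=> /asboolP[s]; apply: contra_notP => nex.
rewrite /rel_matrix; have -> : allowed e f = set0; last exact: esum_set0.
by apply/seteqP; split=> // c al; case: nex; exists c.
Qed.

(** Close the transition e -> f to a cycle with a single label on each other
   transition: the weight of the return path bounds the partial sums of the
   entry from above by its inverse. *)
Lemma rel_matrix_fin_cycle (p : seq (dE D)) (e f : dE D) :
  path (transition_rel x D) f p -> last f p = e -> transition_rel x D e f ->
  rel_matrix x d e f \is a fin_num.
Proof.
move=> pf pe ef.
have ex (a b : dE D) : exists c, transition_rel x D a b -> allowed a b c.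
  have [/transition_allowed[c ?]|] := boolP (transition_rel x D a b); by [exists c|exists setT].
pose c0 a b := projT1 (cid (ex a b)).
have c0P a b : transition_rel x D a b -> allowed a b (c0 a b) by exact: (projT2 (cid (ex a b))).
pose cyc (i : 'I_(size p).+1) := nth f (f :: p) i.
have cycP i : transition_rel x D (cyc i) (cyc (ordS i)).
  rewrite /cyc; have [ip|ip] := ltnP i (size p).
    have -> : val (ordS i) = i.+1 by rewrite /= modn_small ?ltnS.
    by move/(pathP f): pf => /(_ _ ip).
  have -> : val (ordS i) = 0%N.
    by rewrite /= (_ : val i = size p) ?modnn //; apply/eqP; rewrite eqn_leq ip -ltnS ltn_ord.
  have -> : val i = size p by apply/eqP; rewrite eqn_leq ip -ltnS ltn_ord.
  by rewrite nth_last /= pe.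
have maxE : cyc ord_max = e /\ cyc (ordS ord_max) = f.
  by rewrite /cyc /= modnn; split=> //; rewrite -pe -[LHS]/(nth f (f :: p) (size (f :: p)).-1) nth_last.
pose w i := wt (cyc (ordS i)) (c0 (cyc i) (cyc (ordS i))).
pose W := \prod_(i < (size p).+1 | i != ord_max) w i.
have W0 : 0 < W by apply: prodr_gt0 => i _; exact: expR_gt0.
suff: (rel_matrix x d e f <= (W^-1)%:E)%E.
  move=> le; rewrite ge0_fin_numE; first exact: le_lt_trans le (ltry _).
  by apply: esum_EFin_ge0 => c; exact: expR_ge0.
apply: esum_le_seq => F uF Fal.
pose lab a b := if transition_rel x D a b
  then undup (if (a == e) && (b == f) then c0 a b :: F else [:: c0 a b]) else [::].
have labU a b : uniq (lab a b) by rewrite /lab; case: ifP => // _; exact: undup_uniq.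
have laba a b c : c \in lab a b -> allowed a b c.
  rewrite /lab; case: ifP => // ab; rewrite mem_undup; case: ifP => [/andP[/eqP ae /eqP bf]|_].
    by rewrite inE => /predU1P[->|/Fal]; [exact: c0P | rewrite ae bf].
  by rewrite inE => /eqP ->; exact: c0P.
pose K (a b : dE D) := \sum_(c <- lab a b) wt b c.
have K0 : nonneg K by move=> a b; apply: sumr_ge0 => c _; exact: expR_ge0.
have sK : subexponential K.
  exact: (@length_matrix_subexponential _ _ x Gam d Gsub d0 cE H D Hsub HG _ id lab).
have := cycle_weight_le1 cyc K0 sK; rewrite (bigD1 ord_max) //= !(maxE.1, maxE.2).
have KW : W <= \prod_(i < (size p).+1 | i != ord_max) K (cyc i) (cyc (ordS i)).
  apply: ler_prod => i _; rewrite expR_ge0 /=.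
  rewrite /K (big_rem (c0 (cyc i) (cyc (ordS i)))) /=; last first.
    by rewrite /lab cycP mem_undup; case: ifP; rewrite mem_head.
  by rewrite lerDl sumr_ge0 // => c _; exact: expR_ge0.
have FK : \sum_(c <- F) wt f c <= K e f.
  rewrite /K /lab ef !eqxx /=.
  have -> : \sum_(c <- F) wt f c = \sum_(c <- undup (c0 e f :: F) | c \in F) wt f c.
    rewrite -[RHS]big_filter; apply: perm_big; apply: uniq_perm => //.
      by rewrite filter_uniq ?undup_uniq.
    by move=> c; rewrite mem_filter mem_undup inE; case: (c \in F); rewrite ?orbT.
  by rewrite [leRHS](bigID (mem F)) /= lerDl sumr_ge0 // => c _; exact: expR_ge0.
move=> le1; apply: le_trans FK _.
rewrite -[leRHS]mul1r ler_pdivlMr //; apply: le_trans le1.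
by rewrite ler_wpM2l.
Qed.

(** Finitely many labels capture every entry up to a factor 1 + eps. *)
Lemma block_radius_rel_matrix (C : {set dE D}) :
  (forall e f, e \in C -> f \in C -> rel_matrix x d e f \is a fin_num) ->
  block_radius C (fun e f => fine (rel_matrix x d e f)) <= 1.
Proof.
move=> fin; apply/ler_addgt0Pr => eps eps0.
have rel0 (e f : dE D) : (0 <= rel_matrix x d e f)%E by apply: esum_EFin_ge0 => c; exact: expR_ge0.
have ex (e f : dE D) : exists s, [/\ uniq s, forall c, c \in s -> allowed e f c &
    e \in C -> f \in C -> fine (rel_matrix x d e f) <= (1 + eps) * \sum_(c <- s) wt f c].
  have [eC|_] := boolP (e \in C); last by exists [::].
  have [fC|_] := boolP (f \in C); last by exists [::].
  have := fine_ge0 (rel0 e f); rewrite le_eqVlt => /predU1P[<-|K0].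
    by exists [::]; split=> // _ _; rewrite big_nil mulr0.
  set K := fine _ in K0 *.
  have [||s [us sal]] := @esum_fin_approx R _ (allowed e f) (wt f) (K * (eps / (1 + eps))) (fun=> expR_ge0 _).
  - by rewrite !mulr_gt0 // invr_gt0 addr_gt0.
  - by rewrite -ge0_fin_numE; [exact: fin | exact: rel0].
  rewrite -/(rel_matrix x d e f) -(fineK (fin _ _ eC fC)) lee_fin -/K => le.
  exists s; split=> // _ _; move: le; move: (\sum_(c <- s) _) => S.
  have e1 : 0 < 1 + eps by rewrite addr_gt0.
  rewrite -lerBlDr -(ler_pM2l e1) => le; apply: le_trans le.
  by rewrite le_eqVlt; apply/orP; left; apply/eqP; field; exact: lt0r_neq0.
pose lab e f := projT1 (cid (ex e f)).
have labP e f : [/\ uniq (lab e f), forall c, c \in lab e f -> allowed e f c &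
    e \in C -> f \in C -> fine (rel_matrix x d e f) <= (1 + eps) * \sum_(c <- lab e f) wt f c].
  exact: (projT2 (cid (ex e f))).
apply: (@block_radius_scale _ _ _ _ (fun e f => \sum_(c <- lab e f) wt f c)).
- by rewrite addr_ge0 // ltW.
- by move=> e f; rewrite fine_ge0.
- by move=> e f; apply: sumr_ge0 => c _; exact: expR_ge0.
- by move=> e f eC fC; have [_ _] := labP e f; apply.
- apply: (@length_matrix_subexponential _ _ x Gam d Gsub d0 cE H D Hsub HG _ enum_val) => //.
  + exact: enum_val_inj.
  + by move=> i j; have [] := labP (enum_val i) (enum_val j).
  + by move=> i j c; have [_ + _] := labP (enum_val i) (enum_val j); apply.
Qed.

(** An entry of a component either vanishes or lies on a directed cycle. *)
Lemma component_rel_matrix (C : {set dE D}) e f : component x C -> e \in C -> f \in C ->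
  rel_matrix x d e f \is a fin_num.
Proof.
case=> e0 e0S -> ; rewrite !inE => /andP[e0e ee0] /andP[e0f fe0].
have [ef|nef] := boolP (transition_rel x D e f); last first.
  move: nef; rewrite /transition_rel => /asboolPn nef.
  have -> : rel_matrix x d e f = 0%E by apply: contrapT => ne; apply: nef; exists d.
  by [].
case/connectP: (connect_trans fe0 e0e) => p pf pe.
apply: (@rel_matrix_fin_cycle p) => //.
by apply: sub_path pf => a b /= /and3P[].
Qed.

Section Choices.
Variables (C : {set dE D}) (F : dE D -> dE D -> {fset set (isom X)}).
Variable (rep : dE D -> dE D -> set (isom X) -> isom X).
Hypothesis fc : finite_choice C F rep.

Lemma comparison_subexponential :
  subexponential (fun i j : 'I_#|C| => comparison_matrix x F rep d (enum_val i) (enum_val j)).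
Proof.
apply: (@axis_matrix_subexponential _ _ x Gam d Gsub d0 cE axis_disp H D Hsub HG _ enum_val
  (fun i j => enum_fset (F (enum_val i) (enum_val j))) _ _
  (fun i j c => rep (enum_val i) (enum_val j) c)).
- exact: enum_val_inj.
- by move=> i j; exact: fset_uniq.
- by move=> i j c cF; apply: fc => //; exact: enum_valP.
Qed.

Lemma comparison_ge0 s e f : 0 <= comparison_matrix x F rep s e f.
Proof. by apply: sumr_ge0 => c _; exact: expR_ge0. Qed.

Lemma axis_weight_gt0 (g : isom X) : hyperbolic g -> 0 < axis_weight x g.
Proof.
case=> t0 _; rewrite /axis_weight ltr_pwDl // mulr_ge0 //.
rewrite /set_dist; have [->|/set0P ne] := eqVneq [set mdist x z | z in Ax g] set0.
  by rewrite inf0.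
by apply: lb_le_inf => // _ [z _ <-]; exact: mdist_ge0.
Qed.

(** Adding eps to the exponent d multiplies every entry by at most
   exp(-eps a), where a > 0 is a lower bound for the finitely many weights. *)
Lemma critical_parameter_le : (critical_parameter x C F rep <= d%:E)%E.
Proof.
pose aw e f c := axis_weight x (rep e f c).
have aw0 e f c : e \in C -> f \in C -> c \in F e f -> 0 < aw e f c.
  by move=> eC fC cF; apply: axis_weight_gt0; have [_ []] := fc eC fC cF.
(* A positive lower bound for the finitely many weights. *)
pose a := (1 + \sum_(e in C) \sum_(f in C) \sum_(c <- F e f) (aw e f c)^-1)^-1.
have sum0 e f : e \in C -> f \in C -> 0 <= \sum_(c <- F e f) (aw e f c)^-1.
  move=> eC fC; rewrite big_seq; apply: sumr_ge0 => c cF.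
  by rewrite invr_ge0 ltW // aw0.
have ssum0 e : e \in C -> 0 <= \sum_(f in C) \sum_(c <- F e f) (aw e f c)^-1.
  by move=> eC; apply: sumr_ge0 => f fC; exact: sum0.
have a0 : 0 < a by rewrite invr_gt0 ltr_pwDl // sumr_ge0.
have amin e f c : e \in C -> f \in C -> c \in F e f -> a <= aw e f c.
  move=> eC fC cF; rewrite -[leRHS]invrK lef_pV2 ?posrE ?invr_gt0 ?aw0 //; last first.
    by rewrite -invr_gt0.
  rewrite (bigD1 e) //= (bigD1 f) //= big_seq (big_rem c) //= cF.
  rewrite -!addrA [1 + _]addrCA lerDl !addr_ge0 //.
  - rewrite big_seq_cond; apply: sumr_ge0 => c' /andP[_ c'F].
    by rewrite invr_ge0 ltW // aw0.
  - by apply: sumr_ge0 => f' /andP[f'C _]; exact: sum0.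
  - by apply: sumr_ge0 => e' /andP[e'C _]; exact: ssum0.
apply/lee_addgt0Pr => eps eps0; rewrite -EFinD; apply: ereal_inf_lbound.
exists (d + eps) => //; split; first by rewrite addr_gt0.
apply: (@le_lt_trans _ _ (expR (- (eps * a)))); last first.
  by rewrite expR_lt1 oppr_lt0 mulr_gt0.
apply: (block_radius_scale (L := comparison_matrix x F rep d)); rewrite ?expR_ge0 //.
- by move=> e f; exact: comparison_ge0.
- by move=> e f; exact: comparison_ge0.
- move=> e f eC fC; rewrite /comparison_matrix mulr_sumr big_seq [leRHS]big_seq; apply: ler_sum => c cF.
  rewrite -expRD ler_expR; have := amin _ _ _ eC fC cF; rewrite /aw.
  by move: (axis_weight _ _) => A aA; nra.
- exact: comparison_subexponential.
Qed.

Variables (N : dE D -> dE D -> nat) (Rb : dE D -> dE D -> R).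
Hypothesis NR : forall e f, e \in C -> f \in C -> F e f != fset0 ->
  exists S : {fset set (isom X)}, [/\ (S `<=` F e f)%fset, #|` S| = N e f &
    forall c, c \in S -> axis_weight x (rep e f c) <= Rb e f].

Let B e f : R := if F e f != fset0 then (N e f)%:R * expR (- d * Rb e f) else 0.
Let Nmx e f : R := if F e f != fset0 then (N e f)%:R else 0.

Lemma multiplicity_le e f : e \in C -> f \in C -> B e f <= comparison_matrix x F rep d e f.
Proof.
move=> eC fC; rewrite /B; case: ifP => [ne|_]; last exact: comparison_ge0.
have [S [SF <- Sw]] := NR eC fC ne.
apply: (@le_trans _ _ (\sum_(c <- S) expR (- d * axis_weight x (rep e f c)))).
  rewrite mulr_natl -sum1_size -sumrMnr.
  rewrite big_seq [leRHS]big_seq; apply: ler_sum => c cS; rewrite mulr1n.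
  by rewrite ler_expR !mulNr lerN2 (ler_wpM2l (ltW d0)) // Sw.
have -> : \sum_(c <- S) expR (- d * axis_weight x (rep e f c)) =
    \sum_(c <- F e f | c \in S) expR (- d * axis_weight x (rep e f c)).
  rewrite -[RHS]big_filter; apply: perm_big; apply: uniq_perm => //.
    by rewrite filter_uniq.
  by move=> c; rewrite mem_filter andb_idr //; exact: (fsubsetP SF).
by rewrite /comparison_matrix [leRHS](bigID (mem S)) /= lerDl sumr_ge0 // => c _; exact: expR_ge0.
Qed.

Lemma multiplicity_ge0 e f : 0 <= B e f.
Proof. by rewrite /B; case: ifP => // _; rewrite mulr_ge0 // expR_ge0. Qed.

Lemma multiplicity_radius : block_radius C B <= 1.
Proof.
apply: (block_radius_scale (L := comparison_matrix x F rep d)) => // [||e f eC fC|].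
- exact: multiplicity_ge0.
- by move=> e f; exact: comparison_ge0.
- by rewrite mul1r multiplicity_le.
- exact: comparison_subexponential.
Qed.

Lemma multiplicity_log R0 :
  (forall e f, e \in C -> f \in C -> F e f != fset0 -> Rb e f <= R0) ->
  1 < block_radius C Nmx -> ln (block_radius C Nmx) <= d * R0.
Proof.
move=> RbR0 N1; rewrite -[leRHS]expRK ler_ln ?posrE ?expR_gt0 ?(lt_trans ltr01) //.
apply: (block_radius_scale (L := comparison_matrix x F rep d)); rewrite ?expR_ge0 //.
- by move=> e f; rewrite /Nmx; case: ifP.
- by move=> e f; exact: comparison_ge0.
- move=> e f eC fC.
  apply: (@le_trans _ _ (expR (d * R0) * B e f)); last first.
    by rewrite ler_wpM2l ?expR_ge0 // multiplicity_le.
  rewrite /Nmx /B; case: ifP => [ne|_]; last by rewrite mulr0.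
  rewrite mulrCA ler_peMr // -expRD -expR0 ler_expR mulNr subr_ge0.
  by rewrite (ler_wpM2l (ltW d0)) // RbR0.
- exact: comparison_subexponential.
Qed.

Lemma multiplicity_cycle m (cyc : 'I_m.+1 -> dE D) :
  (forall i, [/\ cyc i \in C, F (cyc i) (cyc (ordS i)) != fset0 &
                 (0 < N (cyc i) (cyc (ordS i)))%N]) ->
  \sum_(i < m.+1) ln (N (cyc i) (cyc (ordS i)))%:R <= d * \sum_(i < m.+1) Rb (cyc i) (cyc (ordS i)).
Proof.
move=> cycP.
have inC i : cyc i \in C by case: (cycP i).
have := @cycle_weight_le1 _ _ _ m (fun i => enum_rank_in (inC i) (cyc i)) _ comparison_subexponential.
under eq_bigr do rewrite !enum_rankK_in //.
move=> /(_ (fun i j => comparison_ge0 _ _ _)) le1.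
rewrite -subr_le0 mulr_sumr -sumrB -ler_expR expR0 expR_sum; apply: le_trans le1.
apply: ler_prod => i _; rewrite expR_ge0 /=.
have [_ ne N0] := cycP i.
apply: le_trans (multiplicity_le (inC _) (inC _)).
by rewrite /B ne expRD -mulNr lnK // posrE ltr0n.
Qed.

End Choices.

End RelativeMatrix.

(** * Amalgams, loops and the Hashimoto matrix *)

Section SpecialDecompositions.
Variables (R : realType) (X : metricType R) (x : X) (Gam : set (isom X)) (d : R).
Hypothesis Gsub : is_subgroup Gam.
Hypothesis d0 : 0 < d.
Hypothesis cE : critical_exponent x Gam = d%:E.
Hypothesis axis_disp : forall g : isom X, hyperbolic g -> disp x g <= axis_weight x g.

Variables (H : set (isom X)) (D : decomposition H).
Hypothesis Hsub : is_subgroup H.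
Hypothesis HG : H `<=` Gam.

Section Amalgam.
Variable f : dE D.
Let A := stabV (org (tG (dT D)) (liftE f)).
Let B := stabV (ter (tG (dT D)) (liftE f)).
Let C0 := egrp f.

Let Asub : is_subgroup A. Proof. exact: stabV_subgroup. Qed.
Let Bsub : is_subgroup B. Proof. exact: stabV_subgroup. Qed.
Let Csub : is_subgroup C0. Proof. exact: stabE_subgroup. Qed.
Let CA : C0 `<=` A. Proof. exact: stabE_org. Qed.
Let CB : C0 `<=` B. Proof. exact: stabE_ter. Qed.

(** The two ends of the lifted edge are the states of an automaton whose
   transitions alternate between them; its cycle of length two has the product
   of the two sums as weight. *)
Lemma amalgam_finite_le1 (LA LB : seq (set (isom X))) (gA gB : set (isom X) -> isom X) :
  uniq LA -> uniq LB ->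
  (forall c, c \in LA -> [/\ lcosets_of A C0 c, c <> C0 & c (gA c)]) ->
  (forall c, c \in LB -> [/\ lcosets_of B C0 c, c <> C0 & c (gB c)]) ->
  (\sum_(c <- LA) expR (- d * disp x (gA c))) * (\sum_(c <- LB) expR (- d * disp x (gB c))) <= 1.
Proof.
move=> uA uB hA hB.
pose lab (e e' : bool) := if e then (if e' then [::] else LB) else (if e' then LA else [::]).
pose kk (e e' : bool) c := if e then gB c else gA c.
pose fl := liftE f.
pose E (e : bool) := if e then fl else erev (tG (dT D)) fl.
pose O (e : bool) := if e then ter (tG (dT D)) fl else org (tG (dT D)) fl.
have kA c : c \in LA -> A (gA c).
  by move=> /hA[cA _ cg]; exact: (lcoset_sub Asub CA cA cg).
have kB c : c \in LB -> B (gB c).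
  by move=> /hB[cB _ cg]; exact: (lcoset_sub Bsub CB cB cg).
have kH e e' c : c \in lab e e' -> H (kk e e' c).
  by case: e; case: e' => //; [case/kB|case/kA].
have revE g : H g -> actE g (erev (tG (dT D)) fl) = erev (tG (dT D)) fl -> actE g fl = fl.
  by move=> Hg; rewrite -act_rev // => /(congr1 (erev (tG (dT D)))); rewrite !erevK.
have inj : words_injective lab (fun e e' c => kk e e' c * 1)%g.
  apply: (@tree_words_injective _ _ _ (dT D) _ _ lab E O (fun=> 1%g) kk) => //.
  - by case: Hsub.
  - by case=> /=; rewrite actV1 // /ter erevK.
  - case; case=> //= c; first by case/kB.
    by case/kA.
  - case; case=> //= c cL; rewrite invg1 actE1.
    + have [cB nc cg] := hB _ cL; have [Hg _] := kB _ cL => /(revE _ Hg) gf; apply: nc.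
      by rewrite (lcoset_of_mem Csub cB cg) lcoset_of_id.
    + rewrite erevK => gf; have [cA nc cg] := hA _ cL; have [Hg _] := kA _ cL; apply: nc.
      by rewrite (lcoset_of_mem Csub cA cg) lcoset_of_id.
  - case; case=> // c; case=> // c' cL c'L /= ge; split=> //.
    + have [cB _ cg] := hB _ cL; have [c'B _ c'g] := hB _ c'L.
      have [Hg _] := kB _ cL; have [Hg' _] := kB _ c'L.
      rewrite (lcoset_of_mem Csub cB cg) (lcoset_of_mem Csub c'B c'g).
      apply: lcoset_of_eq => //; apply: stabE_transport => //.
      by move: ge; rewrite -!act_rev // => /(congr1 (erev (tG (dT D)))); rewrite !erevK.
    + have [cA _ cg] := hA _ cL; have [c'A _ c'g] := hA _ c'L.
      have [Hg _] := kA _ cL; have [Hg' _] := kA _ c'L.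
      rewrite (lcoset_of_mem Csub cA cg) (lcoset_of_mem Csub c'A c'g).
      by apply: lcoset_of_eq => //; exact: stabE_transport.
have sK : subexponential (label_matrix x lab (fun e e' c => kk e e' c * 1)%g d).
  apply: (label_matrix_subexponential (Gam := Gam)) => //.
    by case; case.
  by move=> e e' c cl; rewrite mulg1; apply: HG; exact: kH cl.
have := @cycle_weight_le1 _ _ _ 1 (fun i => i != ord0) (label_matrix_nonneg _ _ _ _) sK.
rewrite !big_ord_recl big_ord0 mulr1 /= /label_matrix /=.
by under eq_bigr do rewrite mulg1; under [X in _ * X]eq_bigr do rewrite mulg1.
Qed.

Lemma nontrivial_coset (A' : set (isom X)) : is_subgroup A' -> C0 `<=` A' -> C0 <> A' ->
  [set c | lcosets_of A' C0 c /\ c <> C0] !=set0.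
Proof.
move=> A's CA' ne; have [a A'a nCa] : exists2 a, A' a & ~ C0 a.
  apply: contrapT => nex; apply: ne; apply/seteqP; split=> // a A'a.
  by apply: contrapT => nCa; apply: nex; exists a.
exists (lcoset_of a C0); split; first by exists a.
move=> aC; apply: nCa; rewrite -aC; exists 1%g; rewrite ?mulg1 //; by case: Csub.
Qed.

Lemma coset_min_rep (A' : set (isom X)) c : is_subgroup A' -> C0 `<=` A' -> A' `<=` Gam ->
  lcosets_of A' C0 c -> exists2 g, c g & disp x g = inf [set mdist x (g x) | g in c].
Proof.
move=> A's CA' A'G cA'.
have cG : c `<=` Gam by move=> g /(lcoset_sub A's CA' cA') /A'G.
have [g cg gmin] := disp_min cE (lcoset_nonempty Csub cA') cG.
by exists g => //; rewrite (inf_attained (F := fun g : isom X => mdist x (g x)) cg gmin).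
Qed.

Lemma amalgam_series_le1 : C0 <> A -> C0 <> B ->
  [/\ (coset_series x A C0 d < +oo)%E, (coset_series x B C0 d < +oo)%E &
      (coset_series x A C0 d * coset_series x B C0 d <= 1)%E].
Proof.
move=> nA nB.
have AG : A `<=` Gam by move=> g [/HG].
have BG : B `<=` Gam by move=> g [/HG].
have ex c : exists gg : isom X * isom X,
    (lcosets_of A C0 c -> c gg.1 /\ disp x gg.1 = inf [set mdist x (g x) | g in c]) /\
    (lcosets_of B C0 c -> c gg.2 /\ disp x gg.2 = inf [set mdist x (g x) | g in c]).
  have [g1 h1] : exists g1, lcosets_of A C0 c -> c g1 /\ disp x g1 = inf [set mdist x (g x) | g in c].
    have [/coset_min_rep[]// g cg gd|] := pselect (lcosets_of A C0 c); by [exists g|exists 1%g].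
  have [g2 h2] : exists g2, lcosets_of B C0 c -> c g2 /\ disp x g2 = inf [set mdist x (g x) | g in c].
    have [/coset_min_rep[]// g cg gd|] := pselect (lcosets_of B C0 c); by [exists g|exists 1%g].
  by exists (g1, g2).
pose gg c := projT1 (cid (ex c)); have ggP c := projT2 (cid (ex c)).
pose a c := expR (- d * inf [set mdist x (g x) | g in (c : set (isom X))]).
apply: (@esum_mul_le1 _ _ _ [set c | lcosets_of A C0 c /\ c <> C0]
  [set c | lcosets_of B C0 c /\ c <> C0] a a).
- by move=> c; exact: expR_gt0.
- by move=> c; exact: expR_gt0.
- exact: nontrivial_coset.
- exact: nontrivial_coset.
move=> s1 s2 u1 u2 h1 h2.
have := @amalgam_finite_le1 s1 s2 (fun c => (gg c).1) (fun c => (gg c).2) u1 u2.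
have e1 : \sum_(c <- s1) a c = \sum_(c <- s1) expR (- d * disp x (gg c).1).
  by apply: eq_big_seq => c /h1[/(ggP c).1[_ ->]].
have e2 : \sum_(c <- s2) a c = \sum_(c <- s2) expR (- d * disp x (gg c).2).
  by apply: eq_big_seq => c /h2[/(ggP c).2[_ ->]].
rewrite e1 e2; apply=> c.
  by move=> /h1[cA nc]; split=> //; case: ((ggP c).1 cA).
by move=> /h2[cB nc]; split=> //; case: ((ggP c).2 cB).
Qed.

Lemma amalgam_axis_le1 (FA FB : {fset set (isom X)}) (gA gB : set (isom X) -> isom X) :
  (forall c, c \in FA -> [/\ lcosets_of A C0 c, c <> C0, c (gA c) & hyperbolic (gA c)]) ->
  (forall c, c \in FB -> [/\ lcosets_of B C0 c, c <> C0, c (gB c) & hyperbolic (gB c)]) ->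
  (\sum_(c <- FA) expR (- d * axis_weight x (gA c)))
    * (\sum_(c <- FB) expR (- d * axis_weight x (gB c))) <= 1.
Proof.
move=> hA hB.
have le (S : {fset set (isom X)}) (gS : set (isom X) -> isom X) :
    (forall c, c \in S -> hyperbolic (gS c)) ->
    \sum_(c <- S) expR (- d * axis_weight x (gS c)) <= \sum_(c <- S) expR (- d * disp x (gS c)).
  move=> hS; rewrite big_seq [leRHS]big_seq; apply: ler_sum => c /hS hyp.
  by rewrite ler_expR !mulNr lerN2 (ler_wpM2l (ltW d0)) // axis_disp.
apply: le_trans (@amalgam_finite_le1 FA FB gA gB _ _ _ _).
- by apply: ler_pM; rewrite ?le ?sumr_ge0 // => c; rewrite ?expR_ge0 // => /hA[] || move=> /hB[].
- exact: fset_uniq.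
- exact: fset_uniq.
- by move=> c /hA[].
- by move=> c /hB[].
Qed.

End Amalgam.

Lemma finite_fin_num (W : \bar R) : (0 <= W)%E -> (W < +oo)%E -> W \is a fin_num.
Proof. by move=> W0; rewrite ge0_fin_numE. Qed.

Lemma rel_matrix_diag_le1 (e : dE D) :
  rel_matrix x d e e \is a fin_num /\ (rel_matrix x d e e <= 1)%E.
Proof.
suff le1 : (rel_matrix x d e e <= 1)%E.
  split=> //; apply: finite_fin_num; last exact: le_lt_trans le1 (ltry _).
  by apply: esum_EFin_ge0 => c; exact: expR_ge0.
apply: esum_le_seq => F uF Fal.
have uinj : injective (fun _ : unit => e) by case=> -[].
have sK := @length_matrix_subexponential _ _ x Gam d Gsub d0 cE H D Hsub HG _ _
  (fun _ _ : unit => F) uinj (fun _ _ => uF) (fun _ _ => Fal).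
have := @cycle_weight_le1 _ _ _ 0 (fun=> tt) _ sK; rewrite big_ord_recl big_ord0 mulr1; apply.
by move=> _ _; apply: sumr_ge0 => c _; exact: expR_ge0.
Qed.

Lemma rel_matrix_mixed_le1 (f : dE D) :
  rel_matrix x d f (drev f) <> 0%E -> rel_matrix x d (drev f) f <> 0%E ->
  [/\ rel_matrix x d f (drev f) \is a fin_num, rel_matrix x d (drev f) f \is a fin_num &
      (rel_matrix x d f (drev f) * rel_matrix x d (drev f) f <= 1)%E].
Proof.
move=> n1 n2.
have [] := @esum_mul_le1 R _ _ (allowed f (drev f)) (allowed (drev f) f)
  (fun c => expR (- d * coset_length x (drev f) c)) (fun c => expR (- d * coset_length x f c)).
- by move=> c; exact: expR_gt0.
- by move=> c; exact: expR_gt0.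
- have [|c al] := @transition_allowed _ _ x H D f (drev f); last by exists c.
  by apply/asboolP; exists d.
- have [|c al] := @transition_allowed _ _ x H D (drev f) f; last by exists c.
  by apply/asboolP; exists d.
- move=> s1 s2 u1 u2 h1 h2.
  pose m (b : bool) := if b then f else drev f.
  pose lab (b b' : bool) := if b then (if b' then [::] else s1) else (if b' then s2 else [::]).
  have minj : injective m.
    by case; case=> // fE; case: (@erev_neq _ _ (dY D) f); rewrite -/(drev f) -?fE // fE.
  have labU b b' : uniq (lab b b') by case: b; case: b'.
  have lala b b' c : c \in lab b b' -> allowed (m b) (m b') c.
    by case: b; case: b' => //; [exact: h1 | exact: h2].
  have sK := @length_matrix_subexponential _ _ x Gam d Gsub d0 cE H D Hsub HG _ m lab minj labU lala.
  have := @cycle_weight_le1 _ _ _ 1 (fun i => i == ord0) _ sK.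
  rewrite !big_ord_recl big_ord0 mulr1 /=; apply.
  by move=> b b'; apply: sumr_ge0 => c _; exact: expR_ge0.
- by move=> f1 f2 le1; split=> //; apply: finite_fin_num => //;
    apply: esum_EFin_ge0 => c; exact: expR_ge0.
Qed.

Lemma comparison_cycle_le1 (C : {set dE D}) F rep m (cyc : 'I_m.+1 -> dE D) :
  finite_choice C F rep -> (forall i, cyc i \in C) ->
  \prod_(i < m.+1) comparison_matrix x F rep d (cyc i) (cyc (ordS i)) <= 1.
Proof.
move=> fc inC; have sK := comparison_subexponential Gsub d0 cE axis_disp Hsub HG fc.
have := @cycle_weight_le1 _ _ _ m (fun i => enum_rank_in (inC i) (cyc i)) _ sK.
under eq_bigr do rewrite !enum_rankK_in //.
by apply=> i j; exact: comparison_ge0.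
Qed.

Section Hashimoto.
Variables (c : dE D -> dE D -> set (isom X)) (g : dE D -> dE D -> isom X).
Hypothesis cg : forall e f, hashimoto_rel D e f ->
  relative_coset f (c e f) /\ hyperbolic_rep f (c e f) (g e f).

Let Hmx e f : R := if hashimoto_rel D e f then expR (- d * axis_weight x (g e f)) else 0.

Lemma hashimoto_weight_ge0 e f : 0 <= Hmx e f.
Proof. by rewrite /Hmx; case: ifP => // _; exact: expR_ge0. Qed.

Lemma hashimoto_subexponential (C : {set dE D}) :
  subexponential (fun i j : 'I_#|C| => Hmx (enum_val i) (enum_val j)).
Proof.
pose lab (e f : dE D) := if hashimoto_rel D e f then [:: c e f] else [::].
have labU e f : uniq (lab e f) by rewrite /lab; case: ifP.
have sK := @axis_matrix_subexponential _ _ x Gam d Gsub d0 cE axis_disp H D Hsub HG _ enum_val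
  (fun i j : 'I_#|C| => lab (enum_val i) (enum_val j)) enum_val_inj (fun i j => labU _ _)
  (fun i j _ => g (enum_val i) (enum_val j)).
apply: subexponential_mono (sK _).
- by move=> i j; exact: hashimoto_weight_ge0.
- by move=> i j; rewrite /Hmx /lab; case: ifP => _; rewrite ?big_seq1 ?big_nil.
- move=> i j c'; rewrite /lab; case: ifP => // ef; rewrite inE => /eqP ->.
  have [rc hr] := cg ef; split=> //; case/andP: ef => /eqP tf /eqP nf.
  by split=> // ff.
Qed.

Lemma hashimoto_radius_le1 : block_radius [set: dE D]%SET Hmx <= 1.
Proof.
apply: (block_radius_scale (L := Hmx)) => // [||e f _ _|]; rewrite ?mul1r //;
  by [exact: hashimoto_weight_ge0 | exact: hashimoto_subexponential].
Qed.

(** Transitions between different strong components carry no bound, but they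
   strictly decrease the number of reachable edges: conjugating by the
   exponential of a large multiple of that number absorbs their weights. *)
Lemma hashimoto_log R0 :
  (forall C : {set dE D}, strong_component [set: dE D]%SET (hashimoto_rel D) C ->
     has_directed_cycle (hashimoto_rel D) C ->
     forall e f, e \in C -> f \in C -> hashimoto_rel D e f -> axis_weight x (g e f) <= R0) ->
  1 < block_radius [set: dE D]%SET (hashimoto D) ->
  ln (block_radius [set: dE D]%SET (hashimoto D) : R) <= d * R0.
Proof.
move=> hR N1; rewrite -[leRHS]expRK ler_ln ?posrE ?expR_gt0 ?(lt_trans ltr01) //.
pose r := hashimoto_rel D.
pose reach e := [set h | connect r e h]%SET.
pose Rm := `|R0| + \sum_e \sum_f `|axis_weight x (g e f)|.
have s0 e : 0 <= \sum_f `|axis_weight x (g e f)| by apply: sumr_ge0.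
have RmP e f : axis_weight x (g e f) - R0 <= Rm.
  rewrite /Rm (bigD1 e) //= (bigD1 f) //=.
  have := ler_norm (- R0); rewrite normrN => nR0; have nA := ler_norm (axis_weight x (g e f)).
  have sf : 0 <= \sum_(i | i != f) `|axis_weight x (g e i)| by apply: sumr_ge0.
  have se : 0 <= \sum_(i | i != e) \sum_f0 `|axis_weight x (g i f0)| by apply: sumr_ge0.
  lra.
have Rm0 : 0 <= Rm by rewrite addr_ge0 // sumr_ge0.
pose phi e : R := Rm * #|reach e|%:R.
have phiP e f : r e f -> axis_weight x (g e f) <= R0 + phi e - phi f.
  move=> ef; have sub : reach f \subset reach e.
    by apply/fintype.subsetP => h; rewrite !inE; exact: connect_trans (connect1 ef).
  have [fe|nfe] := boolP (connect r f e).
    have -> : phi e = phi f.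
      rewrite /phi; congr (_ * _%:R); apply/eqP; rewrite eqn_leq (subset_leq_card sub) andbT.
      by apply: subset_leq_card; apply/fintype.subsetP => h; rewrite !inE; exact: connect_trans.
    rewrite addrK.
    have cT : connect [rel e f | [&& e \in [set: dE D]%SET, f \in [set: dE D]%SET & r e f]] =2 connect r.
      by apply: eq_connect => a b /=; rewrite !inE.
    pose C := [set h | connect r e h && connect r h e]%SET.
    apply: (hR C); rewrite ?inE ?connect0 ?fe ?connect1 //.
      exists e; rewrite ?inE //; apply/setP => h; rewrite !inE.
      by rewrite (cT e h) (cT h e).
    case/connectP: (fe) => p pf pe; exists (f :: p); split=> //.
      by rewrite /= rcons_path pf -pe.
    move=> h hp; rewrite inE; apply/andP; split.
      by apply: connect_trans (connect1 ef) _; apply: path_connect pf _ hp.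
    rewrite pe; move: hp; rewrite inE => /predU1P[->|hp]; first by apply/connectP; exists p.
    case/splitPr: hp pf pe => p1 p2; rewrite cat_path last_cat /= => /and3P[_ _ p2P] _.
    by apply/connectP; exists p2.
  have lt : (#|reach f| < #|reach e|)%N.
    apply: proper_card; apply/properP; split=> //; exists e; rewrite !inE ?connect0 //.
  have : phi f + Rm <= phi e.
    by rewrite /phi -{2}[Rm]mulr1 -mulrDr ler_wpM2l // natr1 ler_nat.
  by have := RmP e f; lra.
apply: block_radius_le; rewrite ?expR_ge0 //.
pose u (i : 'I_#|[set: dE D]%SET|) := expR (d * phi (enum_val i)).
apply: (@subexponential_le _ _ _ (fun i j => Hmx (enum_val i) (enum_val j)) u _ 1);
  rewrite ?expR_ge0 ?ltr01 //.
- by move=> i j; exact: hashimoto_weight_ge0.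
- by move=> i; rewrite -expR0 ler_expR mulr_ge0 ?(ltW d0) // mulr_ge0.
- move=> i j; rewrite /hashimoto /Hmx; case: ifP => ef; last by rewrite mul0r !mulr0.
  rewrite mul1r -!expRD ler_expR mulNr addrA -mulrDr -mulrBr (ler_wpM2l (ltW d0)) //.
  by have := phiP _ _ ef; lra.
- exact: hashimoto_subexponential.
Qed.

End Hashimoto.

End SpecialDecompositions.

(** * Free products and alternating words *)

Section FreeProducts.
Variable gT : groupType.
Implicit Types (g h : gT).

Lemma word_prod_cat (u v : seq gT) : word_prod (u ++ v) = (word_prod u * word_prod v)%g.
Proof. by elim: u => [|g u IH] /=; rewrite ?mul1g // IH mulgA. Qed.

Lemma word_prod_rev (w : seq gT) : word_prod (rev (map (fun g => g^-1)%g w)) = (word_prod w)^-1%g.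
Proof.
elim: w => [|g w IH] /=; first by rewrite invg1.
by rewrite rev_cons -cats1 word_prod_cat IH /= mulg1 invgM.
Qed.

Lemma zpowS g (n : int) : zpow g (n + 1) = (zpow g n * g)%g.
Proof.
case: n => [n|n].
  have -> : Posz n + 1 = Posz n.+1 by lia.
  by rewrite /= expgSr.
case: n => [|n]; first by rewrite (_ : Negz 0 + 1 = 0) // /= expg1 mulVg.
have -> : Negz n.+1 + 1 = Negz n by lia.
by rewrite /= [(g ^+ n.+2)%g]expgS invgM mulgVK.
Qed.

Lemma zpowD g (m n : int) : zpow g (m + n) = (zpow g m * zpow g n)%g.
Proof.
have zpowP k : zpow g (k - 1) = (zpow g k * g^-1)%g.
  by rewrite -{2}[k](subrK 1) zpowS mulgK.
elim/int_rec: n => [|n IH|n IH]; first by rewrite addr0 mulg1.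
  have -> : n.+1%:Z = n%:Z + 1 by lia.
  by rewrite addrA !zpowS IH mulgA.
have -> : - (n.+1)%:Z = - n%:Z - 1 :> int by lia.
by rewrite addrA !zpowP IH mulgA.
Qed.

Section Alternating.
Variables (I : eqType) (K : I -> set gT).
Hypothesis Ksub : forall i, is_subgroup (K i).

Definition alternating (w : seq (I * gT)) :=
  (forall l, l \in w -> K l.1 l.2 /\ l.2 <> 1%g) /\ sorted (fun l l' => l.1 != l'.1) w.

Hypothesis free : forall w, w <> [::] -> alternating w -> word_prod (map snd w) <> 1%g.

Lemma alternating_behead l w : alternating (l :: w) -> alternating w.
Proof.
case=> Kw /=; case: w Kw => [|l' w] Kw /=; first by split.
by case/andP=> _ ?; split=> // a aw; apply: Kw; rewrite inE aw orbT.
Qed.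

Let inv_word (w : seq (I * gT)) := rev (map (fun l => (l.1, l.2^-1)%g) w).

Let inv_wordE w : word_prod (map snd (inv_word w)) = (word_prod (map snd w))^-1%g.
Proof. by rewrite /inv_word map_rev -map_comp -word_prod_rev -map_comp. Qed.

Lemma inv_word_cat v l u : alternating (l :: v) -> alternating (l :: u) ->
  forall g, K l.1 g -> g <> 1%g -> alternating (inv_word v ++ (l.1, g) :: u).
Proof.
move=> [Kv sv] [Ku su] g Kg g1; split.
  move=> a; rewrite mem_cat mem_rev => /orP[/mapP[b bv ->]|] /=.
    have [|Kb b1] := Kv b; first by rewrite inE bv orbT.
    split; first by case: (Ksub b.1) => _ _; apply.
    by move=> /(congr1 (fun g => g^-1)%g); rewrite invgK invg1.
  by rewrite inE => /predU1P[->//|au]; apply: Ku; rewrite inE au orbT.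
have su' : path (fun l l' : I * gT => l.1 != l'.1) (l.1, g) u by case: u su {Ku}.
have : sorted (fun l l' : I * gT => l.1 != l'.1) (inv_word ((l.1, g) :: v)).
  rewrite /inv_word rev_sorted sorted_map /=.
  by case: v sv {Kv} => //= a v /andP[h1 h2]; rewrite eq_sym h1 /=; apply: sub_path h2 => ? ? /=; rewrite eq_sym.
rewrite /inv_word map_cons rev_cons; case: (rev _) => [|a s] //=.
by rewrite rcons_path cat_path /= su' => /andP[-> ->].
Qed.

(** Cancel equal first letters.  At the first difference, the inverse of one
   word times the other is, after merging the two letters in the middle if they
   lie in the same factor, a nonempty alternating word. *)
Lemma alternating_inj u v : alternating u -> alternating v ->
  word_prod (map snd u) = word_prod (map snd v) -> u = v.
Proof.
elim: u v => [|l u IH] [|l' v] // hu hv.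
- by move=> E; case: (free (w := l' :: v) _ hv).
- by move=> E; case: (free (w := l :: u) _ hu).
rewrite /= => E.
have [ll|ll] := eqVneq l.1 l'.1; last first.
  exfalso; apply: (free (w := inv_word (l' :: v) ++ l :: u)).
  - by move/(congr1 size); rewrite size_cat addnS.
  - have hl : alternating (l :: l' :: v).
      case: hv => Kv sv; case: hu => Ku _; split; last by rewrite /= ll.
      by move=> a; rewrite inE => /predU1P[->|/Kv//]; apply: Ku; rewrite mem_head.
    have [Kl l1] := hu.1 l (mem_head _ _).
    by have := inv_word_cat hl hu Kl l1; rewrite -surjective_pairing.
  - by rewrite map_cat word_prod_cat inv_wordE /= E mulVg.
have [g|g] := pselect (l.2 = l'.2).
  rewrite (IH v) //; try by [exact: alternating_behead hu|exact: alternating_behead hv].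
    by congr cons; rewrite [l]surjective_pairing ll g -surjective_pairing.
  by move: E; rewrite g => /mulgI.
exfalso; apply: (free (w := inv_word v ++ (l.1, l'.2^-1 * l.2)%g :: u)).
- by move/(congr1 size); rewrite size_cat addnS.
- have [Kl l1] := hu.1 l (mem_head _ _); have [Kl' l1'] := hv.1 l' (mem_head _ _).
  apply: inv_word_cat => //.
  + case: hv => Kv sv; split; last by case: v sv {Kv E} => //= a v; rewrite ll.
    by move=> a; rewrite inE => /predU1P[->//|av]; apply: Kv; rewrite inE av orbT.
  + case: (Ksub l.1) => _ KM KV; apply: KM => //; by rewrite ll; case: (Ksub l'.1) => _ _; apply.
  + by move=> e1; apply: g; rewrite -[RHS]mulg1 -e1 mulVKg.
- by rewrite map_cat word_prod_cat inv_wordE /= -(mulgA l'.2^-1%g) E mulKg mulVg.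
Qed.

End Alternating.
End FreeProducts.

Section GrushkoFactors.
Variables (gT : groupType) (p r : nat) (G : 'I_p -> set gT) (b : 'I_r -> gT) (Gam F : set gT).
Hypothesis Fb : free_basis b F.
Hypothesis GF : free_product Gam (fun k : option 'I_p => if k is Some i then G i else F).

(** Splitting F_r along its basis keeps the product free, and makes the
   cyclic groups generated by the basis elements free factors. *)
Definition factor (k : 'I_p + 'I_r) : set gT :=
  match k with inl i => G i | inr j => range (zpow (b j)) end.

Lemma factor_subgroup k : is_subgroup (factor k).
Proof.
case: k => [i|j] /=; first by case: GF => /(_ (Some i)).
split; first by exists 0.
  by move=> _ _ [m _ <-] [n _ <-]; exists (m + n) => //; rewrite zpowD.
move=> _ [m _ <-]; exists (- m) => //.
by apply: (mulgI (zpow (b j) m)); rewrite -zpowD subrr mulgV.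
Qed.

Let spell (l : 'I_r * int) : seq ('I_r * bool) := nseq `|l.2|%N (l.1, l.2 < 0).
Let letter (l : 'I_r * bool) := if l.2 then (b l.1)^-1%g else b l.1.
Let adj (l l' : 'I_r * bool) := ~~ ((l.1 == l'.1) && (l.2 != l'.2)).

Let spellE l : word_prod (map letter (spell l)) = zpow (b l.1) l.2.
Proof.
have powE g n : word_prod (nseq n g) = (g ^+ n)%g.
  by elim: n => [|n IH] //; rewrite /= IH -expgS.
by case: l => j [n|n]; rewrite /spell map_nseq powE //= -expVgn.
Qed.

Let spell_sorted (w : seq ('I_r * int)) :
  (forall l, l \in w -> l.2 != 0) -> sorted (fun l l' => l.1 != l'.1) w ->
  sorted adj (flatten (map spell w)) /\
  ohead (map fst (flatten (map spell w))) = ohead (map fst w).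
Proof.
elim: w => [|l w IH] //= n0 sw.
have n0' a : a \in w -> a.2 != 0 by move=> aw; apply: n0; rewrite inE aw orbT.
have sw' : sorted (fun l l' : 'I_r * int => l.1 != l'.1) w.
  by case: w sw {IH n0 n0'} => //= a w /andP[].
have [sE hE] := IH n0' sw'.
have : l.2 != 0 by apply: n0; rewrite mem_head.
rewrite -absz_gt0 /spell -/spell; case: `|l.2|%N => // n _; split=> //.
rewrite /= cat_path; set a := (l.1, _).
have -> : last a (nseq n a) = a by elim: n.
apply/andP; split.
  elim: n => //= n ->; by rewrite /adj !eqxx.
move: sE hE; case: (flatten _) => // c s /= -> cw; rewrite andbT /adj /a /= negb_and.
apply/orP; left; case: w cw sw {IH n0 n0' sw'} => //= l' w [-> ]; by case/andP.
Qed.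

(** Spelling out the powers gives a reduced word in the basis. *)
Lemma zpow_word_neq1 (w : seq ('I_r * int)) : w <> [::] ->
  (forall l, l \in w -> l.2 != 0) -> sorted (fun l l' => l.1 != l'.1) w ->
  word_prod [seq zpow (b l.1) l.2 | l <- w] <> 1%g.
Proof.
move=> wne n0 sw; have [sE hE] := spell_sorted n0 sw.
have -> : word_prod [seq zpow (b l.1) l.2 | l <- w] = word_prod (map letter (flatten (map spell w))).
  by elim: w {wne n0 sw sE hE} => //= l w ->; rewrite map_cat word_prod_cat spellE.
case: Fb => _; apply; last exact: sE.
by move=> e; rewrite e in hE; case: w wne hE {n0 sw sE e}.
Qed.

Lemma zpow_basis_inj j : injective (zpow (b j)).
Proof.
move=> m n mn; apply/eqP; rewrite -subr_eq0; apply/negPn/negP => ne.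
apply: (@zpow_word_neq1 [:: (j, m - n)]) => //=; first by move=> l; rewrite inE => /eqP ->.
rewrite mulg1 zpowD mn -zpowD subrr //.
Qed.

Let K (k : option 'I_p) : set gT := if k is Some i then G i else F.

(** The word m is w with maximal runs of powers of basis elements multiplied
   out, so that it alternates between the G_i and F; the last clause remembers
   the first run, which the induction has to extend. *)
Let merged (w : seq (('I_p + 'I_r) * gT)) (m : seq (option 'I_p * gT)) : Prop :=
  [/\ alternating K m, word_prod (map snd m) = word_prod (map snd w) &
  match w with
  | [::] => m = [::]
  | (inl i, _) :: _ => exists h m', m = (Some i, h) :: m'
  | (inr j, _) :: _ => exists u m', [/\ m = (None, word_prod [seq zpow (b l.1) l.2 | l <- u]) :: m',
      forall l, l \in u -> l.2 != 0, sorted (fun l l' => l.1 != l'.1) u & ohead (map fst u) = Some j]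
  end].

Let zpowF j n : F (zpow (b j) n).
Proof.
have Fs : is_subgroup F by case: GF => /(_ None).
have Fbj : F (b j).
  by case: Fb => -> _ S _; apply; exists j.
have Fp k : F (b j ^+ k)%g.
  case: Fs => F1 FM _; elim: k => [|k IH] //; rewrite expgS; exact: FM.
by case: n => n //=; case: Fs => _ _; apply.
Qed.

Let mergeP w : alternating factor w -> exists m, merged w m.
Proof.
have Fs : is_subgroup F by case: GF => /(_ None).
elim: w => [|l w IH] hw; first by exists [::]; split=> //; split.
have [m [[Km sm] mE mh]] := IH (alternating_behead hw).
have [Kl l1] := hw.1 l (mem_head _ _).
have hd : forall l' w', w = l' :: w' -> l.1 != l'.1.
  by move=> l' w' e; case: hw => _; rewrite e /= => /andP[].
case: l Kl l1 hw hd => -[i|j] g /= Kl l1 hw hd.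
  exists ((Some i, g) :: m); split; last by exists g, m.
  - split; first by move=> a; rewrite inE => /predU1P[->//|/Km].
    case: m sm mh {Km mE} => //= a m -> ; rewrite andbT.
    case: w hd {IH hw} => [|[[i'|j'] g'] w'] hd //= [h [m' []]]; last by case=> -> _.
    by move=> -> _; have := hd _ _ erefl.
  - by rewrite /= mE.
case: Kl => n _ ng.
have n0 : n != 0 by apply/eqP => n0; apply: l1; rewrite -ng n0.
have valid u : u <> [::] -> (forall l, l \in u -> l.2 != 0) ->
    sorted (fun l l' : 'I_r * int => l.1 != l'.1) u ->
    F (word_prod [seq zpow (b l.1) l.2 | l <- u]) /\ word_prod [seq zpow (b l.1) l.2 | l <- u] <> 1%g.
  move=> une u0 su; split; last exact: zpow_word_neq1.
  case: Fs => F1 FM _; elim: u {une u0 su} => //= l u IHu; apply: FM => //; exact: zpowF.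
have fresh : (forall h m', m <> (None, h) :: m') -> exists m0, merged ((inr j, g) :: w) m0.
  move=> nN; exists ((None, g) :: m); split.
  - split; first by move=> a; rewrite inE => /predU1P[->|/Km//]; rewrite -ng; split=> //=; rewrite ng.
    by case: m nN sm {Km mE mh} => //= -[[i|] h] m nN -> //; case: (nN h m).
  - by rewrite /= mE.
  - exists [:: (j, n)], m; rewrite /= mulg1 ng; split=> // l; by rewrite inE => /eqP ->.
case: w IH hw hd mE mh fresh => [|[[i'|j'] g'] w'] IH hw hd mE mh fresh.
- by apply: fresh => h m'; rewrite mh.
- by apply: fresh => h m'; case: mh => h' [m'' ->].
case: mh => u [m' [mE' u0 su uh]].
have jj' : j != j' by have := hd _ _ erefl.
have su' : sorted (fun l l' : 'I_r * int => l.1 != l'.1) ((j, n) :: u).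
  by case: u su uh {u0 mE'} => //= a u -> [->]; rewrite jj'.
have u0' l : l \in (j, n) :: u -> l.2 != 0 by rewrite inE => /predU1P[->//|/u0].
have une : (j, n) :: u <> [::] by [].
have [vF v1] := valid _ une u0' su'.
exists ((None, word_prod [seq zpow (b l.1) l.2 | l <- (j, n) :: u]) :: m'); split.
- split; last by move: sm; rewrite mE'; case: (m').
  move=> a; rewrite inE => /predU1P[->|am]; first by split=> //; exact: v1.
  by apply: Km; rewrite mE' inE am orbT.
- by move: mE; rewrite mE' /= => <-; rewrite ng mulgA.
- by exists ((j, n) :: u), m'.
Qed.

Theorem factor_free w : w <> [::] -> alternating factor w -> word_prod (map snd w) <> 1%g.
Proof.
move=> wne hw; have [m [[Km sm] <- mh]] := mergeP hw.
case: GF => _ _; apply=> //.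
by case: w wne mh {hw} => [//|[[i|j] g] w] _; [case=> h [m' ->] | case=> u [m' [->]]].
Qed.

End GrushkoFactors.

(** * The free product inequality *)

Section FreeProductInequality.
Variables (R : realType) (X : metricType R) (x : X) (Gam : set (isom X)) (d : R).
Hypothesis Gsub : is_subgroup Gam.
Hypothesis d0 : 0 < d.
Hypothesis cE : critical_exponent x Gam = d%:E.
Variables (I : finType) (K : I -> set (isom X)).
Hypothesis Ksub : forall i, is_subgroup (K i).
Hypothesis KG : forall i, K i `<=` Gam.
Hypothesis free : forall w, w <> [::] -> alternating K w -> word_prod (map snd w) <> 1%g.

(** The matrix with entry w_j from i to j <> i, and zero diagonal, counts
   alternating words.  Let S be the sum of the w_j / (1 + w_j) and
   v_i = 1 / (1 + w_i).  Then (K v)_i = S - w_i v_i = S - 1 + v_i, which is at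
   least S v_i if S > 1, and rowsum_eigvec applies. *)
Lemma free_product_finite (L : I -> seq (isom X)) :
  (forall i, uniq (L i)) -> (forall i t, t \in L i -> K i t /\ t <> 1%g) ->
  \sum_i (\sum_(t <- L i) expR (- d * disp x t)) / (1 + \sum_(t <- L i) expR (- d * disp x t)) <= 1.
Proof.
move=> LU LK.
pose lab (i j : I) := if i == j then [::] else L j.
pose el (i j : I) (t : isom X) := t.
have elE e w : word_elt el e w = word_prod (map snd w).
  by elim: w e => //= l w IH e; rewrite IH.
have altP n e w : w \in words lab n e ->
    alternating K w /\ path (fun i j => i != j) e (map fst w).
  elim: n e w => [|n IH] e w /=; first by rewrite inE => /eqP ->; split=> //; split.
  case/allpairsPdep => l [w' [ls w's ->]]; rewrite mem_steps /lab in ls.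
  case: eqVneq ls => // el' tl; have [[Kw sw] pw] := IH _ _ w's.
  split; last by rewrite /= el' pw.
  split; first by move=> a; rewrite inE => /predU1P[->|/Kw//]; exact: LK.
  by move: pw; rewrite /= path_map.
have inj : words_injective lab el.
  move=> n e w w' /altP[aw _] /altP[aw' _] _; rewrite !elE.
  exact: (alternating_inj Ksub free).
pose w i := \sum_(t <- L i) expR (- d * disp x t).
have w0 i : 0 <= w i by apply: sumr_ge0 => t _; exact: expR_ge0.
have sK : subexponential (label_matrix x lab el d).
  apply: (label_matrix_subexponential (Gam := Gam)) => //.
    by move=> i j; rewrite /lab; case: ifP.
  by move=> i j t; rewrite /lab; case: ifP => // _ /LK[/KG].
have KE i j : label_matrix x lab el d i j = if i == j then 0 else w j.
  by rewrite /label_matrix /lab; case: ifP => // _; rewrite big_nil.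
set S := \sum_i _; rewrite leNgt; apply/negP => S1.
have [e _] : exists e : I, true.
  apply: contrapT => ne; move: S1; rewrite /S big1 ?ltr10 // => i _.
  by case: ne; exists i.
have p0 i : 0 < 1 + w i by rewrite ltr_pwDl.
suff : S <= 1 by rewrite leNgt S1.
apply: (@rowsum_eigvec _ _ _ (fun i => (1 + w i)^-1) S e (label_matrix_nonneg _ _ _ _) sK).
- by rewrite ltW // (lt_trans ltr01).
- by move=> i; rewrite invr_gt0 p0 invf_le1 // lerDl w0.
move=> i.
have -> : \sum_f label_matrix x lab el d i f * (1 + w f)^-1 = S - w i / (1 + w i).
  rewrite /S [in RHS](bigD1 i) //= -/(w i) addrAC subrr add0r (bigD1 i) //=.
  rewrite KE eqxx mul0r add0r; apply: eq_bigr => j ji.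
  by rewrite KE eq_sym (negbTE ji).
have -> : w i / (1 + w i) = 1 - (1 + w i)^-1 by field; exact: lt0r_neq0.
have : (1 + w i)^-1 <= 1 by rewrite invf_le1 // lerDl w0.
move: (_^-1) => v v1; move: S1; nra.
Qed.

Lemma ratio1_approx (T : choiceType) (S : set T) (a : T -> R) (eps : R) :
  (forall t, 0 <= a t) -> 0 < eps ->
  exists s, [/\ uniq s, forall t, t \in s -> S t &
    ratio1 (\esum_(t in S) (a t)%:E) - eps <= (\sum_(t <- s) a t) / (1 + \sum_(t <- s) a t)].
Proof.
move=> a0 eps0; have W0 := esum_EFin_ge0 S a0.
have [fin|] := boolP ((\esum_(t in S) (a t)%:E)%E < +oo)%E.
  have [s [us sS le]] := esum_fin_approx a0 eps0 fin; exists s; split=> //.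
  have s0 : 0 <= \sum_(t <- s) a t by apply: sumr_ge0.
  have ge := seq_le_esum a us sS.
  move: W0 fin le ge; case: (esum _ _) => [W||] //; rewrite !lee_fin /= => W0 _ le ge.
  move: (\sum_(t <- s) a t) s0 le ge => sg s0 le ge.
  have -> : W / (1 + W) = 1 - (1 + W)^-1 by field; apply: lt0r_neq0; rewrite ltr_pwDl.
  have -> : sg / (1 + sg) = 1 - (1 + sg)^-1 by field; apply: lt0r_neq0; rewrite ltr_pwDl.
  have -> : (1 + sg)^-1 = (1 + W)^-1 + (W - sg) / ((1 + W) * (1 + sg)).
    by field; apply/andP; split; apply: lt0r_neq0; rewrite ltr_pwDl.
  suff : (W - sg) / ((1 + W) * (1 + sg)) <= W - sg by lra.
  rewrite ler_pdivrMr ?mulr_gt0 ?ltr_pwDl // ler_peMr ?subr_ge0 //.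
  by rewrite mulr_ege1 // lerDl.
rewrite -leNgt leye_eq => /eqP E; rewrite E /=.
have [s [us sS ge]] : exists s, [/\ uniq s, forall t, t \in s -> S t & eps^-1 < \sum_(t <- s) a t].
  apply: contrapT => nex; have : (\esum_(t in S) (a t)%:E <= (eps^-1)%:E)%E.
    by apply: esum_le_seq => s us sS; rewrite leNgt; apply/negP => lt; apply: nex; exists s.
  by rewrite E leye_eq.
exists s; split=> //; have s0 : 0 <= \sum_(t <- s) a t by apply: sumr_ge0.
move: (\sum_(t <- s) a t) s0 ge => sg s0 ge.
have -> : sg / (1 + sg) = 1 - (1 + sg)^-1 by field; apply: lt0r_neq0; rewrite ltr_pwDl.
rewrite lerD2l lerN2 -[leRHS]invrK lef_pV2 ?posrE ?invr_gt0 // ?ltr_pwDl //; lra.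
Qed.

End FreeProductInequality.

Section Grushko.
Variables (R : realType) (X : metricType R) (x : X) (Gam : set (isom X)) (d : R).
Hypothesis Gsub : is_subgroup Gam.
Hypothesis d0 : 0 < d.
Hypothesis cE : critical_exponent x Gam = d%:E.
Variables (p r : nat) (G : 'I_p -> set (isom X)) (b : 'I_r -> isom X).
Hypothesis gd : grushko_decomposition G b Gam.

Theorem grushko_inequality :
  \sum_(i < p) ratio1 (orbit_series x (G i `\ 1%g) d)
      + \sum_(j < r) ratio1 (cyclic_series x (b j) d) <= 1.
Proof.
case: gd => -[F [Fb GF]] _.
have Fs : is_subgroup F by case: GF => /(_ None).
have KG k : factor G b k `<=` Gam.
  case: (GF) => _ -> _; case: k => [i|j] /=.
    by move=> g Gg S _ sub; apply: sub; exists (Some i).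
  move=> _ [n _ <-] S Ss sub; have Sb : S (b j).
    by apply: sub; exists None => //; case: Fb => -> _ S' _; apply; exists j.
  have Sp k : S (b j ^+ k)%g.
    case: Ss => S1 SM _; elim: k => [|k IH] //; rewrite expgS; exact: SM.
  by case: n => n //=; case: Ss => _ _; apply.
apply/ler_addgt0Pr => eps eps0.
pose e := eps / (#|{: 'I_p + 'I_r}|%:R + 1).
have e0 : 0 < e by rewrite divr_gt0 // ltr_wpDl.
pose rat k := match k with inl i => ratio1 (orbit_series x (G i `\ 1%g) d)
  | inr j => ratio1 (cyclic_series x (b j) d) end.
have ex (k : 'I_p + 'I_r) : exists s, [/\ uniq s, forall t, t \in s -> factor G b k t /\ t <> 1%g &
    rat k - e <= (\sum_(t <- s) expR (- d * disp x t)) / (1 + \sum_(t <- s) expR (- d * disp x t))].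
  case: k => [i|j] /=.
    have [s [us sS le]] := ratio1_approx (G i `\ 1%g) (fun g : isom X => expR_ge0 (- d * disp x g)) e0.
    by exists s; split=> // t /sS[].
  have [s [us sS le]] := ratio1_approx [set n : int | n <> 0]
    (fun n => expR_ge0 (- d * disp x (zpow (b j) n))) e0.
  have inj := zpow_basis_inj Fb (j := j).
  exists (map (zpow (b j)) s); rewrite map_inj_uniq //; split=> //; last by rewrite !big_map.
  move=> _ /mapP[n /sS n0 ->]; split; first by exists n.
  by move=> E; apply: n0; apply: inj.
pose L k := projT1 (cid (ex k)); have LP k := projT2 (cid (ex k)).
have := @free_product_finite _ _ x Gam d Gsub d0 cE _ (factor G b) (factor_subgroup b GF) KG
  (factor_free Fb GF) L (fun k => let: And3 u _ _ := LP k in u) (fun k => let: And3 _ v _ := LP k in v).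
move=> le.
have -> : \sum_(i < p) ratio1 (orbit_series x (G i `\ 1%g) d)
      + \sum_(j < r) ratio1 (cyclic_series x (b j) d) = \sum_k rat k by rewrite big_sumType.
apply: (@le_trans _ _ (\sum_k ((\sum_(t <- L k) expR (- d * disp x t)) / (1 + \sum_(t <- L k) expR (- d * disp x t)) + e))).
  by apply: ler_sum => k _; rewrite -lerBlDr; case: (LP k).
rewrite big_split /= lerD // sumr_const -mulr_natl /e mulrCA ler_piMr ?(ltW eps0) //.
by rewrite ler_pdivrMr ?mul1r ?lerDl // ltr_wpDl.
Qed.

End Grushko.

(** * Comparison with the hyperbolic plane *)

Section HyperbolicFunctions.
Variable R : realType.
Implicit Types a b t : R.

Definition cosh a : R := (expR a + expR (- a)) / 2.
Definition sinh a : R := (expR a - expR (- a)) / 2.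

Lemma coshN a : cosh (- a) = cosh a.
Proof. by rewrite /cosh opprK addrC. Qed.

Lemma cosh0 : cosh 0 = 1.
Proof. by rewrite /cosh oppr0 expR0; lra. Qed.

Lemma sinh0 : sinh 0 = 0.
Proof. by rewrite /sinh oppr0 expR0; lra. Qed.

Lemma cosh_sqr a : cosh a ^+ 2 = 1 + sinh a ^+ 2.
Proof.
rewrite /cosh /sinh; have := expRxMexpNx_1 a.
by move: (expR a) (expR (- a)) => u v; nra.
Qed.

Lemma coshD a b : cosh (a + b) = cosh a * cosh b + sinh a * sinh b.
Proof. by rewrite /cosh /sinh opprD !expRD; field. Qed.

Lemma coshB a b : cosh (a - b) = cosh a * cosh b - sinh a * sinh b.
Proof. by rewrite /cosh /sinh opprD opprK !expRD; field. Qed.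

Lemma sinhD a b : sinh (a + b) = sinh a * cosh b + cosh a * sinh b.
Proof. by rewrite /cosh /sinh opprD !expRD; field. Qed.

Lemma cosh_diff a b : cosh (a + b) - cosh (a - b) = 2 * sinh a * sinh b.
Proof. by rewrite coshD coshB; lra. Qed.

Lemma sinh_ge0 a : 0 <= a -> 0 <= sinh a.
Proof. by move=> a0; rewrite divr_ge0 // subr_ge0 ler_expR; lra. Qed.

Lemma sinh_gt0 a : 0 < a -> 0 < sinh a.
Proof. by move=> a0; rewrite divr_gt0 // subr_gt0 ltr_expR; lra. Qed.

Lemma cosh_ge1 a : 1 <= cosh a.
Proof.
have := sqr_ge0 (sinh a); have : 0 < cosh a by rewrite divr_gt0 // addr_gt0 // expR_gt0.
by have := cosh_sqr a; nra.
Qed.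

Lemma cosh_norm a : cosh `|a| = cosh a.
Proof. by case: (ger0P a); rewrite ?coshN. Qed.

Lemma cosh_le a b : 0 <= a -> a <= b -> cosh a <= cosh b.
Proof.
move=> a0 ab; rewrite -subr_ge0.
have := cosh_diff ((b + a) / 2) ((b - a) / 2).
have -> : (b + a) / 2 + (b - a) / 2 = b by field.
have -> : (b + a) / 2 - (b - a) / 2 = a by field.
by move=> ->; apply: mulr_ge0; [apply: mulr_ge0 => //|]; apply: sinh_ge0; lra.
Qed.

Lemma cosh_lt a b : 0 <= a -> a < b -> cosh a < cosh b.
Proof.
move=> a0 ab; rewrite -subr_gt0.
have := cosh_diff ((b + a) / 2) ((b - a) / 2).
have -> : (b + a) / 2 + (b - a) / 2 = b by field.
have -> : (b + a) / 2 - (b - a) / 2 = a by field.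
by move=> ->; apply: mulr_gt0; [apply: mulr_gt0 => //|]; apply: sinh_gt0; lra.
Qed.

Lemma cosh_le_inv a b : 0 <= b -> cosh a <= cosh b -> a <= b.
Proof. by move=> b0; rewrite !leNgt; apply: contra => /(cosh_lt b0). Qed.

Lemma cosh_half a : cosh a = 1 + 2 * sinh (a / 2) ^+ 2.
Proof.
have {1}-> : a = a / 2 + a / 2 by field.
by rewrite coshD -!expr2 cosh_sqr; lra.
Qed.

Lemma sinh_ge_half a : 0 <= a -> a / 2 <= sinh a.
Proof.
move=> a0; have e1 := expR_ge1Dx a; have e2 := expRxMexpNx_1 a.
have e3 := expR_gt0 (- a); rewrite /sinh.
move: (expR a) (expR (- a)) e1 e2 e3 => u v; nra.
Qed.

Lemma cosh_arcosh t : 1 <= t -> 0 <= arcosh t /\ cosh (arcosh t) = t.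
Proof.
move=> t1; set q := Num.sqrt (t ^+ 2 - 1).
have q0 : 0 <= q by exact: sqrtr_ge0.
have qq : q ^+ 2 = t ^+ 2 - 1 by rewrite sqr_sqrtr //; nra.
have tq : 1 <= t + q by lra.
have tq0 : 0 < t + q by lra.
split; first by rewrite ln_ge0.
rewrite /cosh /arcosh -/q expRN lnK ?posrE //.
have -> : (t + q)^-1 = t - q; last by lra.
apply: (mulfI (lt0r_neq0 tq0)); rewrite mulfV ?lt0r_neq0 //; nra.
Qed.

Lemma arcosh_cosh a : 0 <= a -> arcosh (cosh a) = a.
Proof.
move=> a0; rewrite /arcosh.
have -> : Num.sqrt (cosh a ^+ 2 - 1) = sinh a.
  by rewrite cosh_sqr addrAC subrr add0r sqrtr_sqr ger0_norm // sinh_ge0.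
have -> : cosh a + sinh a = expR a by rewrite /cosh /sinh; lra.
exact: expRK.
Qed.

End HyperbolicFunctions.

Section Hyperboloid.
Variable R : realType.

(** The second coordinate in the half plane of the point with polar
   coordinates (a, theta) around i, for k = cos theta and l = sin theta, is
   1 / (cosh a - k sinh a). *)
Lemma polar_pos (a k l : R) : k ^+ 2 + l ^+ 2 = 1 -> 0 < cosh a - k * sinh a.
Proof.
move=> kl; have c1 := cosh_ge1 a; have cs := cosh_sqr a.
have : (k * sinh a) ^+ 2 < cosh a ^+ 2.
  by have := sqr_ge0 (l * sinh a); nra.
rewrite subr_gt0 => h; apply: le_lt_trans (ler_norm _) _.
by rewrite -(@ltr_pXn2r _ 2) ?nnegrE // ?real_normK ?num_real // (le_trans ler01).
Qed.

Definition polar (a k l : R) (kl : k ^+ 2 + l ^+ 2 = 1) : hplane R :=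
  exist _ (l * sinh a / (cosh a - k * sinh a), (cosh a - k * sinh a)^-1)
    (let h := polar_pos a kl in etrans (invr_gt0 _) h).

(** The law of cosines: the point with polar coordinates (a, theta) is
   (cosh a, k sinh a, l sinh a) on the hyperboloid, and the argument of arcosh
   is the Lorentz product of two such points. *)
Lemma hdist_polar (a k l a' k' l' : R) (h : k ^+ 2 + l ^+ 2 = 1) (h' : k' ^+ 2 + l' ^+ 2 = 1) :
  hdist (polar a h) (polar a' h') =
  arcosh (cosh a * cosh a' - (k * k' + l * l') * (sinh a * sinh a')).
Proof.
rewrite /hdist /=; congr arcosh.
have p := polar_pos a h; have p' := polar_pos a' h'.
have cs := cosh_sqr a; have cs' := cosh_sqr a'.
move: (cosh a) (sinh a) (cosh a') (sinh a') p p' cs cs' => c s c' s' p p' cs cs'.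
have n : c - k * s != 0 by exact: lt0r_neq0.
have n' : c' - k' * s' != 0 by exact: lt0r_neq0.
have -> : 1 + ((l * s / (c - k * s) - l' * s' / (c' - k' * s')) ^+ 2 +
   ((c - k * s)^-1 - (c' - k' * s')^-1) ^+ 2) /
   (2 * (c - k * s)^-1 * (c' - k' * s')^-1) =
  1 + ((l * s * (c' - k' * s') - l' * s' * (c - k * s)) ^+ 2 + ((c' - k' * s') - (c - k * s)) ^+ 2)
     / (2 * (c - k * s) * (c' - k' * s')) by field; rewrite n n'.
apply: (mulIf (_ : 2 * (c - k * s) * (c' - k' * s') != 0)); first by rewrite !mulf_neq0.
rewrite mulrDl mul1r mulfVK; last by rewrite !mulf_neq0.
have e1 : (l * s) ^+ 2 = c ^+ 2 - 1 - (k * s) ^+ 2 by rewrite !exprMn -[l ^+ 2](addKr (k ^+ 2)) h cs; ring.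
have e2 : (l' * s') ^+ 2 = c' ^+ 2 - 1 - (k' * s') ^+ 2 by rewrite !exprMn -[l' ^+ 2](addKr (k' ^+ 2)) h' cs'; ring.
transitivity (2 * (c - k * s) * (c' - k' * s') + ((l * s) ^+ 2 * (c' - k' * s') ^+ 2
  - 2 * (l * s) * (l' * s') * (c - k * s) * (c' - k' * s') + (l' * s') ^+ 2 * (c - k * s) ^+ 2
  + (c' - k' * s' - (c - k * s)) ^+ 2)); first by ring.
by rewrite e1 e2; ring.
Qed.

End Hyperboloid.

Section Comparison.
Variables (R : realType) (X : metricType R).
Implicit Types o y w : X.
Hypothesis CAT : CATm1 X.

(** The comparison triangle is placed with o at the centre of polar
   coordinates; k is the cosine of its angle at o. *)
Lemma cat_comparison o y w (c c' : R -> X) (s t k : R) :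
  geodesic o y c -> geodesic o w c' -> 0 < mdist o y -> 0 < mdist o w ->
  0 <= s <= mdist o y -> 0 <= t <= mdist o w ->
  cosh (mdist y w) = cosh (mdist o y) * cosh (mdist o w) - k * (sinh (mdist o y) * sinh (mdist o w)) ->
  cosh (mdist (c s) (c' t)) <= cosh s * cosh t - k * (sinh s * sinh t) /\ -1 <= k <= 1.
Proof.
move=> gc gc'; set a := mdist o y; set b := mdist o w; set l := mdist y w.
move=> a0 b0 /andP[s0 sa] /andP[t0 tb] lE.
have sab : 0 < sinh a * sinh b by rewrite mulr_gt0 // sinh_gt0.
have l0 : 0 <= l by exact: mdist_ge0.
have k1 : -1 <= k <= 1.
  apply/andP; split.
    have : cosh l <= cosh (a + b).
      by apply: cosh_le => //; rewrite /l /a (metric_sym o y) metric_triangle.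
    rewrite coshD lE -subr_ge0.
    by rewrite (_ : _ - _ = (k + 1) * (sinh a * sinh b)) ?pmulr_lge0 //; [lra | ring].
  have : cosh (a - b) <= cosh l.
    rewrite -cosh_norm; apply: cosh_le => //; rewrite ler_norml.
    have h1 := metric_triangle o y w; have h2 := metric_triangle o w y.
    by rewrite (metric_sym w y) in h2; rewrite /a /b /l; apply/andP; split; lra.
  rewrite coshB lE -subr_ge0.
  by rewrite (_ : _ - _ = (1 - k) * (sinh a * sinh b)) ?pmulr_lge0 //; [lra | ring].
split=> //; case/andP: k1 => k1 k2.
pose m := Num.sqrt (1 - k ^+ 2).
have km : k ^+ 2 + m ^+ 2 = 1 by rewrite sqr_sqrtr; [ring | nra].
have h10 : (1 : R) ^+ 2 + 0 ^+ 2 = 1 by ring.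
set Z := cosh s * cosh t - _.
have Z1 : 1 <= Z.
  apply: le_trans (cosh_ge1 (s - t)) _; rewrite coshB /Z lerD2l lerN2.
  by rewrite ler_piMl // mulr_ge0 // sinh_ge0.
have [ac0 acE] := cosh_arcosh Z1.
rewrite -acE; apply: cosh_le; first exact: mdist_ge0.
have dE (p q : R) : 0 <= q - p -> arcosh (cosh p * cosh q - sinh p * sinh q) = q - p.
  by move=> pq; rewrite mulrC [sinh p * _]mulrC -coshB arcosh_cosh.
have := CAT.2 o y w c c' (polar 0 h10) (polar a h10) (polar b km) gc gc' _ _ _ s t
  (polar s h10) (polar t km).
rewrite !hdist_polar cosh0 sinh0 !(mul0r, mulr0, subr0, mul1r, mulr1, addr0) -/a -/b -/l -/Z.
have kmE : k * k + m * m = 1 by rewrite -!expr2.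
rewrite !kmE !mul1r.
apply; rewrite ?arcosh_cosh ?(ltW a0) ?(ltW b0) ?s0 ?t0 //.
- by rewrite -lE arcosh_cosh.
- by rewrite dE // subr_ge0.
- by rewrite dE // subr_ge0.
Qed.

(** The law of cosines expresses the comparison angle at o through the Gromov
   product tau, giving 1 - k <= 2 exp(-2 tau); at time t the sides are then at
   distance about exp(t - tau). *)
Lemma geodesic_contraction o y w (c c' : R -> X) (t : R) :
  geodesic o y c -> geodesic o w c' -> 0 <= t -> t <= mdist o y -> t <= mdist o w ->
  mdist (c t) (c' t) <= 2 * expR (t - gromov_product o y w).
Proof.
move=> gc gc' t0 ta tb; set a := mdist o y in ta *; set b := mdist o w in tb *.
move: t0; rewrite le_eqVlt => /predU1P[<-|t0].
  case: gc => -> _ _; case: gc' => -> _ _; rewrite mdistxx.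
  by rewrite mulr_ge0 // expR_ge0.
have a0 : 0 < mdist o y by exact: lt_le_trans ta.
have b0 : 0 < mdist o w by exact: lt_le_trans tb.
set tau := gromov_product _ _ _.
have sa := sinh_gt0 a0; have sb := sinh_gt0 b0.
pose k := (cosh a * cosh b - cosh (mdist y w)) / (sinh a * sinh b).
have nab : sinh a * sinh b != 0 by rewrite mulf_neq0 // lt0r_neq0.
have [|||cd /andP[k1 k2]] := @cat_comparison o y w c c' t t k gc gc' a0 b0.
- by rewrite (ltW t0).
- by rewrite (ltW t0).
- by rewrite -/a -/b /k mulfVK //; ring.
have tau_a : tau <= a.
  by rewrite /tau /gromov_product -/a -/b; have := metric_triangle o y w; rewrite -/a -/b; lra.
have tau_b : tau <= b.
  by rewrite /tau /gromov_product -/a -/b; have := metric_triangle o w y; rewrite -/a -/b (metric_sym w y); lra.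
have tau0 : 0 <= tau.
  rewrite /tau /gromov_product -/a -/b; have := metric_triangle y o w.
  by rewrite (metric_sym y o) -/a -/b; lra.
have shrink p : tau <= p -> sinh (p - tau) <= expR (- tau) * sinh p.
  move=> _; rewrite /sinh mulrA mulrBr -!expRD.
  have -> : - tau + p = p - tau by lra.
  have : expR (- tau - p) <= expR (- (p - tau)) by rewrite ler_expR; lra.
  by lra.
have kE : (1 - k) * (sinh a * sinh b) = 2 * sinh (a - tau) * sinh (b - tau).
  rewrite -cosh_diff mulrBl mul1r /k mulfVK //.
  have -> : a - tau + (b - tau) = mdist y w by rewrite /tau /gromov_product -/a -/b; field.
  have -> : a - tau - (b - tau) = a - b by ring.
  by rewrite coshB; ring.
have kle : 1 - k <= 2 * expR (- tau) ^+ 2.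
  rewrite -(ler_pM2r (mulr_gt0 sa sb)) kE.
  have -> : 2 * expR (- tau) ^+ 2 * (sinh a * sinh b) = 2 * (expR (- tau) * sinh a) * (expR (- tau) * sinh b) by ring.
  have s1 : 0 <= sinh (a - tau) by apply: sinh_ge0; lra.
  have s2 : 0 <= sinh (b - tau) by apply: sinh_ge0; lra.
  apply: ler_pM => //; [by apply: mulr_ge0 | by rewrite ler_pM2l // shrink | exact: shrink].
have st : sinh t <= expR t / 2.
  by rewrite /sinh ler_pM2r // gerBl expR_ge0.
have st0 : 0 <= sinh t by rewrite sinh_ge0 // ltW.
have d0 : 0 <= mdist (c t) (c' t) by exact: mdist_ge0.
have e0 : 0 <= 2 * expR (t - tau) by rewrite mulr_ge0 // expR_ge0.
rewrite -(@ler_pXn2r _ 2) ?nnegrE //.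
have sq : (sinh t * expR (- tau)) ^+ 2 <= (expR (t - tau) / 2) ^+ 2.
  rewrite ler_pXn2r ?nnegrE //.
  - have -> : expR (t - tau) / 2 = expR t / 2 * expR (- tau) by rewrite expRD; ring.
    by rewrite ler_wpM2r ?expR_ge0.
  - by apply: mulr_ge0; rewrite ?expR_ge0.
have := sinh_ge_half (divr_ge0 d0 (ler0n R 2)).
have := sinh_ge0 (divr_ge0 d0 (ler0n R 2)).
move: cd; rewrite (cosh_half (mdist _ _)) -!expr2 cosh_sqr.
have : (1 - k) * sinh t ^+ 2 <= 2 * (sinh t * expR (- tau)) ^+ 2.
  have -> : 2 * (sinh t * expR (- tau)) ^+ 2 = 2 * expR (- tau) ^+ 2 * sinh t ^+ 2 by ring.
  by rewrite ler_wpM2r ?sqr_ge0.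
set D := mdist _ _ in d0 *; set e := expR (t - tau) in e0 sq *.
set sh := sinh (D / 2); set sq' := sinh t * expR (- tau) in sq *.
move=> h1 h2 h3 h4.
have h5 : (D / 2 / 2) ^+ 2 <= sh ^+ 2 by rewrite ler_pXn2r ?nnegrE // !divr_ge0.
move: h1 h2 h5 sq; rewrite -/e.
nra.
Qed.

(** Convexity of the distance, in the isosceles case used to construct
   axes. *)
Lemma midpoint_contraction o y w (c c' : R -> X) (T : R) :
  geodesic o y c -> geodesic o w c' -> mdist o y = T -> mdist o w = T -> 0 < T ->
  mdist (c (T / 2)) (c' (T / 2)) <= mdist y w / 2.
Proof.
move=> gc gc' a b T0; set l := mdist y w.
have l0 : 0 <= l by exact: mdist_ge0.
have sT := sinh_gt0 T0.
pose k := (cosh T * cosh T - cosh l) / (sinh T * sinh T).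
have nab : sinh T * sinh T != 0 by rewrite mulf_neq0 // lt0r_neq0.
have [|||||cd /andP[k1 k2]] := @cat_comparison o y w c c' (T / 2) (T / 2) k gc gc'.
- by rewrite a.
- by rewrite b.
- by rewrite a; apply/andP; split; lra.
- by rewrite b; apply/andP; split; lra.
- by rewrite a b -/l /k mulfVK //; ring.
apply: cosh_le_inv; first by rewrite divr_ge0.
apply: le_trans cd _.
have lT : l <= 2 * T.
  by have := metric_triangle y o w; rewrite (metric_sym y o) a b -/l; lra.
have kE : (1 - k) * sinh T ^+ 2 = cosh l - 1.
  by rewrite mulrBl mul1r /k expr2 mulfVK //; have := cosh_sqr T; rewrite !expr2; lra.
have sT2 : sinh T = 2 * (sinh (T / 2) * cosh (T / 2)).
  have {1}-> : T = T / 2 + T / 2 by field.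
  by rewrite sinhD; ring.
have cl : cosh l - 1 = 8 * sinh (l / 4) ^+ 2 * cosh (l / 4) ^+ 2.
  have uv : cosh (l / 4) ^+ 2 - sinh (l / 4) ^+ 2 = 1 by rewrite cosh_sqr addrK.
  have {1}-> : l = (l / 4 + l / 4) + (l / 4 + l / 4) by field.
  rewrite coshD coshD sinhD.
  move: (cosh _) (sinh _) uv => u v uv.
  transitivity ((u ^+ 2 - v ^+ 2) ^+ 2 - 1 + 8 * v ^+ 2 * u ^+ 2); first by ring.
  by rewrite uv; ring.
have cl2 : cosh (l / 2) = 1 + 2 * sinh (l / 4) ^+ 2.
  by rewrite cosh_half; congr (1 + 2 * sinh _ ^+ 2); field.
have cc : cosh (l / 4) <= cosh (T / 2) by apply: cosh_le; lra.
have c1 := cosh_ge1 (l / 4); have c1' := cosh_ge1 (T / 2).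
rewrite -!expr2 cosh_sqr cl2; rewrite sT2 in kE; rewrite cl in kE.
have ccsq : cosh (l / 4) ^+ 2 <= cosh (T / 2) ^+ 2.
  by rewrite ler_pXn2r ?nnegrE //; lra.
have cp : 0 < cosh (T / 2) ^+ 2 by rewrite exprn_gt0 //; lra.
have : ((1 - k) * sinh (T / 2) ^+ 2) * cosh (T / 2) ^+ 2 <= (2 * sinh (l / 4) ^+ 2) * cosh (T / 2) ^+ 2.
  have s0 := sqr_ge0 (sinh (l / 4)).
  by move: (cosh (T / 2)) (sinh (T / 2)) (sinh (l / 4)) (cosh (l / 4)) ccsq kE s0 => u v p q; nra.
rewrite ler_pM2r //; lra.
Qed.

End Comparison.

(** * Axes of hyperbolic isometries *)

Section Axes.
Variables (R : realType) (X : metricType R).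
Hypothesis CAT : CATm1 X.
Implicit Types (g h : isom X) (x y z : X).

Lemma translation_length_le g y : translation_length g <= mdist y (g y).
Proof.
by apply: ge_inf; [exists 0 => _ [z _ <-]; exact: mdist_ge0 | exists y].
Qed.

Lemma geodesic_rev (a b : X) c : geodesic a b c -> geodesic b a (fun t => c (mdist a b - t)).
Proof.
case=> c0 c1 cd; split; rewrite ?subr0 //.
  by rewrite metric_sym subrr.
move=> s t; rewrite (metric_sym b a) => /andP[s0 sb] /andP[t0 tb].
by rewrite cd ?subr_ge0 ?sb ?tb ?gerBl ?s0 ?t0 // distrC; congr `|_|; ring.
Qed.

Lemma geodesic_isom (a b : X) c g : geodesic a b c -> geodesic (g a) (g b) (g \o c).
Proof.
by case=> c0 c1 cd; split; rewrite /= ?c0 ?isom_dist ?c1 // => s t sb tb; rewrite isom_dist cd.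
Qed.

(** Let m be the midpoint of [y, hy].  In the isosceles triangle y, hy, h^2 y
   the midpoints m and hm of the equal sides satisfy
   2 d(m, hm) <= d(y, h^2 y). *)
Lemma displacement_double h (T : R) z : 0 < T -> (forall y, T <= mdist y (h y)) -> mdist z (h z) = T ->
  (forall y, 2 * T <= mdist y ((h * h)%g y)) /\ mdist z ((h * h)%g z) = 2 * T.
Proof.
move=> T0 min zT.
have dbl y : 2 * T <= mdist y ((h * h)%g y).
  have D0 : 0 < mdist y (h y) by exact: lt_le_trans (min y).
  have [c gc] := CAT.1 y (h y).
  have gr := geodesic_rev gc; have gh := geodesic_isom h gc.
  have := midpoint_contraction CAT gr gh (metric_sym _ _) (isom_dist _ _ _) D0.
  rewrite (_ : mdist y (h y) - mdist y (h y) / 2 = mdist y (h y) / 2); last by field.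
  by move=> le; have := le_trans (min _) le; rewrite /=; lra.
split=> //; apply/eqP; rewrite eq_le dbl andbT.
by have := metric_triangle z (h z) (h (h z)); rewrite isom_dist zT /=; lra.
Qed.

Variables (g : isom X) (z : X).
Let T := translation_length g.
Hypothesis T0 : 0 < T.
Hypothesis zT : mdist z (g z) = T.

(** Doubling gives the powers of 2, and the triangle inequality the numbers
   in between. *)
Lemma dist_pow_min n : mdist z ((g ^+ n)%g z) = n%:R * T.
Proof.
have dbl k : (forall y, 2 ^+ k * T <= mdist y ((g ^+ (2 ^ k))%g y)) /\
    mdist z ((g ^+ (2 ^ k))%g z) = 2 ^+ k * T.
  elim: k => [|k [IH1 IH2]]; first by rewrite expn0 expg1 expr0 mul1r; split=> // y; exact: translation_length_le.
  have := displacement_double (mulr_gt0 (exprn_gt0 k (ltr0n R 2)) T0) IH1 IH2.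
  by rewrite expnS mul2n -addnn expgnDr exprS mulrA.
have up m : mdist z ((g ^+ m)%g z) <= m%:R * T.
  elim: m => [|m IH]; first by rewrite mul0r /= mdistxx.
  rewrite expgS; apply: le_trans (metric_triangle _ (g z) _) _.
  by rewrite /= isom_dist zT -natr1; lra.
apply/eqP; rewrite eq_le up /=.
have [k nk] : exists k, (n <= 2 ^ k)%N by exists n; rewrite ltnW // ltn_expl.
have [_ d2] := dbl k.
have e : (g ^+ (2 ^ k))%g z = (g ^+ n)%g ((g ^+ (2 ^ k - n))%g z).
  by rewrite -{1}(subnKC nk) expgnDr.
have := metric_triangle z ((g ^+ n)%g z) ((g ^+ (2 ^ k))%g z).
rewrite d2 e isom_dist.
have := up (2 ^ k - n)%N; rewrite natrB // natrX; lra.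
Qed.

Lemma dist_zpow (m n : int) : m <= n ->
  mdist (zpow g m z) (zpow g n z) = (n - m)%:~R * T.
Proof.
move=> mn; have [k kE] : exists k : nat, n = m + k%:Z.
  by exists `|n - m|%N; lia.
by rewrite kE zpowD /= isom_dist dist_pow_min addrAC subrr add0r.
Qed.

(** The translates of a segment from z to gz by the powers of g fit together
   into a geodesic line. *)
Lemma axis_exists : exists c : R -> X, [/\ forall s t, mdist (c s) (c t) = `|s - t|,
     forall t, g (c t) = c (t + T) & c 0 = z].
Proof.
have [c0 [c00 c01 cd]] := CAT.1 z (g z); rewrite zT in c01 cd.
pose f (t : R) : int := Num.floor (t / T).
have fP t : (f t)%:~R * T <= t < ((f t)%:~R + 1) * T.
  have /andP[] := floor_itv (t / T).
  by rewrite intrD -ler_pdivlMr // -ltr_pdivrMr // => -> ->.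
pose c t := zpow g (f t) (c0 (t - (f t)%:~R * T)).
have rem t : 0 <= t - (f t)%:~R * T <= T by case/andP: (fP t) => h1 h2; apply/andP; split; lra.
have left t : mdist (zpow g (f t) z) (c t) = t - (f t)%:~R * T.
  rewrite isom_dist -c00 cd ?rem ?lexx ?(ltW T0) // sub0r normrN ger0_norm //.
  by case/andP: (rem t).
have right t : mdist (c t) (zpow g (f t + 1) z) = ((f t)%:~R + 1) * T - t.
  rewrite zpowS /= isom_dist -c01 cd ?rem ?lexx ?(ltW T0) // distrC ger0_norm; first by ring.
  by case/andP: (rem t); lra.
have main s t : s <= t -> mdist (c s) (c t) = t - s.
  move=> st; have fst : f s <= f t by apply: le_floor; rewrite ler_pM2r // invr_gt0.
  apply/eqP; rewrite eq_le; apply/andP; split; last first.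
    have h1 := metric_triangle (zpow g (f s) z) (c s) (zpow g (f t + 1) z).
    have h2 := metric_triangle (c s) (c t) (zpow g (f t + 1) z).
    rewrite dist_zpow ?left ?right in h1 h2; last by lia.
    by rewrite intrB intrD in h1; lra.
  have [e|ne] := eqVneq (f s) (f t).
    rewrite /c e isom_dist cd; [|by rewrite -e rem|by rewrite rem].
    rewrite -e (_ : _ - _ = - (t - s)); last by ring.
    by rewrite normrN ger0_norm // subr_ge0.
  have lt : f s + 1 <= f t by lia.
  have h1 := metric_triangle (c s) (zpow g (f s + 1) z) (c t).
  have h2 := metric_triangle (zpow g (f s + 1) z) (zpow g (f t) z) (c t).
  rewrite (dist_zpow lt) ?left ?right in h1 h2.
  by rewrite intrB intrD in h2; lra.
exists c; split.
- move=> s t; have [st|/ltW ts] := leP s t; last by rewrite metric_sym main // ger0_norm // subr_ge0.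
  by rewrite main // distrC ger0_norm // subr_ge0.
- move=> t; have fE : f (t + T) = f t + 1.
    by rewrite /f mulrDl divff ?lt0r_neq0 // floorDrz ?floor1.
  have zc : zpow g (f t + 1) = (g * zpow g (f t))%g by rewrite addrC zpowD /= expg1.
  rewrite /c fE zc intrD; congr (g (zpow g _ (c0 _))); ring.
- rewrite /c /f mul0r floor0 mul0r subrr c00 //.
Qed.

End Axes.

(** Go from x to a point of an axis, along the axis, and back.  An axis has to
   exist, since the distance to the empty set is zero by convention. *)
Lemma disp_le_axis_weight (R : realType) (X : metricType R) (x : X) (g : isom X) :
  CATm1 X -> hyperbolic g -> disp x g <= axis_weight x g.
Proof.
move=> CAT [T0 [z zT]]; have [c [cd cg c0]] := axis_exists CAT T0 zT.
rewrite /axis_weight; set T := translation_length g in T0 cg *.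
suff : (disp x g - T) / 2 <= set_dist x (Ax g) by lra.
apply: lb_le_inf; first by exists (mdist x z), z => //; exists c; split=> //; exists 0.
move=> _ [y [c' [c'd c'g [t _ <-]]] <-].
have h1 := metric_triangle x (c' t) (g x); have h2 := metric_triangle (c' t) (g (c' t)) (g x).
rewrite isom_dist c'g c'd -/T opprD addrA subrr sub0r normrN (gtr0_norm T0) in h2.
rewrite (metric_sym (c' t) x) in h2; rewrite /disp; lra.
Qed.

(** * Gromov products *)

Section GromovProduct.
Variables (R : realType) (X : metricType R).
Implicit Types (o p q r : X).
Local Notation gp := gromov_product.

Lemma gp_sym o p q : gp o p q = gp o q p.
Proof. by rewrite /gp [mdist p q]metric_sym [mdist o p + _]addrC. Qed.

Lemma gp_ge0 o p q : 0 <= gp o p q.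
Proof.
rewrite /gp divr_ge0 // subr_ge0 (metric_sym o p); exact: metric_triangle.
Qed.

Lemma gp_le_l o p q : gp o p q <= mdist o p.
Proof. by have := metric_triangle o p q; rewrite /gp; lra. Qed.

Lemma gp_le_r o p q : gp o p q <= mdist o q.
Proof. by rewrite gp_sym gp_le_l. Qed.

Lemma gp_diag o p : gp o p p = mdist o p.
Proof. by rewrite /gp mdistxx; lra. Qed.

Lemma gp_isom (g : isom X) o p q : gp (g o) (g p) (g q) = gp o p q.
Proof. by rewrite /gp !isom_dist. Qed.

Lemma gp_move_r o p q q' : gp o p q <= gp o p q' + mdist q q'.
Proof.
have h1 := metric_triangle o q' q; have h2 := metric_triangle p q q'.
by rewrite (metric_sym q' q) in h1; rewrite /gp; lra.
Qed.

Lemma gp_move_base o o' p q : gp o p q <= gp o' p q + mdist o o'.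
Proof.
have h1 := metric_triangle o o' p; have h2 := metric_triangle o o' q.
by rewrite /gp; lra.
Qed.

Lemma gp_step o p q : mdist o p - mdist p q <= gp o p q.
Proof. by rewrite lerBlDr; have := gp_move_r o p p q; rewrite gp_diag. Qed.

Hypothesis CAT : CATm1 X.

Lemma gp_close o p q c c' t : geodesic o p c -> geodesic o q c' ->
  0 <= t -> t <= mdist o p -> t <= mdist o q -> t - mdist (c t) (c' t) / 2 <= gp o p q.
Proof.
move=> [c0 c1 cd] [c0' c1' cd'] t0 tp tq.
have h1 : mdist p (c t) = mdist o p - t.
  by rewrite metric_sym -{1}c1 cd ?t0 ?lexx ?mdist_ge0 // distrC ger0_norm // subr_ge0.
have h2 : mdist (c' t) q = mdist o q - t.
  by rewrite -{1}c1' cd' ?t0 ?lexx ?mdist_ge0 // distrC ger0_norm // subr_ge0.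
have := metric_triangle p (c t) q; have := metric_triangle (c t) (c' t) q.
by rewrite h1 h2 /gp; lra.
Qed.

(** At time T, the geodesics to p and q, and those to q and r, are at distance
   at most 2, so those to p and r are at distance at most 4. *)
Lemma gp_hyperbolic o p q r T : T <= gp o p q -> T <= gp o q r -> T - 2 <= gp o p r.
Proof.
move=> pq qr; have [T0|T0] := leP T 0; first by apply: le_trans (gp_ge0 _ _ _); lra.
have [c gc] := CAT.1 o p; have [c' gc'] := CAT.1 o q; have [c'' gc''] := CAT.1 o r.
have Tp := le_trans pq (gp_le_l _ _ _); have Tq := le_trans pq (gp_le_r _ _ _).
have Tr := le_trans qr (gp_le_r _ _ _).
have h1 := geodesic_contraction CAT gc gc' (ltW T0) Tp Tq.
have h2 := geodesic_contraction CAT gc' gc'' (ltW T0) Tq Tr.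
have e1 : expR (T - gp o p q) <= 1 by rewrite expR_le1 subr_le0.
have e2 : expR (T - gp o q r) <= 1 by rewrite expR_le1 subr_le0.
have h3 := metric_triangle (c T) (c' T) (c'' T).
by apply: le_trans (gp_close gc gc'' (ltW T0) Tp Tr); lra.
Qed.

Lemma gp_hyperbolic3 o p q r u T : T <= gp o p q -> T <= gp o q r -> T <= gp o r u -> T - 4 <= gp o p u.
Proof.
move=> h1 h2 h3; have h4 := gp_hyperbolic h1 h2.
have := gp_hyperbolic h4 (_ : T - 2 <= gp o r u); lra.
Qed.

(** A chain of short steps far away from o cannot turn by a large visual angle:
   projecting it to the ball of radius r contracts every step by the factor
   exp(r - |y|), and r is chosen so that the projected chain has bounded
   length. *)
Lemma gp_chain o y (l : seq X) (L s : R) : 0 < s -> s <= 1 ->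
  path (fun a b => mdist a b <= L) y l ->
  expR (- s * gp o y (last y l)) <=
    expR (expR L) * \sum_(z <- y :: l) expR (- s * mdist o z).
Proof.
move=> s0 s1 pl; set Sg := \sum_(z <- y :: l) _.
have Sg0 : 0 < Sg.
  rewrite /Sg big_cons ltr_pwDl ?expR_gt0 // sumr_ge0 // => z _; exact: expR_ge0.
pose r := - ln Sg / s.
have rE : expR (- s * r) = Sg.
  have -> : - s * r = ln Sg by rewrite /r; field; exact: lt0r_neq0.
  by rewrite lnK.
have C1 : 1 <= expR (expR L) by rewrite -expR0 ler_expR expR_ge0.
have [r0|r0] := leP r 0.
  apply: (@le_trans _ _ 1); first by rewrite expR_le1 mulNr oppr_le0 mulr_ge0 ?(ltW s0) // gp_ge0.
  rewrite -[leLHS]mul1r ler_pM // -rE -expR0 ler_expR mulNr oppr_ge0.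
  by rewrite pmulr_rle0.
have ry z : z \in y :: l -> r <= mdist o z.
  move=> zl; have : expR (- s * mdist o z) <= expR (- s * r).
    rewrite rE /Sg (big_rem z) //= lerDl sumr_ge0 // => w _; exact: expR_ge0.
  by rewrite ler_expR !mulNr lerN2 ler_pM2l.
have ex z : {c | geodesic o z c} by apply: cid; exact: CAT.1.
pose c z := projT1 (ex z); have gc z : geodesic o z (c z) := projT2 (ex z).
have step a b : r <= mdist o a -> r <= mdist o b -> mdist a b <= L ->
    mdist (c a r) (c b r) <= 2 * expR L * (expR (s * r) * expR (- s * mdist o a)).
  move=> ra rb ab; apply: le_trans (geodesic_contraction CAT (gc a) (gc b) (ltW r0) ra rb) _.
  rewrite -mulrA ler_pM2l // -!expRD ler_expR.
  have := gp_step o a b; nra.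
have total : forall z m, path (fun a b => mdist a b <= L) z m -> (forall w, w \in z :: m -> r <= mdist o w) ->
    mdist (c z r) (c (last z m) r) <= 2 * expR L * (expR (s * r) * \sum_(w <- z :: m) expR (- s * mdist o w)).
  move=> z m; elim: m z => [|b m IH] z /=.
    by move=> _ _; rewrite mdistxx !mulr_ge0 ?expR_ge0 // sumr_ge0 // => w _; exact: expR_ge0.
  move=> /andP[zb pm] rw; rewrite big_cons.
  have rw' w : w \in b :: m -> r <= mdist o w by move=> wm; apply: rw; rewrite inE wm orbT.
  have h1 := IH b pm rw'.
  have h2 := step z b (rw z (mem_head _ _)) (rw' b (mem_head _ _)) zb.
  have h3 := metric_triangle (c z r) (c b r) (c (last b m) r).
  apply: le_trans h3 _; rewrite mulrDr mulrDr lerD //.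
have h := total y l pl ry.
rewrite -/Sg -rE -expRD mulNr subrr expR0 mulr1 in h.
have gl := gp_close (gc y) (gc (last y l)) (ltW r0) (ry y (mem_head _ _)) (ry _ (mem_last _ _)).
rewrite -rE -expRD ler_expR; have eL := expR_ge0 L; nra.
Qed.

End GromovProduct.

(** * Geodesic rays *)

Section Rays.
Variables (R : realType) (X : metricType R).
Implicit Types (o p q x y : X).
Local Notation gp := gromov_product.
Hypothesis proper : proper_space X.
Hypothesis CAT : CATm1 X.

Lemma nat_above (r : R) : exists n : nat, r <= n%:R.
Proof.
exists (Num.truncn `|r|).+1; apply: le_trans (ler_norm _) _.
by apply: ltW; apply: truncnS_gt.
Qed.

(** Proper spaces are complete. *)
Lemma cauchy_limit (u : nat -> X) :
  (forall e, 0 < e -> exists N : nat, forall n m, (N <= n)%N -> (N <= m)%N -> mdist (u n) (u m) <= e) ->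
  exists l, forall e, 0 < e -> exists N : nat, forall n, (N <= n)%N -> mdist (u n) l <= e.
Proof.
move=> cau; have [N0 HN0] := cau 1 ltr01.
have F : ProperFilter (u @ \oo) by apply: fmap_proper_filter.
have cpt : compact [set y | mdist (u N0) y <= 1] by exact: proper.
have [|l [_ lcl]] := cpt _ F.
  by exists N0 => // n /= Nn; exact: HN0.
exists l => e e0; have e2 : 0 < e / 2 by rewrite divr_gt0.
have [N HN] := cau _ e2; exists N => n Nn.
have [||y [[m /= Nm] yu]] := lcl (u @` [set n | (N <= n)%N]) (ball l (e / 2)).
- by exists N => // k /= Nk; exists k.
- exact: nbhsx_ballx.
rewrite ballEmdist /= => ly; rewrite -yu in ly.
apply: le_trans (metric_triangle _ (u m) _) _.
rewrite [e](_ : _ = e / 2 + e / 2); last by field.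
by rewrite lerD // ?HN // metric_sym ltW.
Qed.

(** A sequence converging at infinity: its Gromov products tend to infinity. *)
Definition gp_cauchy x (y : nat -> X) := forall M : R, exists N : nat,
  forall n m, (N <= n)%N -> (N <= m)%N -> M <= gp x (y n) (y m).

(** By contraction, the geodesics from x to the points y n form a Cauchy
   sequence at every time; the ray is their limit. *)
Lemma ray_of_sequence x (y : nat -> X) : gp_cauchy x y -> exists c : R -> X,
  [/\ geodesic_ray c, c 0 = x,
    forall s, (forall n, geodesic x (y n) (s n)) -> forall t e, 0 <= t -> 0 < e ->
      exists N : nat, forall n, (N <= n)%N -> mdist (s n t) (c t) <= e &
    forall M N, (forall n m, (N <= n)%N -> (N <= m)%N -> M <= gp x (y n) (y m)) ->
      forall n t, (N <= n)%N -> M <= t -> M - 2 <= gp x (y n) (c t)].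
Proof.
move=> cau.
have contr s : (forall n, geodesic x (y n) (s n)) -> forall t e, 0 <= t -> 0 < e ->
    exists N : nat, forall n m, (N <= n)%N -> (N <= m)%N -> mdist (s n t) (s m t) <= e.
  move=> gs t e t0 e0; have [N HN] := cau (Num.max t (t - ln (e / 2))).
  exists N => n m Nn Nm; have := HN n m Nn Nm; rewrite ge_max => /andP[h1 h2].
  have tn : t <= mdist x (y n) by apply: le_trans (gp_le_l _ _ (y m)).
  have tm : t <= mdist x (y m) by apply: le_trans (gp_le_r _ (y n) _).
  apply: le_trans (geodesic_contraction CAT (gs n) (gs m) t0 tn tm) _.
  have e2 : 0 < e / 2 by rewrite divr_gt0.
  have : expR (t - gp x (y n) (y m)) <= expR (ln (e / 2)) by rewrite ler_expR; lra.
  by rewrite lnK // => h; lra.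
have ex n : {c | geodesic x (y n) c} by apply: cid; exact: CAT.1.
pose s n := projT1 (ex n); have gs n : geodesic x (y n) (s n) := projT2 (ex n).
have exl t : {l | 0 <= t -> forall e, 0 < e -> exists N : nat, forall n, (N <= n)%N -> mdist (s n t) l <= e}.
  apply: cid; have [t0|t0] := leP 0 t; last by exists x.
  have [l Hl] := @cauchy_limit (fun n => s n t) (fun e => contr s gs t e t0).
  by exists l.
pose c t := projT1 (exl t).
have cP t : 0 <= t -> forall e, 0 < e -> exists N : nat, forall n, (N <= n)%N -> mdist (s n t) (c t) <= e.
  exact: (projT2 (exl t)).
have far t : exists N : nat, forall n, (N <= n)%N -> t <= mdist x (y n).
  have [N HN] := cau t; exists N => n Nn; rewrite -gp_diag; exact: HN.
have ray : geodesic_ray c.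
  move=> t t' t0 t'0; apply/eqP; rewrite -subr_eq0 -normr_le0; apply/ler_addgt0Pr => e e0.
  rewrite add0r; have e2 : 0 < e / 2 by rewrite divr_gt0.
  have [N1 H1] := cP t t0 _ e2; have [N2 H2] := cP t' t'0 _ e2; have [N3 H3] := far (Num.max t t').
  pose n := maxn N1 (maxn N2 N3).
  have n1 : (N1 <= n)%N by rewrite leq_maxl.
  have n2 : (N2 <= n)%N by rewrite /n; lia.
  have n3 : (N3 <= n)%N by rewrite /n; lia.
  have := H3 n n3; rewrite ge_max => /andP[tn t'n].
  have [_ _ gd] := gs n; have E := gd t t' (introT andP (conj t0 tn)) (introT andP (conj t'0 t'n)).
  have a1 := metric_triangle (s n t) (c t) (c t'); have a2 := metric_triangle (s n t) (c t') (s n t').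
  have a3 := metric_triangle (c t) (s n t) (c t'); have a4 := metric_triangle (s n t) (s n t') (c t').
  have b1 := H1 n n1; have b2 := H2 n n2.
  rewrite (metric_sym (c t') (s n t')) in a2; rewrite (metric_sym (c t) (s n t)) in a3.
  by rewrite E in a2 a4; rewrite ler_norml; apply/andP; split; lra.
have c0 : c 0 = x.
  apply/esym/mdist_positivity/eqP; rewrite eq_le mdist_ge0 andbT; apply/ler_addgt0Pr => e e0.
  have [N HN] := cP 0 (lexx _) e e0; rewrite add0r.
  by have := HN N (leqnn _); have [-> _ _] := gs N.
have conv s' : (forall n, geodesic x (y n) (s' n)) -> forall t e, 0 <= t -> 0 < e ->
      exists N : nat, forall n, (N <= n)%N -> mdist (s' n t) (c t) <= e.
  move=> gs' t e t0 e0; have e2 : 0 < e / 2 by rewrite divr_gt0.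
  have [N1 H1] := cP t t0 _ e2.
  have [N2 H2] := cau (Num.max t (t - ln (e / 2 / 2))).
  exists (maxn N1 N2) => n; rewrite geq_max => /andP[n1 n2].
  have := H2 n n n2 n2; rewrite ge_max gp_diag => /andP[h1 h2].
  have h3 := geodesic_contraction CAT (gs' n) (gs n) t0 h1 h1; rewrite gp_diag in h3.
  have e4 : 0 < e / 2 / 2 by rewrite !divr_gt0.
  have : expR (t - mdist x (y n)) <= expR (ln (e / 2 / 2)) by rewrite ler_expR; lra.
  rewrite lnK // => h4; have := H1 n n1; have := metric_triangle (s' n t) (s n t) (c t); lra.
exists c; split=> // M N HN n t Nn Mt.
have [M0|M0] := leP M 0; first by apply: le_trans (gp_ge0 _ _ _); lra.
have t0 : 0 <= t by lra.
have close : mdist (s n M) (c M) <= 2.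
  apply/ler_addgt0Pr => e e0; have [N1 H1] := cP M (ltW M0) e e0.
  pose m := maxn N N1; have m1 : (N <= m)%N by rewrite leq_maxl.
  have m2 : (N1 <= m)%N by rewrite leq_maxr.
  have Mn : M <= mdist x (y n) by rewrite -gp_diag; exact: HN.
  have Mm : M <= mdist x (y m) by rewrite -gp_diag; exact: HN.
  have := geodesic_contraction CAT (gs n) (gs m) (ltW M0) Mn Mm.
  have : expR (M - gp x (y n) (y m)) <= 1 by rewrite expR_le1 subr_le0; exact: HN.
  by have := H1 m m2; have := metric_triangle (s n M) (s m M) (c M); lra.
have Mn : M <= mdist x (y n) by rewrite -gp_diag; exact: HN.
have [sn0 sn1 snd] := gs n.
have d1 : mdist (y n) (s n M) = mdist x (y n) - M.
  by rewrite metric_sym -{1}sn1 snd ?(ltW M0) ?Mn ?lexx ?mdist_ge0 // distrC ger0_norm // subr_ge0.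
have d2 : mdist (c M) (c t) = t - M by rewrite ray ?(ltW M0) // distrC ger0_norm // subr_ge0.
have d3 : mdist x (c t) = t by rewrite -c0 ray // sub0r normrN ger0_norm.
have a1 := metric_triangle (y n) (s n M) (c t); have a2 := metric_triangle (s n M) (c M) (c t).
by rewrite /gp d3; lra.
Qed.

Lemma gp_ray x c s t : geodesic_ray c -> c 0 = x -> 0 <= s -> 0 <= t -> gp x (c s) (c t) = Num.min s t.
Proof.
move=> rc <- s0 t0; rewrite /gp !rc // !sub0r !normrN (ger0_norm s0) (ger0_norm t0).
by case: (lerP s t) => st; lra.
Qed.

Lemma gp_ray_cauchy x c : geodesic_ray c -> gp_cauchy x (fun n => c n%:R).
Proof.
move=> rc M; have [N MN] := nat_above (M + mdist (c 0) x); exists N => n m Nn Nm.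
have h := gp_move_base (c 0) x (c n%:R) (c m%:R).
rewrite (@gp_ray (c 0) c) // in h.
have : M + mdist (c 0) x <= Num.min n%:R m%:R.
  by rewrite le_min !(le_trans MN) // ler_nat.
lra.
Qed.

(** A ray is asymptotic, up to a shift of the parameter and an error tending
   to zero, to a ray issuing from x. *)
Lemma ray_from x c : geodesic_ray c -> exists c0 a, [/\ geodesic_ray c0, c0 0 = x &
  forall s, mdist (c 0) x <= s -> 0 <= s + a /\
    mdist (c s) (c0 (s + a)) <= 2 * expR (mdist (c 0) x - s)].
Proof.
move=> rc; have cau := gp_ray_cauchy x rc.
have [c0 [rc0 c00 conv _]] := ray_of_sequence cau; exists c0.
set d := mdist (c 0) x.
pose D n := mdist x (c n%:R).
pose A := [set D n - n%:R | n in [set: nat]].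
have Alb n : - d <= D n - n%:R.
  have := metric_triangle (c 0) x (c n%:R).
  by rewrite rc // sub0r normrN ger0_norm // -/d /D; lra.
have hasA : has_inf A.
  by split; [exists (D 0%N - 0%:R), 0%N | exists (- d) => _ [n _ <-]].
exists (inf A); split=> // s ds.
have infd : - d <= inf A by apply: lb_le_inf; [case: hasA | move=> _ [n _ <-]].
split; first by lra.
have d0 : 0 <= d by exact: mdist_ge0.
apply/ler_addgt0Pr => e e0; have e2 : 0 < e / 2 by rewrite divr_gt0.
have [_ [n0 _ <-] Hn0] := inf_adherent e2 hasA.
have ex n : {sg | geodesic x (c n%:R) sg} by apply: cid; exact: CAT.1.
pose sg n := projT1 (ex n); have gs n : geodesic x (c n%:R) (sg n) := projT2 (ex n).
have sa0 : 0 <= s + inf A by lra.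
have [N1 H1] := conv sg gs (s + inf A) _ sa0 e2.
have [N2 H2] := nat_above s.
pose n := maxn n0 (maxn N1 N2).
have n1 : (n0 <= n)%N by rewrite /n; lia.
have n2 : (N1 <= n)%N by rewrite /n; lia.
have n3 : s <= n%:R by apply: le_trans H2 _; rewrite ler_nat /n; lia.
have Dn : D n - n%:R <= D n0 - n0%:R.
  have := metric_triangle x (c n0%:R) (c n%:R); rewrite -/(D n) -/(D n0) rc //.
  by rewrite distrC ger0_norm ?subr_ge0 ?ler_nat //; lra.
have An : inf A <= D n - n%:R by apply: ge_inf; [case: hasA | exists n].
have sn : 0 <= s by lra.
(* Contract towards the apex c n. *)
have gc : geodesic (c 0) (c n%:R) c.
  have E : mdist (c 0) (c n%:R) = n%:R by rewrite rc // sub0r normrN ger0_norm.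
  by split=> //; rewrite E // => u v /andP[u0 _] /andP[v0 _]; exact: rc.
have E : mdist (c 0) (c n%:R) = n%:R by rewrite rc // sub0r normrN ger0_norm.
have := geodesic_contraction CAT (geodesic_rev gc) (geodesic_rev (gs n)) (_ : 0 <= n%:R - s) _ _.
rewrite subr_ge0 E (metric_sym (c n%:R) (c 0)) E (metric_sym (c n%:R) x) -/(D n).
have -> : n%:R - (n%:R - s) = s :> R by ring.
move=> /(_ n3) H; have {H} := H _ _.
have := Alb n => Albn.
move=> /(_ ltac:(lra) ltac:(lra)) H.
have gE : n%:R - d <= gp (c n%:R) (c 0) x.
  by rewrite /gp (metric_sym (c n%:R)) E (metric_sym (c n%:R)) -/(D n) -/d; lra.
have h1 : expR (n%:R - s - gp (c n%:R) (c 0) x) <= expR (d - s) by rewrite ler_expR; lra.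
have h2 : mdist (sg n (D n - (n%:R - s))) (sg n (s + inf A)) <= e / 2.
  have [_ _ ->] := gs n; rewrite -?/(D n); first by rewrite ger0_norm; lra.
    by apply/andP; split; lra.
  by apply/andP; split; lra.
have h3 := H1 n n2.
have t1 := metric_triangle (c s) (sg n (D n - (n%:R - s))) (c0 (s + inf A)).
have t2 := metric_triangle (sg n (D n - (n%:R - s))) (sg n (s + inf A)) (c0 (s + inf A)).
lra.
Qed.

Lemma ray_unique x c c' : geodesic_ray c -> geodesic_ray c' -> c 0 = x -> c' 0 = x ->
  asymptotic c c' -> forall t, 0 <= t -> c t = c' t.
Proof.
move=> rc rc' cx cx' [M HM] t t0.
have M0 : 0 <= M by apply: le_trans (HM 0 (lexx _)); exact: mdist_ge0.
apply/mdist_positivity/eqP; rewrite eq_le mdist_ge0 andbT; apply/ler_addgt0Pr => e e0.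
rewrite add0r; have e2 : 0 < e / 2 by rewrite divr_gt0.
pose T := t + M + `|ln (e / 2)|.
have T0 : 0 <= T by rewrite /T !addr_ge0.
have tT : t <= T by rewrite /T -addrA lerDl addr_ge0.
have seg r (h : geodesic_ray r) : r 0 = x -> geodesic x (r T) r.
  move=> r0; have E : mdist x (r T) = T by rewrite -r0 h // sub0r normrN ger0_norm.
  by split=> //; rewrite E // => u v /andP[u0 _] /andP[v0 _]; exact: h.
have E r (h : geodesic_ray r) : r 0 = x -> mdist x (r T) = T.
  by move=> r0; rewrite -r0 h // sub0r normrN ger0_norm.
have := geodesic_contraction CAT (seg c rc cx) (seg c' rc' cx') t0.
rewrite !E // => /(_ tT tT).
have gE : T - M <= gp x (c T) (c' T) by rewrite /gp !E //; have := HM T T0; lra.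
have : expR (t - gp x (c T) (c' T)) <= expR (ln (e / 2)).
  by rewrite ler_expR; have := ler_norm (- ln (e / 2)); rewrite normrN; rewrite /T in gE; lra.
rewrite lnK //; lra.
Qed.

End Rays.

(** * The boundary and the Bourdon metric *)

Section Boundary.
Variables (R : realType) (X : metricType R).
Implicit Types (o p q x y : X) (xi eta : set (R -> X)).
Local Notation gp := gromov_product.
Hypothesis proper : proper_space X.
Hypothesis CAT : CATm1 X.

Lemma asymptotic_sym (c c' : R -> X) : asymptotic c c' -> asymptotic c' c.
Proof. by case=> M HM; exists M => t t0; rewrite metric_sym HM. Qed.

Lemma asymptotic_trans (c1 c2 c3 : R -> X) : asymptotic c1 c2 -> asymptotic c2 c3 -> asymptotic c1 c3.
Proof.
move=> [M HM] [M' HM']; exists (M + M') => t t0.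
by apply: le_trans (metric_triangle _ (c2 t) _) _; rewrite lerD ?HM ?HM'.
Qed.

Lemma boundary_eq xi eta c c' : boundary xi -> boundary eta -> xi c -> eta c' ->
  asymptotic c c' -> xi = eta.
Proof.
have sub xi' eta' b b' : boundary xi' -> boundary eta' -> xi' b -> eta' b' -> asymptotic b b' -> xi' `<=` eta'.
  move=> [d rd ->] [d' rd' ->] [rb db] [rb' db'] bb' e [re de]; split=> //.
  apply: asymptotic_trans db' _; apply: asymptotic_trans (asymptotic_sym bb') _.
  by apply: asymptotic_trans (asymptotic_sym db) de.
move=> bx be xc ec cc'; apply/seteqP; split; first exact: sub cc'.
exact: sub (asymptotic_sym cc').
Qed.

Lemma boundary_ray x xi : boundary xi -> exists c0, [/\ geodesic_ray c0, c0 0 = x, xi c0 &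
  forall c, xi c -> exists a, forall e, 0 < e -> exists S, forall s, S <= s ->
    0 <= s + a /\ mdist (c s) (c0 (s + a)) <= e].
Proof.
have asy c : geodesic_ray c -> exists c0 a, [/\ geodesic_ray c0, c0 0 = x, asymptotic c c0 &
    forall e, 0 < e -> exists S, forall s, S <= s -> 0 <= s + a /\ mdist (c s) (c0 (s + a)) <= e].
  move=> rc; have [c0 [a [rc0 c00 H]]] := ray_from proper CAT x rc.
  exists c0, a; set d := mdist (c 0) x in H *; have d0 : 0 <= d by exact: mdist_ge0.
  split=> //.
    exists (2 + `|a| + 3 * d) => t t0; have [dt|td] := leP d t.
      have [ta0 h] := H t dt; have : expR (d - t) <= 1 by rewrite expR_le1 subr_le0.
      have := metric_triangle (c t) (c0 (t + a)) (c0 t); rewrite rc0 //.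
      by have -> : t + a - t = a; [ring | lra].
    have h1 := metric_triangle (c t) (c 0) (c0 t); have h2 := metric_triangle (c 0) x (c0 t).
    rewrite rc // subr0 ger0_norm // in h1.
    rewrite -{2}c00 rc0 // sub0r normrN ger0_norm // in h2.
    by have := normr_ge0 a; rewrite -/d in h2; lra.
  move=> e e0; exists (Num.max d (d - ln (e / 2))) => s; rewrite ge_max => /andP[ds es].
  have [sa h] := H s ds; split=> //; apply: le_trans h _.
  have e2 : 0 < e / 2 by rewrite divr_gt0.
  have : expR (d - s) <= expR (ln (e / 2)) by rewrite ler_expR; lra.
  by rewrite lnK //; lra.
case=> c rc xiE; have [c0 [a [rc0 c00 cc0 _]]] := asy c rc.
exists c0; split=> //; first by rewrite xiE.
move=> c'; rewrite xiE => -[rc' cc'].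
have [c0' [a' [rc0' c00' c'c0' H]]] := asy c' rc'; exists a' => e e0.
have [S HS] := H e e0; exists S => s Ss; have [sa h] := HS s Ss; split=> //.
rewrite (ray_unique CAT rc0 rc0' c00 c00' _ sa) //.
exact: asymptotic_trans (asymptotic_sym cc0) (asymptotic_trans cc' c'c0').
Qed.

Lemma expR_lip (u v : R) : 0 <= u -> 0 <= v -> `|expR (- u) - expR (- v)| <= `|u - v|.
Proof.
have main a b : 0 <= a -> a <= b -> `|expR (- a) - expR (- b)| <= `|a - b|.
  move=> a0 ab; rewrite ger0_norm ?subr_ge0 ?ler_expR ?lerN2 // distrC ger0_norm ?subr_ge0 //.
  have -> : expR (- b) = expR (- a) * expR (a - b) by rewrite -expRD; congr expR; ring.
  have := expR_ge1Dx (a - b); have : expR (- a) <= 1 by rewrite expR_le1 oppr_le0.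
  by have := expR_gt0 (- a); move: (expR _) (expR _) => p q; nra.
move=> u0 v0; have [uv|/ltW vu] := leP u v; first exact: main.
by rewrite distrC (distrC u) main.
Qed.

Lemma gp_ray_mono x c s s' q : geodesic_ray c -> c 0 = x -> 0 <= s -> s <= s' ->
  gp x (c s) q <= gp x (c s') q.
Proof.
move=> rc <- s0 ss'; have s'0 := le_trans s0 ss'.
rewrite /gp !rc // !sub0r !normrN (ger0_norm s0) (ger0_norm s'0).
by have := metric_triangle (c s') (c s) q; rewrite rc // ger0_norm ?subr_ge0 //; lra.
Qed.

(** Along rays issuing from x the Gromov product is monotone in both
   arguments, so that the limit exists; any other ray is asymptotic to such a
   ray up to a vanishing error. *)
Lemma bourdon_lim x xi eta : boundary xi -> boundary eta ->
  forall c c', xi c -> eta c' -> forall e, 0 < e -> exists N, forall s t, N <= s -> N <= t ->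
    `|expR (- gp x (c s) (c' t)) - bourdon_metric x xi eta| < e.
Proof.
move=> bx be; rewrite /bourdon_metric.
set P := [set rho | _]; suff [rho Prho] : exists rho, P rho by exact: (xgetPex 0 (ex_intro _ _ Prho)).
have [c0 [rc0 c00 xc0 H]] := boundary_ray x bx.
have [c0' [rc0' c00' ec0' H']] := boundary_ray x be.
pose h s t := gp x (c0 s) (c0' t).
have mono s s' t t' : 0 <= s -> s <= s' -> 0 <= t -> t <= t' -> h s t <= h s' t'.
  move=> s0 ss' t0 tt'; apply: le_trans (gp_ray_mono _ rc0 c00 s0 ss') _.
  by rewrite /h gp_sym [leRHS]gp_sym; exact: gp_ray_mono.
pose A := [set expR (- h n%:R n%:R) | n in [set: nat]].
have hasA : has_inf A.
  by split; [exists (expR (- h 0%:R 0%:R)), 0%N | exists 0 => _ [n _ <-]; exact: expR_ge0].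
exists (inf A) => c c' xc ec' e e0.
have e3 : 0 < e / 3 by rewrite divr_gt0.
have [_ [n _ <-] Hn] := inf_adherent e3 hasA.
have [a Ha] := H c xc; have [a' Ha'] := H' c' ec'.
have [S HS] := Ha _ e3; have [S' HS'] := Ha' _ e3.
exists (Num.max (Num.max S S') (Num.max (n%:R - a) (n%:R - a'))) => s t.
rewrite !ge_max => /andP[/andP[Ss _] /andP[ns _]] /andP[/andP[_ S't] /andP[_ nt]].
have [sa0 ds] := HS s Ss; have [ta0 dt] := HS' t S't.
have n0 : (0 : R) <= n%:R by exact: ler0n.
have h1 : h n%:R n%:R <= h (s + a) (t + a') by apply: mono => //; lra.
have [m Hm] := nat_above (Num.max (s + a) (t + a')).
move: Hm; rewrite ge_max => /andP[ms mt].
have h2 : inf A <= expR (- h (s + a) (t + a')).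
  apply: le_trans (_ : expR (- h m%:R m%:R) <= _); last by rewrite ler_expR lerN2; exact: mono.
  by apply: ge_inf; [case: hasA | exists m].
have h3 : expR (- h (s + a) (t + a')) <= expR (- h n%:R n%:R) by rewrite ler_expR lerN2.
have h4 := expR_lip (gp_ge0 x (c s) (c' t)) (gp_ge0 x (c0 (s + a)) (c0' (t + a'))).
have g1 := gp_move_r x (c s) (c' t) (c0' (t + a')).
have g2 := gp_move_r x (c0' (t + a')) (c s) (c0 (s + a)).
have g3 := gp_move_r x (c s) (c0' (t + a')) (c' t).
have g4 := gp_move_r x (c0' (t + a')) (c0 (s + a)) (c s).
rewrite !(gp_sym x (c0' (t + a'))) in g2 g4.
rewrite (metric_sym (c0' _)) in g3; rewrite (metric_sym (c0 _)) in g4.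
have h5 : `|gp x (c s) (c' t) - gp x (c0 (s + a)) (c0' (t + a'))| <= 2 * (e / 3).
  by rewrite ler_norml; apply/andP; split; lra.
rewrite -/(h _ _) in h4 h5.
move: h4; set u := expR _ in h2 h3 *; set v := expR _ => h4.
have : `|v - u| <= 2 * (e / 3) by exact: le_trans h5.
rewrite ler_norml ltr_norml => /andP[k1 k2]; apply/andP; split; lra.
Qed.

Lemma bourdon_le x xi eta c c' B N : boundary xi -> boundary eta -> xi c -> eta c' ->
  (forall s t, N <= s -> N <= t -> B <= gp x (c s) (c' t)) ->
  bourdon_metric x xi eta <= expR (- B).
Proof.
move=> bx be xc ec' HB; apply/ler_addgt0Pr => e e0.
have [N' HN'] := bourdon_lim x bx be xc ec' e0.
pose s := Num.max N N'.
have s1 : N <= s by rewrite le_max lexx.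
have s2 : N' <= s by rewrite le_max lexx orbT.
have := HN' s s s2 s2; rewrite ltr_norml => /andP[k1 k2].
have : expR (- gp x (c s) (c' s)) <= expR (- B) by rewrite ler_expR lerN2; exact: HB.
lra.
Qed.

Lemma bourdon_ge x xi eta c c' B N : boundary xi -> boundary eta -> xi c -> eta c' ->
  (forall s t, N <= s -> N <= t -> gp x (c s) (c' t) <= B) ->
  expR (- B) <= bourdon_metric x xi eta.
Proof.
move=> bx be xc ec' HB; apply/ler_addgt0Pr => e e0.
have [N' HN'] := bourdon_lim x bx be xc ec' e0.
pose s := Num.max N N'.
have s1 : N <= s by rewrite le_max lexx.
have s2 : N' <= s by rewrite le_max lexx orbT.
have := HN' s s s2 s2; rewrite ltr_norml => /andP[k1 k2].
have : expR (- B) <= expR (- gp x (c s) (c' s)) by rewrite ler_expR lerN2; exact: HB.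
lra.
Qed.

Lemma bourdon_le_seq x xi eta (y y' : nat -> X) B : boundary xi -> boundary eta ->
  converges_to_boundary x y xi -> converges_to_boundary x y' eta ->
  (forall N : nat, exists n m, [/\ (N <= n)%N, (N <= m)%N & B <= gp x (y n) (y' m)]) ->
  bourdon_metric x xi eta <= expR (4 - B).
Proof.
move=> bx be cy cy' HB; have [c [_ _ xc _]] := boundary_ray x bx.
have [c' [_ _ ec' _]] := boundary_ray x be.
have [N HN] := cy c xc B; have [N' HN'] := cy' c' ec' B.
have [n [m [n1 m1 Bnm]]] := HB (maxn N N').
rewrite -opprB; apply: (@bourdon_le x xi eta c c' _ (maxn N N')%:R) => // s t s1 t1.
have h1 : B <= gp x (y n) (c s).
  apply: HN; first by apply: leq_trans n1; rewrite leq_maxl.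
  by apply: le_trans s1; rewrite ler_nat leq_maxl.
have h2 : B <= gp x (y' m) (c' t).
  apply: HN'; first by apply: leq_trans m1; rewrite leq_maxr.
  by apply: le_trans t1; rewrite ler_nat leq_maxr.
rewrite gp_sym in h1; exact (gp_hyperbolic3 CAT h1 Bnm h2).
Qed.

Lemma bourdon_ge_seq x xi eta (y y' : nat -> X) B (N0 : nat) : boundary xi -> boundary eta ->
  converges_to_boundary x y xi -> converges_to_boundary x y' eta ->
  (forall n m, (N0 <= n)%N -> (N0 <= m)%N -> gp x (y n) (y' m) <= B) ->
  expR (- (B + 4)) <= bourdon_metric x xi eta.
Proof.
move=> bx be cy cy' HB; have [c [_ _ xc _]] := boundary_ray x bx.
have [c' [_ _ ec' _]] := boundary_ray x be.
have [N HN] := cy c xc (B + 5); have [N' HN'] := cy' c' ec' (B + 5).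
apply: (@bourdon_ge x xi eta c c' _ (maxn N N')%:R) => // s t s1 t1.
pose n := maxn N0 (maxn N N').
have h1 : B + 5 <= gp x (y n) (c s).
  apply: HN; first by rewrite /n; lia.
  by apply: le_trans s1; rewrite ler_nat leq_maxl.
have h2 : B + 5 <= gp x (c' t) (y' n).
  rewrite gp_sym; apply: HN'; first by rewrite /n; lia.
  by apply: le_trans t1; rewrite ler_nat leq_maxr.
rewrite leNgt; apply/negP => lt.
have n0 : (N0 <= n)%N by rewrite leq_maxl.
pose T := Num.min (B + 5) (gp x (c s) (c' t)).
have T1 : B + 4 < T by rewrite lt_min lt andbT; lra.
have T2 : T <= B + 5 by rewrite ge_min lexx.
have T3 : T <= gp x (c s) (c' t) by rewrite ge_min lexx orbT.
have := gp_hyperbolic3 CAT (le_trans T2 h1) T3 (le_trans T2 h2).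
by have := HB n n n0 n0; lra.
Qed.

Lemma boundary_eq_seq x xi eta (y y' : nat -> X) : boundary xi -> boundary eta ->
  converges_to_boundary x y xi -> converges_to_boundary x y' eta ->
  (forall M (N : nat), exists n m, [/\ (N <= n)%N, (N <= m)%N & M <= gp x (y n) (y' m)]) ->
  xi = eta.
Proof.
move=> bx be cy cy' H; have [c [rc cx xc _]] := boundary_ray x bx.
have [c' [rc' c'x ec' _]] := boundary_ray x be.
apply: (boundary_eq bx be xc ec'); exists 0 => t t0; apply/ler_addgt0Pr => e e0; rewrite add0r.
have e2 : 0 < e / 2 by rewrite divr_gt0.
pose B := t - ln (e / 2) + 4.
have [N HN] := cy c xc B; have [N' HN'] := cy' c' ec' B.
have [n [m [n1 m1 Bnm]]] := H B (maxn N N').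
pose s := Num.max t (maxn N N')%:R.
have ts : t <= s by rewrite le_max lexx.
have s0 := le_trans t0 ts.
have h1 : B <= gp x (c s) (y n).
  rewrite gp_sym; apply: HN; first by apply: leq_trans n1; rewrite leq_maxl.
  by rewrite le_max ler_nat leq_maxl orbT.
have h2 : B <= gp x (y' m) (c' s).
  apply: HN'; first by apply: leq_trans m1; rewrite leq_maxr.
  by rewrite le_max ler_nat leq_maxr orbT.
have h3 := gp_hyperbolic3 CAT h1 Bnm h2.
have E r (h : geodesic_ray r) : r 0 = x -> mdist x (r s) = s.
  by move=> r0; rewrite -r0 h // sub0r normrN ger0_norm.
have seg r (h : geodesic_ray r) : r 0 = x -> geodesic x (r s) r.
  by move=> r0; split; rewrite ?E // => u v /andP[u0 _] /andP[v0 _]; exact: h.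
have := geodesic_contraction CAT (seg c rc cx) (seg c' rc' c'x) t0.
rewrite !E // => /(_ ts ts).
have : expR (t - gp x (c s) (c' s)) <= expR (ln (e / 2)) by rewrite ler_expR /B in h3 *; lra.
by rewrite lnK //; lra.
Qed.

Lemma boundary_of_cauchy x (y : nat -> X) : gp_cauchy x y ->
  exists2 xi, boundary xi & converges_to_boundary x y xi.
Proof.
move=> cau; have [c [rc cx _ H]] := ray_of_sequence proper CAT cau.
exists [set c' | geodesic_ray c' /\ asymptotic c c']; first by exists c.
move=> c' [rc' [D HD]] M.
have [N HN] := cau (M + 2 + D); have [N' HN'] := nat_above (M + 2 + D).
exists (maxn N N') => n t n1 t1.
have t2 : M + 2 + D <= t.
  by apply: le_trans HN' _; apply: le_trans t1; rewrite ler_nat leq_maxr.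
have t0 : 0 <= t by apply: le_trans t1; exact: ler0n.
have n2 : (N <= n)%N by apply: leq_trans n1; rewrite leq_maxl.
have h1 := H _ N HN n t n2 t2; have h2 := gp_move_r x (y n) (c t) (c' t); have := HD t t0; lra.
Qed.

End Boundary.

(** * Covers and Hausdorff measure *)

Section Hausdorff.
Variables (R : realType) (B : Type) (rho : B -> B -> R).

Lemma diameter_le (U : set B) (v : R) : 0 <= v -> (forall a b, U a -> U b -> rho a b <= v) ->
  (diameter rho U <= v%:E)%E.
Proof.
move=> v0 H; apply: ge_ereal_sup => _ [->|[a [b [Ua Ub ->]]]]; rewrite lee_fin //.
exact: H.
Qed.

Lemma diameter_ge0 (U : set B) : (0 <= diameter rho U)%E.
Proof. by apply: ereal_sup_ubound; left. Qed.

Lemma diameter_set0 : diameter rho set0 = 0%E.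
Proof. by apply/eqP; rewrite eq_le diameter_ge0 andbT; apply: diameter_le. Qed.

(** Covers may be indexed by any countable set, and their pieces by bounds on
   the s-th powers of the diameters. *)
Lemma hausdorff_measure_eq0 (T : choiceType) (S : set T) (Lam : set B) (s : R) : 0 < s -> countable S ->
  (forall eps eta : R, 0 < eps -> 0 < eta -> exists (U : T -> set B) (w : T -> R),
    [/\ Lam = \bigcup_(t in S) U t,
        forall t, S t -> exists v, [/\ 0 <= v, v <= eps, v `^ s <= w t &
          forall a b, U t a -> U t b -> rho a b <= v] &
        forall l, uniq l -> (forall t, t \in l -> S t) -> \sum_(t <- l) w t <= eta]) ->
  hausdorff_measure rho s Lam = 0%E.
Proof.
move=> s0 /countable_injP[f finj] H.
have ge0 eps : (0 <= hausdorff_content rho s eps Lam)%E.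
  apply: le_ereal_inf_tmp => _ [U [_ _ ->]]; apply: nneseries_ge0 => n _ _; exact: poweR_ge0.
have le0 eps : 0 < eps -> (hausdorff_content rho s eps Lam <= 0)%E.
  move=> eps0; apply/lee_addgt0Pr => eta eta0; rewrite add0e.
  have [U [w [LU Uv wl]]] := H eps eta eps0 eta0.
  pose V n := [set a | exists t, [/\ S t, f t = n & U t a]].
  have VU t : S t -> V (f t) = U t.
    move=> St; apply/seteqP; split=> a; last by exists t.
    by case=> t' [St' /finj -> //]; exact/mem_set.
  have V0 n : ~ (f @` S) n -> V n = set0.
    by move=> nS; apply/seteqP; split=> // a [t [St ft _]]; apply: nS; exists t.
  have dV t : S t -> (diameter rho (V (f t)) `^ s <= (w t)%:E)%E /\ (diameter rho (V (f t)) <= eps%:E)%E.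
    move=> St; have [v [v0 ve vw vd]] := Uv t St; rewrite VU //.
    have dv : (diameter rho (U t) <= v%:E)%E by exact: diameter_le.
    split; last by apply: le_trans dv _; rewrite lee_fin.
    apply: (@le_trans _ _ (v%:E `^ s)%E); last by rewrite poweR_EFin lee_fin.
    apply: gt0_ler_poweR => //; rewrite ?ltW ?in_itv //= ?leey ?andbT ?diameter_ge0 //.
  have le : (\sum_(0 <= n <oo) diameter rho (V n) `^ s <= eta%:E)%E.
    rewrite nneseries_esumT; last by move=> n; exact: poweR_ge0.
    have -> : (\esum_(n in [set: nat]) diameter rho (V n) `^ s =
               \esum_(n in f @` S) diameter rho (V n) `^ s)%E.
      rewrite [RHS]esum_mkcond; apply: eq_esum => n _; case: ifP => //.
      move=> /negP nS; rewrite V0; last by move=> fS; apply: nS; exact/mem_set.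
      by rewrite diameter_set0 poweR_EFin powR0 // gt_eqF.
    rewrite esum_image; last by move=> a b Sa Sb; apply: finj.
    apply: (@le_trans _ _ (\esum_(t in S) (w t)%:E)%E).
      by apply: le_esum => t St; case: (dV t St).
    exact: esum_le_seq.
  apply: le_trans le; apply: ereal_inf_lbound; exists V; split=> //.
    rewrite LU; apply/seteqP; split=> a.
      by case=> t St Ua; exists (f t) => //; exists t.
    by case=> n _ [t [St _ Ua]]; exists t.
  move=> n; have [[t St <-]|nS] := pselect ((f @` S) n); first by case: (dV t St).
  by rewrite V0 // diameter_set0 lee_fin ltW.
rewrite /hausdorff_measure.
have -> : [set hausdorff_content rho s eps Lam | eps in [set eps : R | 0 < eps]] = [set 0%E].
  have c0 eps : 0 < eps -> hausdorff_content rho s eps Lam = 0%E.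
    by move=> eps0; apply/eqP; rewrite eq_le ge0 le0.
  apply/seteqP; split=> [_ [eps eps0 <-]|_ ->]; first exact: c0.
  by exists (1 : R); [exact: ltr01 | apply: c0; exact: ltr01].
exact: ereal_sup1.
Qed.

End Hausdorff.

Section OrbitTail.
Variables (R : realType) (X : metricType R) (x : X) (Gam : set (isom X)) (d : R).
Hypothesis cE : critical_exponent x Gam = d%:E.

Lemma countable_group : countable Gam.
Proof.
have -> : Gam = \bigcup_n [set g | Gam g /\ disp x g <= n%:R].
  apply/seteqP; split=> [g Gg|g [n _ []]//].
  exists (Num.truncn (disp x g)).+1 => //; split=> //.
  by apply: ltW; apply: truncnS_gt.
apply: bigcup_countable; first exact: countableP.
by move=> n _; apply: finite_set_countable; exact: finite_orbit_ball cE _.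
Qed.

Lemma orbit_tail (s eta : R) : (orbit_series x Gam s < +oo)%E -> 0 < eta ->
  exists r : R, forall l, uniq l -> (forall g, g \in l -> Gam g /\ r < disp x g) ->
    \sum_(g <- l) expR (- s * disp x g) <= eta.
Proof.
move=> fin eta0.
have [l0 [u0 G0 le0]] := esum_fin_approx (fun g : isom X => expR_ge0 (- s * disp x g)) eta0 fin.
exists (\sum_(g <- l0) disp x g) => l ul lG.
have dis g : g \in l0 -> g \notin l.
  move=> gl0; apply/negP => /lG[_]; rewrite (big_rem g) //= ltNge lerDl.
  by rewrite sumr_ge0 // => h _; exact: disp_ge0.
have := @seq_le_esum _ _ Gam (fun g => expR (- s * disp x g)) (l ++ l0).
rewrite cat_uniq ul u0 andbT big_cat /= => H.
have : ((\sum_(g <- l) expR (- s * disp x g) + \sum_(g <- l0) expR (- s * disp x g))%:E <= 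
   (\sum_(g <- l0) expR (- s * disp x g) + eta)%:E)%E.
  apply: le_trans le0; apply: H; first by apply/hasPn.
  by move=> g; rewrite mem_cat => /orP[/lG[]|/G0].
by rewrite lee_fin addrC lerD2l.
Qed.

End OrbitTail.

(** * Convex-cobounded actions *)

Section UpperBounds.
Variables (R : realType) (X : metricType R) (x : X) (Gam : set (isom X)) (d : R).
Hypothesis proper : proper_space X.
Hypothesis CAT : CATm1 X.
Hypothesis Gsub : is_subgroup Gam.
Hypothesis cE : critical_exponent x Gam = d%:E.
Local Notation gp := gromov_product.
Local Notation Lam := (limit_set x Gam).
Local Notation rho := (bourdon_metric x).

Lemma hausdorff_dim_le (eta : R) : 0 < eta ->
  (forall s, d <= s -> s < d + eta -> 0 < s -> (orbit_series x Gam s < +oo)%E ->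
     hausdorff_measure rho s Lam = 0%E) ->
  (hausdorff_dim rho Lam <= d%:E)%E.
Proof.
move=> eta0 H; apply/lee_addgt0Pr => e e0.
have m0 : 0 < Num.min e eta by rewrite lt_min e0.
have [s [ds sm s0 sfin]] := critical_exponent_lt cE m0.
apply: (@le_trans _ _ s%:E); last first.
  rewrite -EFinD lee_fin (le_trans (ltW sm)) // lerD2l ge_min lexx //.
apply: ereal_inf_lbound; exists s => //; split=> //; apply: H => //.
by apply: lt_le_trans sm _; rewrite lerD2l ge_min lexx orbT.
Qed.

Lemma limit_set_far xi (g : nat -> isom X) : boundary xi ->
  converges_to_boundary x (fun n => g n x) xi ->
  forall r : R, exists N : nat, forall n, (N <= n)%N -> r < disp x (g n).
Proof.
move=> bx cv r; have [c [_ _ xc _]] := boundary_ray proper CAT x bx.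
have [N HN] := cv c xc (r + 1); exists N => n Nn.
have := HN n n%:R Nn (_ : N%:R <= n%:R); rewrite ler_nat => /(_ Nn) h.
by have := gp_le_l x (g n x) (c n%:R); rewrite -/(disp x (g n)); lra.
Qed.

Section ConvexCobounded.
Hypothesis cc : convex_cobounded x Gam.

(** A ray to a limit point runs along segments between orbit points, and these
   stay close to the orbit. *)
Lemma conical_limit : exists2 r0 : R, 0 <= r0 & forall xi, Lam xi -> forall c, geodesic_ray c -> c 0 = x ->
  xi c -> forall t, 0 <= t -> exists2 g, Gam g & mdist (c t) (g x) <= r0.
Proof.
case: cc => R' HR'; exists (`|R'| + 1); first by rewrite addr_ge0.
move=> xi [bx [g [gG cv]]] c rc cx xc t t0.
have [N HN] := cv c xc (t + 1).
pose n := N; have [m Hm] := nat_above (Num.max t N%:R).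
move: Hm; rewrite ge_max => /andP[tm Nm].
have h := HN n m%:R (leqnn _) Nm.
have [sg gs] := CAT.1 x (g n x).
have tn : t <= mdist x (g n x) by have := gp_le_l x (g n x) (c m%:R); lra.
have dm : mdist x (c m%:R) = m%:R by rewrite -cx rc // sub0r normrN ger0_norm.
have gc : geodesic x (c m%:R) c.
  by split; rewrite ?dm // => u v /andP[u0 _] /andP[v0 _]; exact: rc.
have := geodesic_contraction CAT gs gc t0 tn; rewrite dm => /(_ tm) h2.
have e1 : expR (t - gp x (g n x) (c m%:R)) <= 2^-1.
  apply: (@le_trans _ _ (expR (- 1))); first by rewrite ler_expR; lra.
  by rewrite expRN lef_pV2 ?posrE ?expR_gt0 //; have := expR_ge1Dx (1 : R).
have G1 : Gam 1%g by case: Gsub.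
have [k Gk [z zR kz]] : (\bigcup_(k in Gam) (k @` [set z | mdist x z < R'])) (sg t).
  apply: (HR' 1%g (g n)) => //; exists sg, t; split=> //.
  by rewrite t0.
exists k => //; rewrite metric_sym.
have := metric_triangle (k x) (sg t) (c t); rewrite -kz isom_dist.
move: zR => /= zR; have := ler_norm R'; rewrite kz; lra.
Qed.

(** The limit set is covered by the shadows of the orbit points far from x.
   The shadow of gx has diameter at most a constant times exp(-d(x, gx)), so
   the s-th powers of the diameters sum up to a tail of the orbit series. *)
Lemma convex_cobounded_dim_le : (hausdorff_dim rho Lam <= d%:E)%E.
Proof.
apply: (hausdorff_dim_le ltr01) => s _ _ s0 sfin.
apply: (@hausdorff_measure_eq0 _ _ _ _ Gam) => //; first exact: countable_group cE.
move=> eps eta eps0 eta0; have [r0 r00 Hr0] := conical_limit.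
pose K := 3 * r0 + 4.
have eta' : 0 < eta / expR (s * K) by rewrite divr_gt0 // expR_gt0.
have [r Hr] := orbit_tail sfin eta'.
pose n := Num.max (Num.max 0 r) (K - ln eps).
have n0 : 0 <= n by rewrite !le_max lexx.
pose U g xi := [/\ n < disp x g, Lam xi & exists c t, [/\ geodesic_ray c, c 0 = x, xi c, 0 <= t & mdist (c t) (g x) <= r0]].
pose w g := if n < disp x g then expR (s * K) * expR (- s * disp x g) else 0.
exists U, w; split.
- apply/seteqP; split=> [xi Lxi|xi [g _ []//]].
  have [bx _] := Lxi; have [c [rc cx xc _]] := boundary_ray proper CAT x bx.
  have t0 : 0 <= n + r0 + 1 by rewrite !addr_ge0.
  have [g Gg h] := Hr0 xi Lxi c rc cx xc _ t0; exists g => //; split=> //.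
    have cT : mdist x (c (n + r0 + 1)) = n + r0 + 1 by rewrite -cx rc // sub0r normrN ger0_norm.
    have := metric_triangle x (g x) (c (n + r0 + 1)).
    by rewrite cT (metric_sym (g x)) -/(disp x g); lra.
  by exists c, (n + r0 + 1).
- move=> g Gg; have [gn|gn] := boolP (n < disp x g); last first.
    exists 0; rewrite /w (negbTE gn); split=> //; first exact: ltW.
      by rewrite powR0 ?gt_eqF.
    by move=> a b [h]; rewrite h in gn.
  exists (expR (K - disp x g)); split.
  + exact: expR_ge0.
  + rewrite -[leRHS]lnK // ler_expR; have : K - ln eps <= n by rewrite le_max lexx orbT.
    lra.
  + rewrite /w gn -expRM -expRD ler_expR; lra.
  move=> a b [_ La [c [t [rc cx ac t0 ct]]]] [_ Lb [c' [t' [rc' c'x bc' t'0 ct']]]].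
  rewrite -opprB; apply: (bourdon_le proper CAT (N := Num.max t t') (c := c) (c' := c')) => //.
  + by case: La.
  + by case: Lb.
  move=> u v; rewrite !ge_max => /andP[tu t'u] /andP[tv t'v].
  have tE : mdist x (c t) = t by rewrite -cx rc // sub0r normrN ger0_norm.
  have t'E : mdist x (c' t') = t' by rewrite -c'x rc' // sub0r normrN ger0_norm.
  have a1 := metric_triangle x (c t) (g x); have a2 := metric_triangle x (c' t') (g x).
  have a3 := metric_triangle (c t) (g x) (c' t'); rewrite (metric_sym (g x)) in a3.
  rewrite tE -/(disp x g) in a1; rewrite t'E -/(disp x g) in a2.
  have g1 : disp x g - 3 * r0 <= gp x (c u) (c t).
    by rewrite (gp_ray rc cx) ?le_min ?(le_trans t0) //; apply/andP; split; lra.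
  have g2 : disp x g - 3 * r0 <= gp x (c t) (c' t').
    by have := gp_step x (c t) (c' t'); rewrite tE; lra.
  have g3 : disp x g - 3 * r0 <= gp x (c' t') (c' v).
    by rewrite (gp_ray rc' c'x) ?le_min ?(le_trans t'0) //; apply/andP; split; lra.
  by have := gp_hyperbolic3 CAT g1 g2 g3; rewrite /K; lra.
- move=> l ul lG.
  rewrite (eq_bigr (fun g => if n < disp x g then expR (s * K) * expR (- s * disp x g) else 0)) //.
  rewrite -big_mkcond -big_filter -mulr_sumr mulrC -ler_pdivlMr ?expR_gt0 //.
  apply: Hr; first exact: filter_uniq.
  move=> g; rewrite mem_filter => /andP[gn /lG Gg]; split=> //.
  by apply: le_lt_trans gn; rewrite !le_max lexx orbT.
Qed.

End ConvexCobounded.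

End UpperBounds.

(** * Critical exponent less than one *)

Section CoarseComponents.
Variables (R : realType) (X : metricType R) (x : X) (Gam : set (isom X)).
Hypothesis Gsub : is_subgroup Gam.
Variables (L r : R).

Lemma dist_disp (a b : isom X) : mdist (a x) (b x) = disp x (a^-1 * b)%g.
Proof. by rewrite /disp /= -[RHS](isom_dist a) isomKV. Qed.

(** Adjacency in the coarse orbit graph outside the ball of radius r.  The
   whole orbit graph is connected for large L if Gam is finitely generated;
   outside the ball it falls apart into components. *)
Definition step : rel (isom X) := fun a b =>
  `[< [/\ Gam a, Gam b, r < disp x a, r < disp x b & mdist (a x) (b x) <= L] >].

Definition conn (g h : isom X) := exists2 l, path step g l & last g l = h.

Lemma conn_refl g : conn g g. Proof. by exists [::]. Qed.

Lemma step_sym : symmetric step.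
Proof. by move=> a b; apply: asbool_equiv_eq; split=> -[*]; split; rewrite // metric_sym. Qed.

Lemma conn_sym g h : conn g h -> conn h g.
Proof.
case=> l pl <-; exists (rev (belast g l)).
  by rewrite rev_path; under eq_path do rewrite step_sym.
case: l {pl} => //= a l; by rewrite rev_cons last_rcons.
Qed.

Lemma conn_trans g h k : conn g h -> conn h k -> conn g k.
Proof. by case=> l pl <- [m pm <-]; exists (l ++ m); rewrite ?cat_path ?pl // last_cat. Qed.

Lemma conn_step g h k : conn g h -> step h k -> conn g k.
Proof. by move=> gh hk; apply: conn_trans gh _; exists [:: k]; rewrite //= hk. Qed.

Lemma conn_in g h : Gam g -> r < disp x g -> conn g h -> Gam h /\ r < disp x h.
Proof.
move=> Gg gr [l pl <-]; case/lastP: l pl => //= l b.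
by rewrite rcons_path last_rcons => /andP[_ /asboolP[]].
Qed.

Lemma conn_path g l a : path step g l -> a \in g :: l -> conn g a.
Proof.
elim: l g => [|b l IH] g /=; first by rewrite inE => _ /eqP ->; exact: conn_refl.
move=> /andP[gb pl]; rewrite inE => /predU1P[->|al]; first exact: conn_refl.
by apply: conn_trans (IH b pl al); exists [:: b]; rewrite //= gb.
Qed.

Lemma conn_uniq g h : conn g h -> exists l, [/\ path step g l, last g l = h & uniq (g :: l)].
Proof. by case=> l pl <-; case/shortenP: pl => l' pl' ul' _; exists l'. Qed.

Definition comp g : set (isom X) := [set h | conn g h].

Lemma comp_eq g h : conn g h -> comp g = comp h.
Proof.
move=> gh; apply/seteqP; split=> k; last exact: conn_trans.
exact: conn_trans (conn_sym gh).
Qed.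

Definition comp_rep g : isom X := xget 1%g (comp g).

Lemma comp_repP g : conn g (comp_rep g).
Proof. exact: (xgetPex 1%g (ex_intro _ g (conn_refl g))). Qed.

Lemma comp_rep_id g : comp_rep (comp_rep g) = comp_rep g.
Proof. by rewrite {1}/comp_rep -(comp_eq (comp_repP g)). Qed.

Definition step0 : rel (isom X) := fun a b => `[< [/\ Gam a, Gam b & mdist (a x) (b x) <= L] >].

(** Follow the path after its last visit to the ball of radius r. *)
Lemma last_exit g0 l : path step0 g0 l -> disp x g0 <= r -> r < disp x (last g0 l) ->
  exists h, [/\ Gam h, r < disp x h, disp x h <= r + L & conn h (last g0 l)].
Proof.
elim/last_ind: l => [|l b IH] /=; first by move=> _ a1 /(le_lt_trans a1); rewrite ltxx.
rewrite rcons_path last_rcons => /andP[pl /asboolP[Gc Gb cb]] g0r br.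
have [cr|cr] := leP (disp x (last g0 l)) r.
  exists b; split=> //; last exact: conn_refl.
  by have := metric_triangle x (last g0 l x) (b x); rewrite /disp in cr *; lra.
have [h [Gh hr hL ch]] := IH pl g0r cr; exists h; split=> //.
by apply: conn_step ch _; apply/asboolP.
Qed.

End CoarseComponents.

Lemma generated_chain (R : realType) (X : metricType R) (x : X) (Gam : set (isom X)) :
  is_subgroup Gam -> finitely_generated Gam -> exists L : R, forall g, Gam g ->
  exists2 l, path (step0 x Gam L) 1%g l & last 1%g l = g.
Proof.
move=> Gsub [A [finA GA]].
exists (\sum_(a <- fset_set A) disp x a) => g; set L := \sum_(a <- _) _.
have AL a : A a -> disp x a <= L.
  move=> Aa; have aA : a \in fset_set A by rewrite in_fset_set // mem_set.
  by rewrite /L (big_rem a) //= lerDl sumr_ge0 // => b _; exact: disp_ge0.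
have AG : A `<=` Gam by move=> a Aa; rewrite GA => H _; apply.
have [G1 GM GV] := Gsub.
pose reach a b := exists2 l, path (step0 x Gam L) a l & last a l = b.
have rtr a b c : reach a b -> reach b c -> reach a c.
  by case=> l pl <- [m pm <-]; exists (l ++ m); rewrite ?cat_path ?pl // last_cat.
have s0sym : symmetric (step0 x Gam L).
  by move=> a b; apply: asbool_equiv_eq; split=> -[*]; split; rewrite // metric_sym.
have rsym a b : reach a b -> reach b a.
  case=> l pl <-; exists (rev (belast a l)).
    by rewrite rev_path; under eq_path do rewrite s0sym.
  by case: l {pl} => //= c l; rewrite rev_cons last_rcons.
have rmul k a b : Gam k -> reach a b -> reach (k * a)%g (k * b)%g.
  move=> Gk [l pl <-]; exists (map (fun c => k * c)%g l); last by rewrite last_map.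
  rewrite path_map; apply: sub_path pl => c e /asboolP[Gc Ge ce]; apply/asboolP.
  by split; [exact: GM | exact: GM | rewrite /= isom_dist].
rewrite [in Gam g]GA => Gg.
have [] := Gg [set h | Gam h /\ reach 1%g h] => //.
  split=> [|a b [Ga ra] [Gb rb]|a [Ga ra]].
  - by split=> //; exists [::].
  - split; first exact: GM.
    by apply: rtr ra _; have := rmul a _ _ Ga rb; rewrite mulg1.
  - split; first exact: GV.
    by apply: rsym; have := rmul _ _ _ (GV _ Ga) ra; rewrite mulg1 mulVg.
move=> a Aa; split; first exact: AG.
by exists [:: a] => //=; rewrite andbT; apply/asboolP; split; [|exact: AG|exact: AL].
Qed.

Lemma infinitely_often (T : eqType) (l : seq T) (P : T -> nat -> Prop) :
  (forall N : nat, exists n, (N <= n)%N /\ exists2 t, t \in l & P t n) ->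
  exists2 t, t \in l & forall N : nat, exists2 n, (N <= n)%N & P t n.
Proof.
elim: l => [|t l IH] H; first by have [n [_ []]] := H 0%N.
have [tinf|] := pselect (forall N : nat, exists2 n, (N <= n)%N & P t n).
  by exists t; rewrite ?mem_head.
move=> /existsNP[N0 HN0]; case: IH => [N|t' t'l Ht']; last by exists t'; rewrite // inE t'l orbT.
have [n [nN [t' t'l Pt'n]]] := H (maxn N N0); exists n; split; first by lia.
move: t'l; rewrite inE => /predU1P[E|t'l]; last by exists t'.
by case: HN0; exists n; [lia | rewrite -E].
Qed.

Section SmallExponent.
Variables (R : realType) (X : metricType R) (x : X) (Gam : set (isom X)) (d : R).
Hypothesis proper : proper_space X.
Hypothesis CAT : CATm1 X.
Hypothesis Gsub : is_subgroup Gam.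
Hypothesis Gfg : finitely_generated Gam.
Hypothesis cE : critical_exponent x Gam = d%:E.
Hypothesis d1 : d < 1.
Local Notation gp := gromov_product.
Local Notation Lam := (limit_set x Gam).
Local Notation rho := (bourdon_metric x).

(** The limit set is covered by the limit sets of the components of the
   coarse orbit graph outside a large ball: each component visited by a sequence
   in Gam meets a fixed annulus, which is finite, so one of them is visited
   infinitely often.  By gp_chain, and since s <= 1, the s-th power of the
   diameter of a piece is at most a constant times the part of the orbit series
   carried by its component, and these parts are disjoint. *)
Theorem small_exponent_dim_le : (hausdorff_dim rho Lam <= d%:E)%E.
Proof.
apply: (hausdorff_dim_le cE (eta := 1 - d)); first by rewrite subr_gt0.
move=> s _; rewrite addrC subrK => s1 s0 sfin.
apply: (@hausdorff_measure_eq0 _ _ _ _ Gam) => //; first exact: countable_group cE.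
move=> eps eta eps0 eta0.
have [L0 HL0] := generated_chain x Gsub Gfg.
pose L := Num.max 0 L0.
have HL g : Gam g -> exists2 l, path (step0 x Gam L) 1%g l & last 1%g l = g.
  move=> /HL0[l pl <-]; exists l => //; apply: sub_path pl => a b /asboolP[Ga Gb ab].
  by apply/asboolP; split=> //; rewrite le_max ab orbT.
pose C := expR (s * 4) * expR (expR L).
have C0 : 0 < C by rewrite mulr_gt0 ?expR_gt0.
pose eta' := Num.min eta (expR (s * ln eps)) / C.
have eta'0 : 0 < eta' by rewrite divr_gt0 // lt_min eta0 expR_gt0.
have [r0 Hr0] := orbit_tail sfin eta'0.
pose r := Num.max 0 r0.
have r_ge0 : 0 <= r by rewrite le_max lexx.
have Hr l : uniq l -> (forall g, g \in l -> Gam g /\ r < disp x g) ->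
    \sum_(g <- l) expR (- s * disp x g) <= eta'.
  move=> ul lG; apply: Hr0 => // g /lG[Gg rg]; split=> //.
  by apply: le_lt_trans rg; rewrite le_max lexx orbT.
pose cmp := comp x Gam L r.
pose ser g := (\esum_(h in cmp g) (expR (- s * disp x h))%:E)%E.
have serle g : Gam g -> r < disp x g -> (ser g <= eta'%:E)%E.
  move=> Gg rg; apply: esum_le_seq => l ul lc; apply: Hr => // h /lc; exact: conn_in.
have ser0 g : (0 <= ser g)%E by apply: esum_EFin_ge0 => h; exact: expR_ge0.
have serfin g : Gam g -> r < disp x g -> ser g \is a fin_num.
  by move=> Gg rg; rewrite ge0_fin_numE //; apply: le_lt_trans (serle g Gg rg) (ltry _).
pose canon g := (r < disp x g) && (comp_rep x Gam L r g == g).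
pose U g xi := [/\ canon g, Lam xi &
  exists2 h : nat -> isom X, forall n, cmp g (h n) & converges_to_boundary x (fun n => h n x) xi].
pose w g := if canon g then C * fine (ser g) else 0.
exists U, w; split.
- apply/seteqP; split=> [xi Lxi|xi [g _ []//]].
  have [bx [g [gG cv]]] := Lxi.
  have [N HN] := limit_set_far proper CAT bx cv r.
  have finT : finite_set [set h | Gam h /\ disp x h <= r + L] := finite_orbit_ball cE _.
  have [] := @infinitely_often _ (fset_set [set h | Gam h /\ disp x h <= r + L])
    (fun h n => [/\ Gam h, r < disp x h & cmp h (g n)]).
    move=> M; exists (maxn M N); split; first by rewrite leq_maxl.
    have gr := HN (maxn M N) (leq_maxr _ _).
    have [l pl lE] := HL _ (gG (maxn M N)).
    have one_r : disp x 1%g <= r by rewrite disp1.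
    have lr : r < disp x (last 1%g l) by rewrite lE.
    have [h [Gh hr hL ch]] := last_exit pl one_r lr.
    by exists h; [rewrite in_fset_set // mem_set | rewrite -lE].
  move=> h _ Hh; have [_ _ [Gh hr _]] := Hh 0%N.
  have hrep : conn x Gam L r h (comp_rep x Gam L r h) := comp_repP _ _ _ _ h.
  have [Gk kr] := conn_in Gh hr hrep.
  exists (comp_rep x Gam L r h) => //; split=> //; first by rewrite /canon kr comp_rep_id eqxx.
  have ex N' : {n | (N' <= n)%N /\ cmp h (g n)}.
    by apply: cid; have [n nN [_ _ c]] := Hh N'; exists n.
  exists (fun n => g (projT1 (ex n))).
    by move=> n; rewrite /cmp -(comp_eq hrep); have [] := projT2 (ex n).
  move=> c xc M; have [N' HN'] := cv c xc M; exists N' => n t n1 t1.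
  by apply: HN' => //; apply: leq_trans n1 _; have [] := projT2 (ex n).
- move=> g Gg; have [gc|gc] := boolP (canon g); last first.
    exists 0; rewrite /w (negbTE gc); split=> //; first exact: ltW.
      by rewrite powR0 ?gt_eqF.
    by move=> a b [h]; rewrite h in gc.
  have gr : r < disp x g by case/andP: gc.
  have serE := fineK (serfin g Gg gr).
  set S := fine (ser g) in serE.
  have Sle l : uniq l -> (forall h, h \in l -> cmp g h) -> \sum_(h <- l) expR (- s * disp x h) <= S.
    move=> ul lc; have := @seq_le_esum _ _ (cmp g) (fun h => expR (- s * disp x h)) l ul lc.
    by rewrite -/(ser g) -serE lee_fin.
  have S0 : 0 < S.
    apply: (@lt_le_trans _ _ (\sum_(h <- [:: g]) expR (- s * disp x h))).
      by rewrite big_seq1 expR_gt0.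
    by apply: Sle => // h; rewrite inE => /eqP ->; exact: conn_refl.
  have Seta : S <= eta' by rewrite -lee_fin serE serle.
  have CS0 : 0 < C * S by rewrite mulr_gt0.
  exists (expR (ln (C * S) / s)); split.
  + exact: expR_ge0.
  + rewrite -[leRHS]lnK // ler_expR ler_pdivrMr // [ln eps * s]mulrC -ler_expR lnK //.
    apply: (@le_trans _ _ (C * eta')); first by rewrite ler_pM2l.
    have -> : C * eta' = Num.min eta (expR (s * ln eps)) by rewrite /eta' mulrCA mulfV ?mulr1 ?gt_eqF.
    by rewrite ge_min lexx orbT.
  + by rewrite /w gc -expRM divfK ?gt_eqF // lnK.
  move=> a b [_ La [h hc ha]] [_ Lb [k kc kb]].
  pose E := expR (expR L) * S.
  have E0 : 0 < E by rewrite mulr_gt0 ?expR_gt0.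
  have -> : ln (C * S) / s = 4 - (- ln E / s).
    by rewrite /C -mulrA lnM ?posrE ?expR_gt0 // expRK; field; exact: lt0r_neq0.
  apply: (bourdon_le_seq proper CAT _ _ ha kb); [by case: La|by case: Lb|].
  move=> N; exists N, N; split=> //.
  have [l [pl lE ul]] := conn_uniq (conn_trans (conn_sym (hc N)) (kc N)).
  pose ev (f : isom X) := f x.
  have pl' : path (fun p q : X => mdist p q <= L) (ev (h N)) (map ev l).
    by rewrite path_map; apply: sub_path pl => f f' /asboolP[].
  have := gp_chain CAT x s0 (ltW s1) pl'.
  rewrite -(map_cons ev) big_map last_map lE => le.
  rewrite ler_pdivrMr // mulrC -ler_expR; apply: (@le_trans _ _ (expR (ln E^-1))); first by rewrite lnV.
  rewrite lnK ?posrE ?invr_gt0 // -[leRHS]invrK lef_pV2 ?posrE ?invr_gt0 ?expR_gt0 //.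
  rewrite -expRN -mulNr; apply: le_trans le _; rewrite /E ler_pM2l ?expR_gt0 //.
  apply: Sle => // f fl; apply: conn_trans (hc N) _; exact: conn_path pl fl.
- move=> l ul lG.
  rewrite (eq_bigr (fun g => if canon g then C * fine (ser g) else 0)) //.
  rewrite -big_mkcond -big_filter -mulr_sumr mulrC -ler_pdivlMr //.
  apply: (@le_trans _ _ eta'); last by rewrite /eta' ler_pM2r ?invr_gt0 // ge_min lexx.
  set l' := [seq g <- l | canon g].
  have l'P g : g \in l' -> [/\ Gam g, r < disp x g & comp_rep x Gam L r g = g].
    by rewrite mem_filter => /andP[/andP[gr /eqP ge] /lG Gg].
  rewrite -lee_fin; apply: le_trans (seq_le_esum (S := [set` l']) _ _ _) _ => //.
    exact: filter_uniq.
  rewrite (eq_esum (b := fun g => \esum_(h in cmp g) (expR (- s * disp x h))%:E)%E); last first.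
    by move=> g /= /l'P[Gg gr _]; rewrite fineK // serfin.
  rewrite esum_esum; last by move=> g h _ _; rewrite lee_fin expR_ge0.
  apply: (@esum_le_seq _ _ _ (fun k => expR (- s * disp x k.2))) => q uq qP.
  rewrite -(big_map snd xpredT (fun h => expR (- s * disp x h))); apply: Hr.
    rewrite map_inj_in_uniq // => -[g h] [g' h'] /qP[/= /l'P[Gg gr ge] gh] /qP[/= /l'P[Gg' gr' ge'] g'h'] /= hh.
    subst h'; congr (_, _); rewrite -ge -ge' /comp_rep; congr (xget _ _).
    exact: comp_eq (conn_trans gh (conn_sym g'h')).
  by move=> h /mapP[[g h'] /qP[/= /l'P[Gg gr ge] gh] ->]; exact: conn_in gh.
Qed.

End SmallExponent.

(** * Heavy annuli and ultrafilter limits *)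

Lemma finite_bounded_lists (T : choiceType) (S : set T) (M : nat) :
  (forall l, uniq l -> (forall t, t \in l -> S t) -> (size l <= M)%N) -> finite_set S.
Proof.
move=> H; apply: contrapT => inf; have [C CS szC] := infinite_set_fset M.+1 inf.
have := H (enum_fset C) (fset_uniq C) (fun t tC => CS t tC).
by rewrite leqNgt szC.
Qed.

Section Growth.
Variables (R : realType) (X : metricType R) (x : X) (Gam : set (isom X)) (d : R).
Hypothesis cE : critical_exponent x Gam = d%:E.

(** Otherwise comparison with a geometric series would make the orbit series
   converge below the critical exponent. *)
Lemma annulus_growth (s K : R) (n0 : nat) : 0 < s -> s < d ->
  exists n l, [/\ (n0 <= n)%N, uniq l,
    forall g, g \in l -> [/\ Gam g, n%:R <= disp x g & disp x g < n%:R + 1] &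
    K * expR (s * n%:R) < (size l)%:R].
Proof.
move=> s0 sd; apply: contrapT => nex.
have bnd n l : (n0 <= n)%N -> uniq l ->
    (forall g, g \in l -> [/\ Gam g, n%:R <= disp x g & disp x g < n%:R + 1]) ->
    (size l)%:R <= K * expR (s * n%:R).
  by move=> nn ul lG; rewrite leNgt; apply/negP => lt; apply: nex; exists n, l.
have fin := finite_orbit_ball cE (n0%:R + 1).
pose M := (size (fset_set [set g | Gam g /\ disp x g <= n0%:R + 1]))%:R : R.
pose K' := `|K| + M.
have M0 : 0 <= M by exact: ler0n.
have bnd' n l : uniq l ->
    (forall g, g \in l -> [/\ Gam g, n%:R <= disp x g & disp x g < n%:R + 1]) ->
    (size l)%:R <= K' * expR (s * n%:R).
  move=> ul lG; have [nn|nn] := leqP n0 n.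
    apply: le_trans (bnd n l nn ul lG) _; rewrite ler_wpM2r ?expR_ge0 //.
    by rewrite /K'; have := ler_norm K; lra.
  apply: (@le_trans _ _ M).
    rewrite ler_nat; apply: uniq_leq_size => // g /lG[Gg _ gn].
    rewrite -[_ \in _]/(g \in fset_set _) in_fset_set // mem_set //; split=> //.
    by apply: ltW; apply: lt_le_trans gn _; rewrite lerD2r ler_nat ltnW.
  rewrite -[leLHS]mulr1 ler_pM ?ler01 //; first by rewrite /K'; have := normr_ge0 K; lra.
  by rewrite -expR0 ler_expR mulr_ge0 // ltW.
have K'0 : 0 <= K' by rewrite addr_ge0.
pose s' := (s + d) / 2.
pose q := expR (s - s').
have q0 : 0 < q by exact: expR_gt0.
have q1 : q < 1 by rewrite expR_lt1 /s'; lra.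
have geo N : \sum_(n < N) q ^+ n <= (1 - q)^-1.
  have : (1 - q) * \sum_(n < N) q ^+ n = 1 - q ^+ N.
    by elim: N => [|N IH]; rewrite ?big_ord0 ?big_ord_recr /= ?mulrDr ?IH ?exprS; ring.
  have p1 : 0 < 1 - q by rewrite subr_gt0.
  move=> E; by rewrite -[leRHS]mul1r ler_pdivlMr // mulrC E gerBl exprn_ge0 // (ltW q0).
have s'0 : 0 < s' by rewrite /s'; lra.
have s'd : s' < d by rewrite /s'; lra.
apply: (critical_exponent_ge cE s'0 s'd).
apply: (@le_lt_trans _ _ (K' * (1 - q)^-1)%:E); last exact: ltry.
apply: esum_le_seq => l ul lG.
pose f (g : isom X) := Num.truncn (disp x g).
have fP g : (f g)%:R <= disp x g < (f g)%:R + 1.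
  by rewrite natr1; apply: truncn_itv; exact: disp_ge0.
pose N := (\max_(g <- l) f g).+1.
have fN g : g \in l -> (f g < N)%N by move=> gl; rewrite ltnS; exact: leq_bigmax_seq.
have -> : \sum_(g <- l) expR (- s' * mdist x (g x)) =
    \sum_(n < N) \sum_(g <- l | f g == n) expR (- s' * disp x g).
  rewrite (exchange_big_dep xpredT) //=; apply: eq_big_seq => g gl.
  rewrite (big_pred1 (Ordinal (fN g gl))) // => n /=.
apply: (@le_trans _ _ (\sum_(n < N) K' * q ^+ n)); last by rewrite -mulr_sumr ler_wpM2l.
apply: ler_sum => n _; rewrite -big_filter.
apply: (@le_trans _ _ (\sum_(g <- [seq g <- l | f g == n]) expR (- s' * n%:R))).
  rewrite big_seq [leRHS]big_seq; apply: ler_sum => g; rewrite mem_filter => /andP[/eqP fg _].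
  rewrite ler_expR !mulNr lerN2 ler_wpM2l //; first by rewrite /s'; lra.
  by have /andP[] := fP g; rewrite fg.
rewrite big_const_seq count_predT iter_addr addr0 -[leLHS]mulr_natl.
have -> : K' * q ^+ n = K' * expR (s * n%:R) * expR (- s' * n%:R).
  by rewrite /q -expRM_natl -mulrA -expRD; congr (_ * expR _); ring.
rewrite ler_wpM2r ?expR_ge0 //; apply: bnd'; first exact: filter_uniq.
move=> g; rewrite mem_filter => /andP[/eqP fg gl].
by have /andP[] := fP g; rewrite fg; split=> //; exact: lG.
Qed.

End Growth.

Section UltraLimits.
Variable R : realType.

Lemma free_ultrafilter : exists U : set_system nat,
  [/\ forall A B, U A -> A `<=` B -> U B, forall A B, U A -> U B -> U (A `&` B),
      forall A, U A -> A !=set0, forall A, U A \/ U (~` A) &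
      forall N : nat, U [set n | (N <= n)%N]].
Proof.
have [U [UU sub]] := @ultraFilterLemma nat \oo _.
exists U; split.
- by move=> A B UA AB; apply: filterS UA.
- by move=> A B; exact: filterI.
- by move=> A; exact: filter_ex.
- by move=> A; exact: in_ultra_setVsetC.
- by move=> N; apply: sub; exists N.
Qed.

Lemma ultra_limit (U : set_system nat) (f : nat -> R) (B : R) :
  (forall A B, U A -> A `<=` B -> U B) -> (forall A B, U A -> U B -> U (A `&` B)) ->
  (forall A, U A -> A !=set0) -> (forall A, U A \/ U (~` A)) -> U setT ->
  (forall n, `|f n| <= B) ->
  exists l, forall e, 0 < e -> U [set n | `|f n - l| <= e].
Proof.
move=> US UI Une Uor UT fB.
pose S := [set t | U [set n | t <= f n]].
have Slow : S (- B) by apply: US UT _ => n _ /=; have := fB n; rewrite ler_norml => /andP[].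
have Sub t : S t -> t <= B.
  by move=> /Une[n /= tn]; apply: le_trans tn _; have := fB n; rewrite ler_norml => /andP[].
have hasS : has_sup S by split; [exists (- B) | exists B].
exists (sup S) => e e0; have [t St te] := sup_adherent e0 hasS.
have nS : ~ S (sup S + e).
  move=> Se; have : sup S + e <= sup S by apply: ub_le_sup Se; case: hasS.
  by rewrite gerDl leNgt e0.
have [//|Un] := Uor [set n | sup S + e <= f n].
apply: US (UI _ _ St Un) _ => n [/= h1 h2].
rewrite ler_norml; apply/andP; split; first by lra.
by move/negP: h2; rewrite -ltNge; lra.
Qed.

End UltraLimits.

(** * Directions almost fixed by the group *)

Lemma int_range (m : nat) (j : int) : - m.+1%:Z < j + 1 -> j < m.+1%:Z ->
  exists2 i : nat, (i < 2 * m + 4)%N & j = i%:Z - m.+2%:Z.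
Proof. by move=> h1 h2; exists (absz (j + m.+2%:Z)); lia. Qed.

Section Focal.
Variables (R : realType) (X : metricType R) (x : X) (Gam : set (isom X)) (d : R).
Hypothesis proper : proper_space X.
Hypothesis CAT : CATm1 X.
Hypothesis Gsub : is_subgroup Gam.
Hypothesis cE : critical_exponent x Gam = d%:E.
Local Notation gp := gromov_product.
Local Notation Lam := (limit_set x Gam).

(** A sequence that every element of Gam eventually almost fixes, as seen
   from x. *)
Variable z : nat -> X.
Hypothesis zfix : forall g n, Gam g -> disp x g <= n%:R -> n%:R - 2 <= gp x (z n) (g (z n)).
Variable U : set_system nat.
Hypothesis US : forall A B, U A -> A `<=` B -> U B.
Hypothesis UI : forall A B, U A -> U B -> U (A `&` B).
Hypothesis Une : forall A, U A -> A !=set0.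
Hypothesis Uor : forall A, U A \/ U (~` A).
Hypothesis Uge : forall N : nat, U [set n | (N <= n)%N].

Let Umin (r : R) : U [set n | r <= n%:R].
Proof.
have [N rN] := nat_above r; apply: US (Uge N) _ => n /= Nn.
by apply: le_trans rN _; rewrite ler_nat.
Qed.

Lemma move_target o p (g : isom X) n : Gam g -> disp x g <= n%:R -> mdist x o + mdist o p + 2 <= n%:R ->
  gp o p (g (z n)) <= gp o p (z n) + 2 /\ gp o p (z n) <= gp o p (g (z n)) + 2.
Proof.
move=> Gg gn on; have h := zfix Gg gn; have h2 := gp_move_base x o (z n) (g (z n)).
have h3 : mdist o p <= gp o (z n) (g (z n)) by lra.
have h4 := le_trans (gp_le_l o p (z n)) h3; have h5 := le_trans (gp_le_l o p (g (z n))) h3.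
rewrite (gp_sym o (z n)) in h5; split.
  by have := gp_hyperbolic CAT (lexx (gp o p (g (z n)))) h5; lra.
by have := gp_hyperbolic CAT (lexx (gp o p (z n))) h4; lra.
Qed.

Definition busemann_at n (g : isom X) : R := mdist (g x) (z n) - mdist x (z n).

Lemma busemann_at_norm n g : `|busemann_at n g| <= disp x g.
Proof.
have h1 := metric_triangle (g x) x (z n); have h2 := metric_triangle x (g x) (z n).
rewrite (metric_sym (g x) x) -/(disp x g) in h1; rewrite -/(disp x g) in h2.
by rewrite /busemann_at ler_norml; apply/andP; split; lra.
Qed.

Lemma busemann_gp n (g : isom X) : 2 * gp x (g x) (z n) = disp x g - busemann_at n g.
Proof. by rewrite /gp /busemann_at /disp; lra. Qed.

Lemma busemann_atM n g h : Gam g -> disp x g <= n%:R -> disp x h + 2 <= n%:R ->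
  `|busemann_at n (g * h)%g - busemann_at n g - busemann_at n h| <= 4.
Proof.
move=> Gg gn hn.
have GV : Gam g^-1%g by case: Gsub => _ _; apply.
have gn' : disp x (g^-1)%g <= n%:R by rewrite dispV.
have hn' : mdist x x + mdist x (h x) + 2 <= n%:R by rewrite mdistxx add0r.
have := move_target GV gn' hn'.
have e1 : mdist (h x) (g^-1%g (z n)) = mdist (g (h x)) (z n) by rewrite -(isom_dist g) isomKV.
have e2 : mdist x (g^-1%g (z n)) = mdist (g x) (z n) by rewrite -(isom_dist g) isomKV.
by rewrite /gp e1 e2 /busemann_at /= => -[h1 h2]; rewrite ler_norml; apply/andP; split; lra.
Qed.

Let exb g : {l | forall e, 0 < e -> U [set n | `|busemann_at n g - l| <= e]}.
Proof.
apply: cid; apply: (ultra_limit (B := disp x g)) => //; last by move=> n; exact: busemann_at_norm.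
by apply: US (Uge 0) _.
Qed.

(** The Busemann quasi-character of the fixed direction. *)
Definition busemann g : R := projT1 (exb g).

Lemma busemannP g e : 0 < e -> U [set n | `|busemann_at n g - busemann g| <= e].
Proof. exact: (projT2 (exb g)). Qed.

Lemma busemann_norm g : `|busemann g| <= disp x g.
Proof.
apply/ler_addgt0Pr => e e0; have [n /= h] := Une (busemannP g e0).
have := ler_normD (busemann_at n g) (busemann g - busemann_at n g).
rewrite addrC subrK => h2; rewrite distrC in h; have := busemann_at_norm n g; lra.
Qed.

Lemma busemannM g h : Gam g -> Gam h -> `|busemann (g * h)%g - busemann g - busemann h| <= 4.
Proof.
move=> Gg Gh; apply/ler_addgt0Pr => e e0; have e3 : 0 < e / 3 by rewrite divr_gt0.
have [n [/= h1 [h2 [h3 [h4 h5]]]]] := Une (UI (busemannP g e3) (UI (busemannP h e3)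
  (UI (busemannP (g * h)%g e3) (UI (Umin (disp x g)) (Umin (disp x h + 2)))))).
have := busemann_atM Gg h4 h5; move: h1 h2 h3; rewrite !ler_norml.
by move=> /andP[? ?] /andP[? ?] /andP[? ?] /andP[? ?]; apply/andP; split; lra.
Qed.

Lemma busemann1 : `|busemann 1%g| <= 0.
Proof. by apply: le_trans (busemann_norm _) _; rewrite disp1. Qed.

(** Bounded Busemann values put every orbit point far from x in the direction
   of z, which leaves room for one limit point only. *)
Lemma focal_bounded B : (forall g, Gam g -> `|busemann g| <= B) ->
  forall xi eta, Lam xi -> Lam eta -> xi = eta.
Proof.
move=> HB xi eta [bx [g [gG cv]]] [be [h [hG cv']]].
apply: (boundary_eq_seq proper CAT bx be cv cv') => M N.
have [N1 HN1] := limit_set_far proper CAT bx cv (2 * (M + 2) + B + 1).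
have [N2 HN2] := limit_set_far proper CAT be cv' (2 * (M + 2) + B + 1).
pose i := maxn N (maxn N1 N2); exists i, i; split; [by rewrite leq_maxl|by rewrite leq_maxl|].
have gi := HN1 i (_ : N1 <= i)%N; have hi := HN2 i (_ : N2 <= i)%N.
have {}gi : 2 * (M + 2) + B + 1 < disp x (g i) by apply: gi; rewrite /i; lia.
have {}hi : 2 * (M + 2) + B + 1 < disp x (h i) by apply: hi; rewrite /i; lia.
have [n [/= h1 h2]] := Une (UI (busemannP (g i) ltr01) (busemannP (h i) ltr01)).
have b1 := HB _ (gG i); have b2 := HB _ (hG i).
have e1 := busemann_gp n (g i); have e2 := busemann_gp n (h i).
move: h1 h2 b1 b2; rewrite !ler_norml => /andP[? ?] /andP[? ?] /andP[? ?] /andP[? ?].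
have k1 : M + 2 <= gp x (g i x) (z n) by lra.
have k2 : M + 2 <= gp x (z n) (h i x) by rewrite gp_sym; lra.
by have := gp_hyperbolic CAT k1 k2; lra.
Qed.

Section Unbounded.
Variable f : isom X.
Hypothesis Gf : Gam f.
Hypothesis bf : busemann f <= - 50.
Let e := (f^-1)%g.

Let Ge : Gam e. Proof. by case: Gsub => _ _; apply. Qed.
Let Gpow g m : Gam g -> Gam (g ^+ m)%g.
Proof. by move=> Gg; case: Gsub => G1 GM _; elim: m => [|m IH] //; rewrite expgS; exact: GM. Qed.

Let be : 46 <= busemann e.
Proof.
have := busemannM Gf Ge; rewrite /e mulgV -/e; have := busemann1.
by rewrite !ler_norml => /andP[? ?] /andP[? ?]; have := bf; lra.
Qed.

Lemma busemann_pow_step m : `|busemann (f ^+ m.+1)%g - busemann (f ^+ m)%g - busemann f| <= 4.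
Proof. by rewrite expgSr; apply: busemannM => //; exact: Gpow. Qed.

Lemma busemann_epow_step m : `|busemann (e ^+ m.+1)%g - busemann (e ^+ m)%g - busemann e| <= 4.
Proof. by rewrite expgSr; apply: busemannM => //; exact: Gpow. Qed.

Lemma busemann_pow_le m : busemann (f ^+ m)%g <= - m%:R.
Proof.
elim: m => [|m IH]; first by have := busemann1; rewrite expg0 ler_norml => /andP[]; lra.
have := busemann_pow_step m; rewrite ler_norml -natr1 => /andP[_]; have := bf; lra.
Qed.

Lemma busemann_epow_ge m : m%:R <= busemann (e ^+ m)%g.
Proof.
elim: m => [|m IH]; first by have := busemann1; rewrite expg0 ler_norml => /andP[]; lra.
have := busemann_epow_step m; rewrite ler_norml -natr1 => /andP[+ _]; have := be; lra.
Qed.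

(** The backward orbit of f stays away from the fixed direction, with a bound
   that does not deteriorate along the orbit. *)
Lemma backward_product m : U [set n | gp x ((e ^+ m)%g x) (z n) <= disp x e + 2].
Proof.
elim: m => [|m IH].
  apply: US (Uge 0) _ => n _ /=; apply: le_trans (gp_le_l _ _ _) _.
  by rewrite mdistxx addr_ge0 // disp_ge0.
apply: US (UI IH (UI (busemannP f ltr01) (UI (busemannP e ltr01)
  (UI (Umin (disp x e)) (Umin (disp x (e ^+ m.+1)%g + 2)))))) _.
move=> n [/= hT [hf [he [n1 n2]]]].
set u := (e ^+ m.+1)%g x; have uE : u = e ((e ^+ m)%g x) by rewrite /u expgS.
have := gp_le_l x (e x) (z n); rewrite -/(disp x e) => ele.
have [//|far] := leP (gp x u (z n)) (disp x e + 2).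
exfalso.
have un : mdist x x + mdist x u + 2 <= n%:R by rewrite mdistxx add0r.
have [_ mv] := move_target Ge n1 un.
have near : gp x u (e x) <= gp x (e x) (z n) + 2.
  rewrite leNgt; apply/negP => lt.
  pose T := Num.min (gp x u (e x)) (gp x u (z n)).
  have T1 : T <= gp x (e x) u by rewrite gp_sym ge_min lexx.
  have T2 : T <= gp x u (z n) by rewrite ge_min lexx orbT.
  have T3 : gp x (e x) (z n) + 2 < T by rewrite lt_min lt andTb; lra.
  by have := gp_hyperbolic CAT T1 T2; lra.
have eT : gp (e x) u (e (z n)) = gp x ((e ^+ m)%g x) (z n) by rewrite uE gp_isom.
have fE : mdist (f x) (z n) = mdist x (e (z n)).
  by rewrite -(isom_dist f x) /e isomKV.
have eE := busemann_gp n e.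
have be' := be; have bf' := bf.
move: hf he; rewrite /busemann_at !ler_norml fE => /andP[f1 f2] /andP[e1 e2].
move: eT hT mv near eE ele far; rewrite /busemann_at /disp /gp isom_dist -/u.
rewrite (metric_sym (e x) u); lra.
Qed.

Let tau := disp x e + 4.

Lemma forward_product m : U [set n | disp x (f ^+ m)%g + busemann_at n (f ^+ m)%g <= 2 * tau].
Proof.
apply: US (UI (backward_product m) (UI (Umin (disp x (e ^+ m)%g)) (Umin (disp x (e ^+ m)%g + 2)))) _.
move=> n [/= h [n1 n2]].
have un : mdist x x + mdist x ((e ^+ m)%g x) + 2 <= n%:R by rewrite mdistxx add0r.
have [mv _] := move_target (Gpow m Ge) n1 un.
have em : (e ^+ m)%g = ((f ^+ m)^-1)%g by rewrite /e expVgn.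
have E1 : mdist ((f ^+ m)%g x) (z n) = mdist x ((e ^+ m)%g (z n)).
  by rewrite -(isom_dist (f ^+ m)%g x) em isomKV.
have E2 : disp x (f ^+ m)%g = disp x (e ^+ m)%g by rewrite em dispV.
rewrite /busemann_at E1 E2 /tau; move: mv h; rewrite /gp isom_dist /disp; lra.
Qed.

(** Elements almost preserving the Busemann level are moved into a fixed ball
   by conjugation with a high power of f. *)
Lemma conjugate_bounded K1 g : Gam g -> `|busemann g| <= K1 ->
  exists m0, forall m, (m0 <= m)%N ->
    disp x ((f ^+ m)^-1 * g * f ^+ m)%g <= 2 * tau + K1 + 18.
Proof.
move=> Gg gK; have [m0 Hm0] := nat_above (2 * disp x g + tau + 6); exists m0 => m mm.
have GM : Gam (g * f ^+ m)%g by case: Gsub => _ GM _; apply: GM => //; exact: Gpow.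
set p := (f ^+ m)%g x; set q := g p.
have [n [/= h1 [h2 [h3 [n1 n2]]]]] := Une (UI (forward_product m) (UI (busemannP (f ^+ m)%g ltr01)
  (UI (busemannP (g * f ^+ m)%g ltr01) (UI (Umin (disp x g)) (Umin (2 * disp x (f ^+ m)%g + 2)))))).
have bm := busemannM Gg (Gpow m Gf).
have pm : m%:R <= disp x (f ^+ m)%g.
  have := busemann_norm (f ^+ m)%g; have := busemann_pow_le m.
  by rewrite ler_norml => ? /andP[? _]; lra.
have mm' : 2 * disp x g + tau + 6 <= m%:R by apply: le_trans Hm0 _; rewrite ler_nat.
have GV : Gam g^-1%g by case: Gsub => _ _; apply.
(* Seen from q, the points x and g x lie in the same direction, and z is to g x
   what g^-1 z, hence z, is to x seen from p. *)
have gVn : disp x (g^-1)%g <= n%:R by rewrite dispV.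
have pn : mdist x p + mdist p x + 2 <= n%:R.
  by rewrite (metric_sym p x); move: n2; rewrite /disp -/p; lra.
have [mv _] := move_target GV gVn pn.
have E : gp q (g x) (z n) = gp p x (g^-1%g (z n)).
  by rewrite -(gp_isom g p) isomKV.
have far : tau + 5 <= gp q x (g x).
  have s1 := gp_step q x (g x); have s2 := metric_triangle (g x) x q.
  rewrite -/(disp x g) in s1; rewrite (metric_sym (g x) x) -/(disp x g) /q isom_dist -/(disp x (f ^+ m)%g) in s2.
  by rewrite (metric_sym q x) -/q in s1; lra.
have pz : gp p x (z n) <= tau.
  by move: h1; rewrite /busemann_at /gp -/p (metric_sym p x) /disp -/p; lra.
have qz : gp q x (z n) <= tau + 4.
  rewrite leNgt; apply/negP => lt.
  pose T := Num.min (gp q x (z n)) (tau + 5).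
  have T1 : T <= gp q (g x) x by apply: le_trans (_ : tau + 5 <= _); rewrite ?ge_min ?lexx ?orbT // gp_sym.
  have T2 : T <= gp q x (z n) by rewrite ge_min lexx.
  have T3 : tau + 4 < T by rewrite lt_min lt; lra.
  by have := gp_hyperbolic CAT T1 T2; rewrite E; lra.
have dE : disp x ((f ^+ m)^-1 * g * f ^+ m)%g = mdist p q.
  by rewrite /disp -(isom_dist (f ^+ m)%g) /= isomKV.
have pqz : exists T, [/\ T <= gp x p (z n), T <= gp x (z n) q &
    T = gp x p (z n) \/ T = gp x (z n) q].
  exists (Num.min (gp x p (z n)) (gp x (z n) q)); rewrite !ge_min !lexx orbT; split=> //.
  by rewrite /Num.min; case: ifP; [left|right].
case: pqz => T [T1 T2 T3]; have h4 := gp_hyperbolic CAT T1 T2.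
rewrite dE; move: h1 h2 h3 bm gK qz h4; rewrite /busemann_at !ler_norml -/p.
rewrite [(g * _)%g x]/(g p) -/q /disp -/p => h1 /andP[h2 h2'] /andP[h3 h3'] /andP[b1 b2] /andP[g1 g2].
case: T3 => ->; rewrite /gp ?(metric_sym q x) ?(metric_sym (z n) q); lra.
Qed.

Lemma level_finite K1 : finite_set [set g | Gam g /\ `|busemann g| <= K1].
Proof.
have fin := finite_orbit_ball cE (2 * tau + K1 + 18).
apply: (@finite_bounded_lists _ _ (size (fset_set [set g | Gam g /\ disp x g <= 2 * tau + K1 + 18]))).
move=> l ul lS.
have [m Hm] : exists m, forall g, g \in l -> disp x ((f ^+ m)^-1 * g * f ^+ m)%g <= 2 * tau + K1 + 18.
  suff [m0 H] : exists m0, forall m, (m0 <= m)%N -> forall g, g \in l ->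
      disp x ((f ^+ m)^-1 * g * f ^+ m)%g <= 2 * tau + K1 + 18 by exists m0; exact: H.
  elim: l lS {ul} => [|a l IH] lS; first by exists 0%N.
  have [m1 H1] := IH (fun g gl => lS g (mem_behead (s := a :: l) gl)).
  have [Ga aK] := lS a (mem_head _ _); have [m2 H2] := conjugate_bounded Ga aK.
  exists (maxn m1 m2) => m; rewrite geq_max => /andP[mm1 mm2] g.
  by rewrite inE => /predU1P[->|gl]; [exact: H2 | exact: H1].
pose c g := ((f ^+ m)^-1 * g * f ^+ m)%g.
rewrite -(size_map c); apply: uniq_leq_size.
  by rewrite map_inj_uniq // => g h /mulIg /mulgI.
move=> _ /mapP[g gl ->]; rewrite -[_ \in _]/(c g \in fset_set _) in_fset_set // mem_set //.
have [Gg _] := lS g gl; split; last exact: Hm.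
case: Gsub => _ GM GV; apply: (GM); last exact: Gpow.
by apply: GM => //; apply: GV; exact: Gpow.
Qed.

Let K1 := disp x f + 20.

Lemma level_shift (v : R) : exists c, Gam c /\ forall g, Gam g -> v <= busemann g -> busemann g <= v + 1 ->
  `|busemann (g * c)%g| <= K1.
Proof.
have step h m : (h = f \/ h = e) -> `|busemann (h ^+ m.+1)%g - busemann (h ^+ m)%g| <= disp x f + 4.
  move=> hfe.
  have s : `|busemann (h ^+ m.+1)%g - busemann (h ^+ m)%g - busemann h| <= 4.
    by case: hfe => ->; [exact: busemann_pow_step | exact: busemann_epow_step].
  have bh : `|busemann h| <= disp x f.
    by apply: le_trans (busemann_norm h) _; case: hfe => ->; rewrite // /e dispV.
  by have := ler_normD (busemann (h ^+ m.+1)%g - busemann (h ^+ m)%g - busemann h) (busemann h); rewrite subrK; lra.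
have [c [Gc cv]] : exists c, Gam c /\ `|busemann c + v| <= disp x f + 5.
  have b1 := busemann1; have df := disp_ge0 x f.
  have [v0|v0] := leP 0 v.
    have ex : exists m, (busemann (f ^+ m)%g <= - v).
      have [m Hm] := nat_above v; exists m; have := busemann_pow_le m; lra.
    have ex' : exists m, `[< busemann (f ^+ m)%g <= - v >] by case: ex => m ?; exists m; apply/asboolP.
    case: (ex_minnP ex') => -[|m] /asboolP hm mmin.
      exists 1%g; split; first by case: Gsub.
      by move: hm b1; rewrite expg0 !ler_norml => hm /andP[? ?]; apply/andP; split; lra.
    exists (f ^+ m.+1)%g; split; first exact: Gpow.
    have hm' : - v < busemann (f ^+ m)%g.
      rewrite ltNge; apply/negP => le; have := mmin m (asboolT le); by rewrite ltnn.
    have := step f m (or_introl erefl); rewrite !ler_norml => /andP[? ?]; apply/andP; split; lra.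
  have ex : exists m, (- v <= busemann (e ^+ m)%g).
    have [m Hm] := nat_above (- v); exists m; have := busemann_epow_ge m; lra.
  have ex' : exists m, `[< - v <= busemann (e ^+ m)%g >] by case: ex => m ?; exists m; apply/asboolP.
  case: (ex_minnP ex') => -[|m] /asboolP hm mmin.
    exists 1%g; split; first by case: Gsub.
    by move: hm b1; rewrite expg0 !ler_norml => hm /andP[? ?]; apply/andP; split; lra.
  exists (e ^+ m.+1)%g; split; first exact: Gpow.
  have hm' : busemann (e ^+ m)%g < - v.
    rewrite ltNge; apply/negP => le; have := mmin m (asboolT le); by rewrite ltnn.
  have := step e m (or_intror erefl); rewrite !ler_norml => /andP[? ?]; apply/andP; split; lra.
exists c; split=> // g Gg vg gv.
have := busemannM Gg Gc; move: cv; rewrite /K1 !ler_norml => /andP[? ?] /andP[? ?]; apply/andP; split; lra.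
Qed.

(** Multiplying by powers of f and of its inverse brings every level of the
   quasi-character into one bounded range, which contains finitely many elements
   by level_finite.  Orbit balls then grow linearly, contradicting
   annulus_growth. *)
Lemma focal_unbounded : 0 < d -> False.
Proof.
move=> d0; pose S0 := fset_set [set g | Gam g /\ `|busemann g| <= K1].
have finS := level_finite K1.
pose M := (size S0)%:R : R.
have s0 : 0 < d / 2 by rewrite divr_gt0.
have sd : d / 2 < d by lra.
pose K := (M + 1) * (5 + 2 / (d / 2)).
have [n [l [_ ul lG]]] := annulus_growth cE K 0 s0 sd.
apply/negP; rewrite -leNgt.
pose ex (k : int) := cid (level_shift k%:~R).
pose c k := projT1 (ex k).
have cP k : Gam (c k) /\ forall g, Gam g -> k%:~R <= busemann g -> busemann g <= k%:~R + 1 ->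
  `|busemann (g * c k)%g| <= K1 by exact: (projT2 (ex k)).
pose lev g : int := Num.floor (busemann g).
have levP g : (lev g)%:~R <= busemann g < (lev g)%:~R + 1.
  by have := floor_itv (busemann g); rewrite intrD.
pose code g := (lev g, (g * c (lev g))%g).
pose target := [seq (k, g) | k <- [seq (i%:Z - n.+2%:Z)%R | i <- iota 0 (2 * n + 4)], g <- enum_fset S0].
have sub : (size l <= size target)%N.
  rewrite -(size_map code); apply: uniq_leq_size.
    rewrite map_inj_uniq // => g h E; have E1 : lev g = lev h := congr1 fst E.
    have E2 : (g * c (lev g) = h * c (lev h))%g := congr1 snd E.
    by move: E2; rewrite E1 => /mulIg.
  move=> _ /mapP[g gl ->]; have [Gg g1 g2] := lG g gl.
  have bg := busemann_norm g; have := levP g => /andP[l1 l2].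
  apply/allpairsP; exists (code g); split=> //=.
    have k1 : - (n.+1)%:Z < lev g + 1.
      rewrite -(ltr_int R) intrN intrD -pmulrn -natr1 /=.
      by move: bg; rewrite ler_norml => /andP[? ?]; lra.
    have k2 : lev g < (n.+1)%:Z.
      by rewrite -(ltr_int R) -pmulrn -natr1; move: bg; rewrite ler_norml => /andP[? ?]; lra.
    by have [i il ->] := int_range k1 k2; apply/mapP; exists i; rewrite ?mem_iota.
  rewrite -[_ \in _]/(_ \in S0) in_fset_set // mem_set //; split.
    by case: Gsub => _ GM _; apply: GM => //; case: (cP (lev g)).
  by have [_ cP'] := cP (lev g); apply: cP' => //; exact: ltW.
rewrite size_allpairs size_map size_iota in sub.
apply: (@le_trans _ _ ((2 * n + 4)%:R * M)); first by rewrite /M -natrM ler_nat.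
have e1 := expR_ge1Dx (d / 2 * n%:R).
have n0 : 0 <= n%:R :> R by exact: ler0n.
have M0 : 0 <= M by exact: ler0n.
rewrite natrD natrM; apply: (@le_trans _ _ (K * (1 + d / 2 * n%:R))); last first.
  by rewrite ler_wpM2l // /K mulr_ge0 ?addr_ge0 // divr_ge0 // ltW.
have -> : K * (1 + d / 2 * n%:R) = (M + 1) * (5 + 2 * n%:R + 2 / (d / 2) + 5 * (d / 2) * n%:R).
  by rewrite /K; field; exact: lt0r_neq0.
have : 0 <= 2 / (d / 2) by rewrite divr_ge0 // ltW.
have : 0 <= 5 * (d / 2) * n%:R by rewrite !mulr_ge0 // ltW.
move: (2 / (d / 2)) (5 * (d / 2) * n%:R) => P Q Q0 P0; nra.
Qed.

End Unbounded.

End Focal.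

(** * Schottky families *)

Lemma pigeonhole_filter (T C : eqType) (f : T -> C) (cs : seq C) (l : seq T) :
  (forall t, t \in l -> f t \in cs) ->
  (size l <= size cs * \max_(c <- cs) size [seq t <- l | f t == c])%N.
Proof.
elim: cs l => [|c cs IH] l H.
  by case: l H => // t l /(_ t (mem_head _ _)).
rewrite big_cons -(count_predC (fun t => f t == c)) -size_filter mulSn leq_add ?leq_maxl //.
rewrite -size_filter; set l' := seq.filter _ _.
have := IH l' (_ : forall t, t \in l' -> f t \in cs).
rewrite (_ : (forall t, t \in l' -> f t \in cs) = True); last first.
  apply/propext; split=> // _ t; rewrite mem_filter /= => /andP[ne /H].
  by rewrite inE (negbTE ne).
move=> /(_ I) le; apply: leq_trans le _; rewrite leq_mul2l; apply/orP; right.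
apply: (@leq_trans (\max_(c0 <- cs) size [seq t <- l | f t == c0])); last exact: leq_maxr.
apply/bigmax_leqP_seq => a acs _.
apply: (@leq_trans (size [seq t <- l | f t == a])); last first.
  by apply: (@leq_bigmax_seq _ cs xpredT (fun c0 => size [seq t <- l | f t == c0])).
rewrite /l' -filter_predI !size_filter; apply: sub_count => t /= /andP[] //.
Qed.

Lemma max_seq_attained (C : eqType) (F : C -> nat) (cs : seq C) :
  (0 < \max_(c <- cs) F c)%N -> exists2 c, c \in cs & F c = \max_(c <- cs) F c.
Proof.
elim: cs => [|a cs IH]; first by rewrite big_nil.
rewrite big_cons; case: (leqP (F a) (\max_(c <- cs) F c)) => h.
  by move=> /IH[c ccs <-]; exists c; rewrite // inE ccs orbT.
by move=> _; exists a; rewrite // mem_head.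
Qed.

Section Schottky.
Variables (R : realType) (X : metricType R) (x : X) (Gam : set (isom X)) (d : R).
Hypothesis proper : proper_space X.
Hypothesis CAT : CATm1 X.
Hypothesis Gsub : is_subgroup Gam.
Hypothesis d0 : 0 < d.
Hypothesis cE : critical_exponent x Gam = d%:E.
Hypothesis ne : non_elementary x Gam.
Local Notation gp := gromov_product.

(** Otherwise there are points z n which all elements of larger and larger
   orbit balls almost fix, as seen from x.  The Busemann quasi-character of this
   direction is either bounded, and there is only one limit point, or
   unbounded, and the orbit grows linearly. *)
Lemma transversality : exists (A : seq (isom X)) (C0 : R),
  (forall a, a \in A -> Gam a) /\ forall y z, exists2 a, a \in A & gp x y (a z) <= C0.
Proof.
apply: contrapT => nex.
pose A (n : nat) := enum_fset (fset_set [set g | Gam g /\ disp x g <= n%:R]).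
have AP n g : g \in A n <-> Gam g /\ disp x g <= n%:R.
  rewrite -[_ \in _]/(g \in fset_set _) in_fset_set; last exact: (finite_orbit_ball cE).
  by split; [move=> /set_mem | move=> ?; exact/mem_set].
have ex (n : nat) : {z : X | forall g, Gam g -> disp x g <= n%:R -> n%:R - 2 <= gp x z (g z)}.
  apply: cid; apply: contrapT => nz; apply: nex; exists (A n), n%:R; split=> [a /AP[]//|y z].
  apply: contrapT => na; apply: nz; exists z => g Gg gn.
  have far a : Gam a -> disp x a <= n%:R -> n%:R <= gp x y (a z).
    by move=> Ga an; rewrite leNgt; apply/negP => lt; apply: na; exists a; [exact/AP | exact: ltW].
  have h1 : n%:R <= gp x y z.
    by apply: (far 1%g); [case: Gsub | rewrite disp1].
  by rewrite gp_sym in h1; exact (gp_hyperbolic CAT h1 (far g Gg gn)).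
pose z n := projT1 (ex n).
have zfix g n : Gam g -> disp x g <= n%:R -> n%:R - 2 <= gp x (z n) (g (z n)).
  by move=> Gg gn; exact: (projT2 (ex n)).
have [U [US UI Une Uor Uge]] := free_ultrafilter.
pose bus := busemann x z US UI Une Uor Uge.
have [[f Gf bf]|nf] := pselect (exists2 f, Gam f & bus f <= - 50).
  exact: (focal_unbounded CAT Gsub cE zfix Gf bf d0).
have lb g : Gam g -> - 50 < bus g.
  by move=> Gg; rewrite ltNge; apply/negP => le; apply: nf; exists g.
have bnd g : Gam g -> `|bus g| <= 54.
  move=> Gg; have GV : Gam (g^-1)%g by case: Gsub => _ _; apply.
  have := busemannM CAT Gsub zfix US UI Une Uor Uge Gg GV; rewrite mulgV.
  have := busemann1 x z US UI Une Uor Uge; rewrite -/bus.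
  have := lb _ Gg; have := lb _ GV; rewrite !ler_norml => l1 l2 /andP[? ?] /andP[? ?].
  by apply/andP; split; lra.
case: ne => xi1 [xi2 [xi3 [L1 L2 _ [n12 _ _]]]]; apply: n12.
exact: (focal_bounded proper CAT bnd).
Qed.

(** The points at distance T from x on geodesics from x lie in a compact
   ball. *)
Lemma direction_net (T : R) : 0 <= T -> exists P : seq X,
  forall y, T <= mdist x y -> exists2 p, p \in P & T - 3 <= gp x y p.
Proof.
move=> T0.
(* Finite lists of centres, ordered by inclusion, form a filter base. *)
pose F : set_system (seq X) := [set S : set (seq X) | exists l0 : seq X, forall l : seq X, {subset l0 <= l} -> S l].
have FF : Filter F.
  split; first by exists [::].
    move=> S1 S2 [l1 H1] [l2 H2]; exists (l1 ++ l2) => l sub; split; [apply: H1|apply: H2];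
      by move=> y yl; apply: sub; rewrite mem_cat yl ?orbT.
  by move=> S1 S2 S12 [l1 H1]; exists l1 => l /H1; exact: S12.
have /compact_near_coveringP cov : compact [set y | mdist x y <= T] by exact: proper.
have [|D HD] := cov _ F (fun l y => exists2 p, p \in l & mdist y p < 1) FF.
  move=> y _; exists ([set y' | mdist y' y < 1], [set l : seq X | y \in l]); last by move=> [y' l] /= [? ?]; exists y.
  split=> /=; last by exists [:: y] => l; apply; rewrite mem_head.
  apply: (filterS _ (nbhsx_ballx y 1 ltr01)) => y'; rewrite ballEmdist /=.
  by rewrite metric_sym.
exists D => y Ty; have [c gc] := CAT.1 x y.
have [c0 c1 cd] := gc.
have uT : mdist x (c T) = T.
  by rewrite -{1}c0 cd ?lexx ?T0 ?mdist_ge0 // sub0r normrN ger0_norm.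
have [p pD pc] : exists2 p, p \in D & mdist (c T) p < 1 by apply: (HD D) => //=; rewrite uT.
exists p => //.
have g1 : T <= gp x y (c T).
  have yc : mdist y (c T) = mdist x y - T.
    by rewrite metric_sym -{1}c1 cd ?T0 ?Ty ?lexx ?mdist_ge0 // distrC ger0_norm // subr_ge0.
  by rewrite /gp uT yc; lra.
have g2 : T - 1 <= gp x (c T) p.
  by have := gp_step x (c T) p; rewrite uT; lra.
have := gp_hyperbolic CAT (_ : T - 1 <= gp x y (c T)) g2; lra.
Qed.

(** Repeatedly keep one element and discard the elements close to it, whose
   number is bounded by the size of an orbit ball. *)
Lemma separated_subset (Dd : R) : exists M : nat, forall l : seq (isom X), uniq l -> (forall g, g \in l -> Gam g) ->
  exists l', [/\ uniq l', {subset l' <= l}, (size l <= M * size l')%N &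
    forall g h, g \in l' -> h \in l' -> g <> h -> Dd < mdist (g x) (h x)].
Proof.
pose Bl := fset_set [set g | Gam g /\ disp x g <= Dd].
exists (size Bl).+1 => l.
have [n] := ubnP (size l); elim: n l => // n IH [|g l] sz ul lG; first by exists [::].
pose near := [seq h : isom X <- l | mdist (g x) (h x) <= Dd].
pose far := [seq h : isom X <- l | ~~ (mdist (g x) (h x) <= Dd)].
have [|||l' [ul' sub szl sep]] := IH far.
- by rewrite size_filter (leq_ltn_trans (count_size _ _)).
- by apply: filter_uniq; case/andP: ul.
- by move=> h; rewrite mem_filter => /andP[_ hl]; apply: lG; rewrite inE hl orbT.
have subf h : h \in l' -> Dd < mdist (g x) (h x) /\ h \in l.
  by move=> /sub; rewrite mem_filter -ltNge => /andP.
exists (g :: l'); split.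
- rewrite /= ul' andbT; apply/negP => /subf[_ gl]; case/andP: ul; by rewrite gl.
- by move=> h; rewrite !inE => /predU1P[->|/subf[_ ->]]; rewrite ?eqxx ?orbT.
- have szn : (size near <= size Bl)%N.
    rewrite -(size_map (fun h => g^-1 * h)%g); apply: uniq_leq_size.
      rewrite map_inj_uniq ?filter_uniq //; last by move=> a b /mulgI.
      by case/andP: ul.
    move=> _ /mapP[h + ->]; rewrite mem_filter => /andP[gh hl].
    rewrite -[_ \in _]/(_ \in fset_set _) in_fset_set; last exact: (finite_orbit_ball cE).
    apply/mem_set; split; last by rewrite -dist_disp.
    case: Gsub => _ GM GV; apply: GM; last by apply: lG; rewrite inE hl orbT.
    by apply: GV; apply: lG; rewrite mem_head.
  have szE : (size near + size far = size l)%N by rewrite !size_filter count_predC.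
  by rewrite /= mulnS -szE addSn ltnS leq_add.
- move=> a b; rewrite !inE => /predU1P[->|al] /predU1P[->|bl] ab //.
  + by case: (subf b bl).
  + by rewrite metric_sym; case: (subf a al).
  + exact: sep.
Qed.

(** In a heavy annulus, pigeonhole the directions of gx and of g^-1 x, and
   keep a separated subset.  Its elements have one common direction of gx and
   one of g^-1 x; multiplying on the left by an element a given by
   transversality separates these two directions, and changes the other
   quantities by a bounded amount. *)
Theorem schottky_family (s : R) : 0 < s -> s < d -> exists (F : seq (isom X)) (Lb C1 : R),
  [/\ uniq F, forall g, g \in F -> Gam g, expR (s * Lb) <= (size F)%:R, 2 <= C1 &
  [/\ forall g, g \in F -> 2 * C1 + 1 <= disp x g <= Lb,
      forall g h, g \in F -> h \in F -> gp x ((g^-1)%g x) (h x) <= C1 - 2 &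
      forall g h, g \in F -> h \in F -> g <> h -> gp x (g x) (h x) <= disp x g - C1 - 5]].
Proof.
move=> s0 sd; have [A [C0 [AG AC]]] := transversality.
have C00 : 0 <= C0 by have [a _] := AC x x; apply: le_trans; exact: gp_ge0.
pose am := \sum_(a <- A) disp x a.
have am0 : 0 <= am by apply: sumr_ge0 => a _; exact: disp_ge0.
have amP a : a \in A -> disp x a <= am.
  by move=> aA; rewrite /am (big_rem a) //= lerDl sumr_ge0 // => h _; exact: disp_ge0.
pose T := C0 + 10 + am.
have T0 : 0 <= T by rewrite !addr_ge0.
have [P HP] := direction_net T0.
pose C1 := C0 + 8.
pose Dd := 2 * (2 * am + 1 + C1 + 5).
have [M HM] := separated_subset Dd.
pose NP := (size P * size P)%N.
pose K := (NP * M)%:R * expR (s * (1 + am)).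
have [n0 Hn0] := nat_above (T + 2 * C1 + 1 + am + C0 + 7).
have [n [l [nn ul lG lsz]]] := annulus_growth cE K n0 s0 sd.
have nbig : T + 2 * C1 + 1 + am + C0 + 7 <= n%:R by apply: le_trans Hn0 _; rewrite ler_nat.
have GV g : Gam g -> Gam (g^-1)%g by case: Gsub => _ _; apply.
have GM g h : Gam g -> Gam h -> Gam (g * h)%g by case: Gsub => _ + _; apply.
have ex (y : X) : {p | T <= mdist x y -> p \in P /\ T - 3 <= gp x y p}.
  apply: cid; have [Ty|Ty] := leP T (mdist x y); last by exists x.
  by have [p pP h] := HP y Ty; exists p.
pose dir y := projT1 (ex y).
have dirP y : T <= mdist x y -> dir y \in P /\ T - 3 <= gp x y (dir y) by exact: (projT2 (ex y)).
pose cls (g : isom X) := (dir (g x), dir ((g^-1)%g x)).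
have Tg g : g \in l -> T <= mdist x (g x) /\ T <= mdist x ((g^-1)%g x).
  move=> gl; have [_ g1 _] := lG g gl.
  have -> : mdist x ((g^-1)%g x) = mdist x (g x) by exact: dispV.
  by rewrite -/(disp x g); split; rewrite /C1 in nbig; lra.
have clsP g : g \in l -> cls g \in [seq (p, q) | p <- P, q <- P].
  move=> /Tg[t1 t2]; apply/allpairsP; exists (cls g) => /=.
  by have [? _] := dirP _ t1; have [? _] := dirP _ t2.
have := pigeonhole_filter clsP; rewrite size_allpairs -/NP.
set mx := \max_(c <- _) _ => lmx.
have lpos : 0 < (size l)%:R :> R.
  by apply: le_lt_trans lsz; rewrite mulr_ge0 ?expR_ge0 // /K mulr_ge0 ?expR_ge0.
have mx0 : (0 < mx)%N.
  by rewrite lt0n; apply/eqP => m0; move: lmx lpos; rewrite m0 muln0 leqn0 => /eqP ->; rewrite ltxx.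
have [c _ cmx] := max_seq_attained mx0.
set lc := [seq t <- l | cls t == c] in cmx; rewrite -/mx in cmx; rewrite -cmx in lmx mx0.
have lcP g : g \in lc -> g \in l /\ cls g = c by rewrite mem_filter => /andP[/eqP].
have same y y' : T <= mdist x y -> T <= mdist x y' -> dir y = dir y' -> T - 5 <= gp x y y'.
  move=> ty ty' e; have [_ h1] := dirP y ty; have [_ h2] := dirP y' ty'.
  by rewrite -e gp_sym in h2; have := gp_hyperbolic CAT h1 h2; lra.
have same1 g h : g \in lc -> h \in lc -> T - 5 <= gp x (g x) (h x) /\ T - 5 <= gp x ((g^-1)%g x) ((h^-1)%g x).
  move=> /lcP[gl gc] /lcP[hl hc]; have [g1 g2] := Tg g gl; have [h1 h2] := Tg h hl.
  have E : cls g = cls h by rewrite gc hc.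
  by split; apply: same => //; [exact: (congr1 fst E) | exact: (congr1 snd E)].
have [g0 g0lc] : exists g0, g0 \in lc.
  by case: (lc) mx0 => // a m _; exists a; rewrite mem_head.
have [a aA aC] := AC ((g0^-1)%g x) (g0 x).
have Ga := AG a aA; have aam := amP a aA.
have [|g glc|F0 [uF sF szF sepF]] := HM lc.
- exact: filter_uniq.
- by have [gl _] := lcP g glc; case: (lG g gl).
have inl g : g \in F0 -> g \in lc /\ [/\ Gam g, n%:R <= disp x g & disp x g < n%:R + 1].
  by move=> /sF glc; split=> //; have [gl _] := lcP g glc; exact: lG.
have lenag g : g \in F0 -> n%:R - am <= disp x (a * g)%g <= n%:R + 1 + am.
  move=> /inl[_ [_ g1 g2]]; have h1 := dispM x a g; have h2 := dispM x (a^-1)%g (a * g)%g.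
  by rewrite mulKg dispV in h2; apply/andP; split; lra.
have cross g h : g \in lc -> h \in lc -> gp x ((g^-1)%g x) (a (h x)) <= C0 + 4.
  move=> glc hlc; rewrite leNgt; apply/negP => lt.
  have [_ k1] := same1 g0 g g0lc glc; have [k2 _] := same1 h g0 hlc g0lc.
  have k3 : T - 5 - am <= gp x (a (h x)) (a (g0 x)).
    have := gp_move_base ((a^-1)%g x) x (h x) (g0 x); rewrite -(gp_isom a) isomKV.
    have := gp_move_base x ((a^-1)%g x) (h x) (g0 x).
    rewrite -/(disp x (a^-1)%g) dispV -(gp_isom a ((a^-1)%g x)) isomKV; lra.
  pose S := Num.min (C0 + 5) (gp x ((g^-1)%g x) (a (h x))).
  have S1 : C0 + 4 < S by rewrite lt_min lt andbT; lra.
  have S2 : S <= gp x ((g0^-1)%g x) ((g^-1)%g x).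
    by apply: le_trans (_ : C0 + 5 <= _); [rewrite ge_min lexx | rewrite /T in k1; lra].
  have S3 : S <= gp x ((g^-1)%g x) (a (h x)) by rewrite ge_min lexx orbT.
  have S4 : S <= gp x (a (h x)) (a (g0 x)).
    by apply: le_trans (_ : C0 + 5 <= _); [rewrite ge_min lexx | rewrite /T in k3; lra].
  by have := gp_hyperbolic3 CAT S2 S3 S4; lra.
exists (map (fun g => a * g)%g F0), (n%:R + 1 + am), C1; split.
- by rewrite map_inj_uniq // => g h /mulgI.
- by move=> _ /mapP[g /inl[_ [Gg _ _]] ->]; exact: GM.
- rewrite size_map.
  have szl : (size l)%:R <= (NP * M)%:R * (size F0)%:R :> R.
    rewrite -natrM ler_nat -mulnA; apply: leq_trans lmx _.
    by rewrite leq_mul2l szF orbT.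
  have := lt_le_trans lsz szl; rewrite /K -mulrA -expRD.
  have [->|nz] := eqVneq (NP * M)%N 0%N; first by rewrite !mul0r ltxx.
  rewrite ltr_pM2l ?ltr0n ?lt0n // => /ltW; congr (expR _ <= _); ring.
- by rewrite /C1; lra.
split.
- move=> _ /mapP[g gF ->]; case/andP: (lenag g gF) => h1 h2.
  by apply/andP; split=> //; rewrite /T in nbig; lra.
- move=> _ _ /mapP[g gF ->] /mapP[h hF ->].
  have [glc [Gg g1 _]] := inl g gF; have [hlc _] := inl h hF.
  rewrite leNgt; apply/negP => lt; rewrite /C1 in lt.
  have k1 : C0 + 7 <= gp x ((g^-1)%g x) (((a * g)^-1)%g x).
    have := gp_step x ((g^-1)%g x) (((a * g)^-1)%g x).
    have -> : mdist ((g^-1)%g x) (((a * g)^-1)%g x) = disp x a.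
      by rewrite invgM -[((g^-1 * a^-1)%g x)]/((g^-1)%g ((a^-1)%g x)) isom_dist -/(disp x (a^-1)%g) dispV.
    rewrite -/(disp x (g^-1)%g) dispV => st.
    by rewrite /T /C1 in nbig; lra.
  pose S := Num.min (C0 + 7) (gp x (((a * g)^-1)%g x) ((a * h)%g x)).
  have S1 : C0 + 6 < S.
    rewrite lt_min; apply/andP; split; first lra.
    by apply: le_lt_trans lt; lra.
  have S2 : S <= gp x ((g^-1)%g x) (((a * g)^-1)%g x) by apply: le_trans k1; rewrite ge_min lexx.
  have S3 : S <= gp x (((a * g)^-1)%g x) ((a * h)%g x) by rewrite ge_min lexx orbT.
  by have := gp_hyperbolic CAT S2 S3; have := cross g h glc hlc; rewrite /=; lra.
- move=> _ _ /mapP[g gF ->] /mapP[h hF ->] agh.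
  have gh : g <> h by move=> E; apply: agh; rewrite E.
  have sep := sepF g h gF hF gh.
  case/andP: (lenag g gF) => k1 k2; case/andP: (lenag h hF) => k3 k4.
  have E : mdist ((a * g)%g x) ((a * h)%g x) = mdist (g x) (h x) by rewrite /= isom_dist.
  move: k1 k2 k3 k4 sep; rewrite /Dd /gp E -/(disp x (a * g)%g) -/(disp x (a * h)%g); lra.
Qed.

End Schottky.

(** * Mass distribution on infinite words *)

Lemma infinite_word (T : eqType) (F : seq T) (P : seq T -> Prop) : P [::] ->
  (forall v, P v -> exists2 g, g \in F & P (rcons v g)) ->
  exists2 w : nat -> T, (forall n, w n \in F) & forall n, P (mkseq w n).
Proof.
move=> P0 PS.
have ex (v : {v | P v}) : {g | g \in F /\ P (rcons (projT1 v) g)}.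
  by apply: cid; case: v => v Pv; have [g gF Pg] := PS v Pv; exists g.
pose nxt (v : {v | P v}) : {v | P v} := exist _ _ (proj2 (projT2 (ex v))).
pose pre n := iter n nxt (exist _ _ P0).
exists (fun n => projT1 (ex (pre n))) => n; first by case: (projT2 (ex (pre n))).
have -> : mkseq (fun n => projT1 (ex (pre n))) n = projT1 (pre n).
  by elim: n => // n IH; rewrite mkseqS IH.
exact: projT2.
Qed.

Lemma pow_half_sum (R : realType) (l : seq nat) : uniq l -> \sum_(n <- l) (2 : R) ^- n.+2 <= 1 / 2.
Proof.
move=> ul; have [m lm] : exists m, {subset l <= iota 0 m}.
  exists (\max_(n <- l) n).+1 => n nl; rewrite mem_iota /= add0n ltnS.
  exact: (@leq_bigmax_seq _ l xpredT id n nl).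
have h m0 : \sum_(n <- iota 0 m0) (2 : R) ^- n.+2 = 1 / 2 - 2 ^- m0.+1.
  elim: m0 => [|k IH]; first by rewrite big_nil expr1; lra.
  rewrite -addn1 iotaD big_cat /= big_seq1 add0n IH addn1.
  have : (2 : R) ^+ k != 0 by rewrite expf_neq0.
  rewrite !exprS => nz; field; exact: nz.
apply: (@le_trans _ _ (\sum_(n <- iota 0 m) (2 : R) ^- n.+2)); last first.
  by rewrite h gerBl invr_ge0 exprn_ge0.
have E : perm_eq (iota 0 m) (l ++ [seq n <- iota 0 m | n \notin l]).
  apply: uniq_perm; rewrite ?iota_uniq // ?cat_uniq ?ul ?filter_uniq ?iota_uniq //=.
    by rewrite andbT; apply/hasPn => n; rewrite mem_filter => /andP[].
  move=> n; rewrite mem_cat mem_filter; case: (boolP (n \in l)) => //= /lm -> //.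
rewrite (perm_big _ E) big_cat /= lerDl; apply: sumr_ge0 => n _; by rewrite invr_ge0 exprn_ge0.
Qed.

Section MassDistribution.
Variables (R : realType) (B : Type) (rho : B -> B -> R) (Lam : set B).
Variables (T : choiceType) (F : seq T) (xi : (nat -> T) -> B) (L s : R).
Definition letters_in (w : nat -> T) := forall n, w n \in F.
Hypothesis s0 : 0 < s.
Hypothesis uF : uniq F.
Hypothesis F2 : (1 < size F)%N.
Hypothesis FL : expR (s * L) <= (size F)%:R.
Hypothesis xiL : forall w, letters_in w -> Lam (xi w).
Hypothesis sep : forall w w' k, letters_in w -> letters_in w' -> mkseq w k = mkseq w' k -> w k <> w' k ->
  expR (- (k.+1%:R * L + 4)) <= rho (xi w) (xi w').
Let N : R := (size F)%:R.
Let N0 : 0 < N. Proof. by rewrite ltr0n (ltn_trans _ F2). Qed.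
Let g0 : {g | g \in F}.
Proof. by case: F F2 => // a l _; exists a; rewrite mem_head. Qed.

(** Let u be the longest prefix common to all words whose points lie in U:
   where two of these words diverge, the distance of their points bounds D from
   below.  The term 2 ^- n.+2 accounts for the case of at most one word, where
   the prefix may be taken as long as one likes. *)
Lemma cover_prefix (U : set B) (D : R) (n : nat) : 0 <= D -> (forall a b, U a -> U b -> rho a b <= D) ->
  exists u : seq T, (forall w, letters_in w -> U (xi w) -> mkseq w (size u) = u) /\
    N ^- (size u) <= 2 ^- n.+2 + expR (s * (L + 4)) * D `^ s.
Proof.
move=> D0 HD.
have CD : 0 <= expR (s * (L + 4)) * D `^ s by rewrite mulr_ge0 ?expR_ge0 ?powR_ge0.
have small : N ^- n.+2 <= 2 ^- n.+2 + expR (s * (L + 4)) * D `^ s.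
  rewrite -[leLHS]addr0 lerD // lef_pV2 ?posrE ?exprn_gt0 // lerXn2r ?nnegrE ?(ltW N0) //.
  by rewrite /N ler_nat.
have [[w0 [W0 U0]]|none] := pselect (exists w, letters_in w /\ U (xi w)); last first.
  exists (mkseq (fun _ => projT1 g0) n.+2); rewrite size_mkseq; split=> // w Ww Uw.
  by case: none; exists w.
have [[k [w [Ww Uw wk]]]|agree] :=
    pselect (exists k w, [/\ letters_in w, U (xi w) & w k <> w0 k]); last first.
  exists (mkseq w0 n.+2); rewrite size_mkseq; split=> // w Ww Uw.
  apply: eq_mkseq => k; apply: contrapT => wk; apply: agree; by exists k, w.
pose P k := `[< exists w, [/\ letters_in w, U (xi w) & w k <> w0 k] >].
have exP : exists k, P k by exists k; apply: asboolT; exists w.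
case: (ex_minnP exP) => {w Ww Uw wk}k' /asboolP[w [Ww Uw wk]] kmin.
have ag w1 : letters_in w1 -> U (xi w1) -> mkseq w1 k' = mkseq w0 k'.
  move=> W1 U1; apply/eq_in_map => i; rewrite mem_iota add0n /= => ik.
  apply: contrapT => ne; have := kmin i; rewrite leqNgt ik /= => H.
  by have := H (asboolT (ex_intro _ w1 (And3 W1 U1 ne))).
exists (mkseq w0 k'); rewrite size_mkseq; split; first exact: ag.
have h1 : expR (- (k'.+1%:R * L + 4)) <= D.
  by apply: le_trans (sep Ww W0 (ag w Ww Uw) wk) _; exact: HD.
have h2 : expR (- (k'.+1%:R * L + 4) * s) <= D `^ s.
  rewrite expRM; apply: ge0_ler_powR => //; rewrite ?nnegrE ?expR_ge0 //; exact: ltW.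
have h3 : N ^- k' <= expR (s * (L + 4)) * D `^ s.
  apply: (@le_trans _ _ (expR (s * (L + 4)) * expR (- (k'.+1%:R * L + 4) * s))); last first.
    by rewrite ler_pM2l ?expR_gt0.
  rewrite -expRD (_ : _ + _ = - (s * L *+ k')); last by rewrite -mulr_natr -natr1; ring.
  rewrite expRN lef_pV2 ?posrE ?exprn_gt0 ?expR_gt0 // -mulr_natl expRM_natl.
  by rewrite lerXn2r ?nnegrE ?expR_ge0 // ltW.
by rewrite -[leLHS]add0r lerD // invr_ge0 exprn_ge0.
Qed.

(** The mass below a prefix is at least the sum of the masses below its
   extensions by one letter.  So a prefix v of mass less than N ^- size v has
   an extension with the same property, and in the infinite word built in this
   way no prefix is one of the u n. *)
Lemma uncovered_word (u : nat -> seq T) :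
  (forall l, uniq l -> \sum_(n <- l) N ^- (size (u n)) <= 3 / 4) ->
  exists2 w, letters_in w & forall n, mkseq w (size (u n)) <> u n.
Proof.
move=> Hu.
pose mu v n : R := if prefix v (u n) then N ^- (size (u n)) else 0.
have mu0 v n : 0 <= mu v n by rewrite /mu; case: ifP => // _; rewrite invr_ge0 exprn_ge0 // ltW.
pose mass v := (\esum_(n in setT) (mu v n)%:E)%E.
have muS v n : \sum_(g <- F) mu (rcons v g) n <= mu v n.
  case: (boolP (has (fun g => prefix (rcons v g) (u n)) F)) => [/hasP[g gF pg]|/hasPn no]; last first.
    by rewrite big_seq big1 // => g /no /negbTE pg; rewrite /mu pg.
  rewrite (bigD1_seq g) //= big1 ?addr0 => [|h hg].
    have pv : prefix v (u n) by move: pg; rewrite -cats1; exact: catl_prefix.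
    by rewrite /mu pg pv.
  rewrite /mu; case: ifP => // ph; case/eqP: hg.
  move: pg ph => /prefixP[a ->] /prefixP[b] /eqP.
  by rewrite !cat_rcons eqseq_cat // => /andP[_ /eqP[]].
have [|v Pv|w wF Pw] := @infinite_word T F (fun v => (mass v < (N ^- size v)%:E)%E).
- rewrite /= invr1; apply: le_lt_trans (_ : ((3 / 4)%:E < _)%E); last by rewrite lte_fin; lra.
  apply: esum_le_seq => l ul _; apply: le_trans (Hu l ul); apply: ler_sum => n _.
  by rewrite /mu prefix0s.
- apply: contrapT => no.
  have := Pv; rewrite ltNge => /negP; apply.
  apply: (@le_trans _ _ (\sum_(g <- F) mass (rcons v g))%E).
    apply: (@le_trans _ _ (\sum_(g <- F) (N ^- (size v).+1)%:E)%E).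
      rewrite sumEFin lee_fin big_const_seq count_predT iter_addr_0 -mulr_natl exprS invfM.
      by rewrite mulrA mulfV ?mul1r // gt_eqF.
    rewrite big_seq [leRHS]big_seq; apply: lee_sum => g gF.
    by rewrite leNgt; apply/negP => lt; apply: no; exists g; rewrite // size_rcons.
  rewrite /mass -esum_sum; last by move=> n g _ _; rewrite lee_fin.
  by apply: le_esum => n _; rewrite sumEFin lee_fin.
exists w => // n E.
have := Pw (size (u n)); rewrite size_mkseq E ltNge => /negP; apply.
have := @seq_le_esum R nat setT (mu (u n)) [:: n] isT (fun _ _ => I).
have E1 : mu (u n) n = N ^- size (u n) by rewrite /mu prefix_refl.
by rewrite big_seq1 E1.
Qed.

(** A cover with a small sum of s-th powers would give prefixes of total mass
   less than one. *)
Lemma mass_distribution : hausdorff_measure rho s Lam <> 0%E.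
Proof.
move=> H0.
pose C := expR (s * (L + 4)).
have C0 : 0 < C by exact: expR_gt0.
pose c := C^-1 / 4.
have c0 : 0 < c by rewrite divr_gt0 ?invr_gt0.
have : (hausdorff_content rho s 1 Lam < c%:E)%E.
  apply: (@le_lt_trans _ _ 0%E); last by rewrite lte_fin.
  by rewrite -H0; apply: ereal_sup_ubound; exists 1 => //; exact: ltr01.
move=> /ereal_inf_lt[_ [U [LU U1 ->]] lt].
pose D n := fine (diameter rho (U n)).
have DE n : diameter rho (U n) = (D n)%:E.
  rewrite /D fineK // ge0_fin_numE ?diameter_ge0 //.
  by apply: le_lt_trans (U1 n) _; rewrite ltry.
have D0 n : 0 <= D n by rewrite -lee_fin -DE diameter_ge0.
have HD n a b : U n a -> U n b -> rho a b <= D n.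
  move=> Ua Ub; rewrite -lee_fin -DE; apply: ereal_sup_ubound; right; by exists a, b.
have ex n := cid (@cover_prefix (U n) (D n) n (D0 n) (HD n)).
pose u n := projT1 (ex n).
have [|w Ww wu] := @uncovered_word u.
  move=> l ul.
  apply: (@le_trans _ _ (\sum_(n <- l) (2 ^- n.+2 + C * D n `^ s))).
    by apply: ler_sum => n _; case: (projT2 (ex n)).
  rewrite big_split /= -mulr_sumr.
  have k1 := pow_half_sum R ul.
  have k2 : \sum_(n <- l) D n `^ s <= c.
    rewrite -lee_fin; apply: le_trans (ltW lt).
    rewrite nneseries_esumT; last by move=> n; exact: poweR_ge0.
    under eq_esum do rewrite DE poweR_EFin.
    exact: seq_le_esum.
  have k3 : C * \sum_(n <- l) D n `^ s <= 1 / 4.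
    rewrite -(ler_pM2l C0) in k2; apply: le_trans k2 _.
    by rewrite /c mulrA mulfV ?gt_eqF.
  lra.
have : Lam (xi w) by exact: xiL.
rewrite LU => -[n _ Un]; apply: (wu n).
by have [h _] := projT2 (ex n); exact: h.
Qed.

End MassDistribution.

(** * The Cantor set of a Schottky family *)

Section Cantor.
Variables (R : realType) (X : metricType R) (x : X).
Hypothesis CAT : CATm1 X.
Variables (F : seq (isom X)) (Lb C1 : R).
Hypothesis C12 : 2 <= C1.
Hypothesis lenF : forall g : isom X, g \in F -> 2 * C1 + 1 <= disp x g <= Lb.
Hypothesis crossF : forall g h : isom X, g \in F -> h \in F ->
  gromov_product x ((g^-1)%g x) (h x) <= C1 - 2.
Hypothesis sepF : forall g h : isom X, g \in F -> h \in F -> g <> h ->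
  gromov_product x (g x) (h x) <= disp x g - C1 - 5.
Local Notation gp := gromov_product.
Local Notation pt u := (word_prod (u : seq (isom X)) x).

Lemma gp_base_change (g : isom X) (p q : X) :
  gp x (g p) (g q) = disp x g + gp x p q - gp (g x) x (g p) - gp (g x) x (g q).
Proof.
rewrite -(gp_isom g x p q) /gp /disp (metric_sym (g x) x); lra.
Qed.

(** A word starting with g stays behind g, seen from x: otherwise the word
   with g removed would be seen in the direction of g^-1 x, whereas by
   induction it is seen in the direction of its own first letter. *)
Lemma word_shadow (u : seq (isom X)) (g : isom X) : {subset g :: u <= F} -> gp (g x) x (pt (g :: u)) <= C1.
Proof.
elim: u g => [|h u IH] g sub.
  rewrite -[pt _]/(g x) gp_sym; apply: le_trans (gp_le_l _ _ _) _; rewrite mdistxx; have := C12; lra.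
have gF : g \in F by apply: sub; rewrite mem_head.
have hF : h \in F by apply: sub; rewrite !inE eqxx orbT.
have {}IH := IH h (fun a ha => sub a (@mem_behead _ [:: g, h & u] a ha)).
set z := pt (h :: u) in IH *.
rewrite -[pt (g :: _)]/(g z) -{2}(isomKV g x) gp_isom leNgt; apply/negP => lt.
have hz : C1 + 1 <= gp x z (h x).
  case/andP: (lenF hF) => h1 h2; move: IH h1; rewrite /gp /disp (metric_sym (h x) x) (metric_sym z); lra.
pose S := Num.min (C1 + 1) (gp x ((g^-1)%g x) z).
have S1 : C1 < S by rewrite lt_min lt andbT ltrDl ltr01.
have S2 : S <= gp x ((g^-1)%g x) z by rewrite ge_min lexx orbT.
have S3 : S <= gp x z (h x) by apply: le_trans hz; rewrite ge_min lexx.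
by have := gp_hyperbolic CAT S2 S3; have := crossF gF hF; lra.
Qed.

Lemma shadow_gp (u : seq (isom X)) (g : isom X) : {subset g :: u <= F} ->
  disp x g - C1 <= gp x (g x) (pt (g :: u)).
Proof.
move=> /word_shadow; rewrite /gp /disp (metric_sym (g x) x); lra.
Qed.

Lemma word_gp_ge (u v v' : seq (isom X)) : {subset u ++ v <= F} -> {subset u ++ v' <= F} ->
  (size u)%:R <= gp x (pt (u ++ v)) (pt (u ++ v')).
Proof.
elim: u => [|g u IH] sub sub'; first exact: gp_ge0.
have /IH {}IH : {subset u ++ v <= F} by move=> a au; apply: sub; exact: mem_behead.
have {}IH : (size u)%:R <= gp x (pt (u ++ v)) (pt (u ++ v')).
  by apply: IH => a au; apply: sub'; exact: mem_behead.
have h1 := word_shadow sub; have h2 := word_shadow sub'.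
have gF : g \in F by apply: sub; exact: mem_head.
case/andP: (lenF gF) => h3 h4.
rewrite -[pt ((g :: u) ++ v)]/(g (pt (u ++ v))) in h1 *.
rewrite -[pt ((g :: u) ++ v')]/(g (pt (u ++ v'))) in h2 *.
rewrite gp_base_change /= -natr1; lra.
Qed.

Lemma word_gp_le (u v v' : seq (isom X)) : {subset u <= F} ->
  gp x (pt (u ++ v)) (pt (u ++ v')) <= (size u)%:R * Lb + gp x (pt v) (pt v').
Proof.
elim: u => [|g u IH] sub; first by rewrite mul0r add0r.
have {}IH := IH (fun a au => sub a (@mem_behead _ (g :: u) a au)).
case/andP: (lenF (sub g (mem_head _ _))) => h3 h4.
have := gp_ge0 (g x) x (g (pt (u ++ v))); have := gp_ge0 (g x) x (g (pt (u ++ v'))).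
rewrite -[pt ((g :: u) ++ v)]/(g (pt (u ++ v))) -[pt ((g :: u) ++ v')]/(g (pt (u ++ v'))).
rewrite gp_base_change /= -natr1; lra.
Qed.

(** The two words are seen in the directions of g x and h x, which are
   apart. *)
Lemma first_letters_differ (v v' : seq (isom X)) (g h : isom X) :
  {subset g :: v <= F} -> {subset h :: v' <= F} -> g <> h ->
  gp x (pt (g :: v)) (pt (h :: v')) <= Lb.
Proof.
move=> sub sub' gh.
have gF := sub g (mem_head _ _); have hF := sub' h (mem_head _ _).
case/andP: (lenF gF) => g1 g2; case/andP: (lenF hF) => h1 h2.
have s1 := sepF gF hF gh; have s2 := sepF hF gF (fun e => gh (esym e)).
rewrite gp_sym in s2.
have a1 := shadow_gp sub; have a2 := shadow_gp sub'.
rewrite gp_sym in a2.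
rewrite leNgt; apply/negP => lt.
pose S := Num.min (Num.min (disp x g - C1) (disp x h - C1)) (gp x (pt (g :: v)) (pt (h :: v'))).
have S1 : S <= gp x (g x) (pt (g :: v)) by apply: le_trans a1; rewrite !ge_min lexx.
have S2 : S <= gp x (pt (g :: v)) (pt (h :: v')) by rewrite ge_min lexx orbT.
have S3 : S <= gp x (pt (h :: v')) (h x) by apply: le_trans a2; rewrite !ge_min lexx orbT.
have k := gp_hyperbolic3 CAT S1 S2 S3.
have : gp x (g x) (h x) + 4 < S by rewrite !lt_min; apply/andP; split; [apply/andP; split|]; have := C12; lra.
lra.
Qed.

Hypothesis proper : proper_space X.
Variable Gam : set (isom X).
Hypothesis Gsub : is_subgroup Gam.
Hypothesis FG : forall g : isom X, g \in F -> Gam g.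
Let path w n : X := pt (mkseq w n).

Let mkseq_in w n : letters_in F w -> {subset mkseq w n <= F}.
Proof. by move=> W a /mapP[i _ ->]. Qed.

Let split (w : nat -> isom X) k n : (k <= n)%N -> exists v, mkseq w n = mkseq w k ++ v.
Proof.
move=> /subnKC <-; elim: (n - k)%N => [|m [v E]]; first by exists [::]; rewrite addn0 cats0.
by exists (rcons v (w (k + m)%N)); rewrite addnS mkseqS E rcons_cat.
Qed.

Lemma word_limit w : letters_in F w ->
  exists xi, limit_set x Gam xi /\ converges_to_boundary x (path w) xi.
Proof.
move=> W.
have [|xi bxi cxi] := @boundary_of_cauchy R X proper CAT x (path w).
  move=> M; have [k Mk] := nat_above M; exists k => n m kn km; apply: le_trans Mk _.
  have [v E] := split w kn; have [v' E'] := split w km.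
  rewrite /path E E' -{1}(size_mkseq w k); apply: word_gp_ge; rewrite -?E -?E'; exact: mkseq_in.
exists xi; split=> //; split=> //.
exists (fun n => word_prod (mkseq w n)); split=> // n.
have := @mkseq_in w n W; case: Gsub => G1 GM _.
elim: (mkseq w n) => //= g u IH sub; apply: GM; first by apply: FG; apply: sub; exact: mem_head.
by apply: IH => a au; apply: sub; exact: mem_behead.
Qed.

Lemma word_limits_apart w w' k xi eta : letters_in F w -> letters_in F w' ->
  mkseq w k = mkseq w' k -> w k <> w' k -> boundary xi -> boundary eta ->
  converges_to_boundary x (path w) xi -> converges_to_boundary x (path w') eta ->
  expR (- (k.+1%:R * Lb + 4)) <= bourdon_metric x xi eta.
Proof.
move=> W W' E ne bx be cx ce.
apply: (@bourdon_ge_seq R X proper CAT x xi eta (path w) (path w') _ k.+1) => // n m kn km.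
have [v Ev] := split w kn; have [v' Ev'] := split w' km.
have sub := @mkseq_in w n W; have sub' := @mkseq_in w' m W'.
move: Ev Ev'; rewrite /path !mkseqS !cat_rcons -E => Ev Ev'.
rewrite Ev in sub *; rewrite Ev' in sub' *.
apply: le_trans (word_gp_le _ _ (@mkseq_in w k W)) _.
rewrite size_mkseq -natr1 mulrDl mul1r lerD2l; apply: first_letters_differ => //.
- by move=> a av; apply: sub; rewrite mem_cat av orbT.
- by move=> a av; apply: sub'; rewrite mem_cat av orbT.
Qed.

(** Words that diverge at time k have limit points at distance at least about
   exp(-k Lb), while a prefix of length k carries the mass (size F) ^- k, at
   most exp(-s k Lb). *)
Theorem cantor_set_measure (s : R) : 0 < s -> uniq F -> expR (s * Lb) <= (size F)%:R ->
  hausdorff_measure (bourdon_metric x) s (limit_set x Gam) <> 0%E.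
Proof.
move=> s0 uF FL.
have F2 : (1 < size F)%N.
  have F1 : (0 < size F)%N by rewrite -(ltr0n R); apply: lt_le_trans FL; exact: expR_gt0.
  have [g gF] : exists g, g \in F by case: (F) F1 => // a l _; exists a; rewrite mem_head.
  case/andP: (lenF gF) => h1 h2; rewrite -(ltr1n R); apply: lt_le_trans FL.
  by rewrite expR_gt1 mulr_gt0 //; have := C12; lra.
have ex w : {xi | letters_in F w -> limit_set x Gam xi /\ converges_to_boundary x (path w) xi}.
  apply: cid; have [W|nW] := pselect (letters_in F w); last by exists set0.
  by have [xi H] := word_limit W; exists xi.
apply: (@mass_distribution R _ _ _ _ F (fun w => projT1 (ex w)) Lb s) => //.
  by move=> w W; case: (projT2 (ex w) W).
move=> w w' k W W' E ne.
have [[b1 _] c1] := projT2 (ex w) W; have [[b2 _] c2] := projT2 (ex w') W'.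
exact: word_limits_apart c1 c2.
Qed.

End Cantor.

Section LowerBound.
Variables (R : realType) (X : metricType R) (x : X) (Gam : set (isom X)) (d : R).
Hypothesis proper : proper_space X.
Hypothesis CAT : CATm1 X.
Hypothesis Gsub : is_subgroup Gam.
Hypothesis d0 : 0 < d.
Hypothesis cE : critical_exponent x Gam = d%:E.
Hypothesis ne : non_elementary x Gam.

Theorem hausdorff_dim_ge : (d%:E <= hausdorff_dim (bourdon_metric x) (limit_set x Gam))%E.
Proof.
apply: le_ereal_inf_tmp => _ [s [s0 H0] <-]; rewrite lee_fin leNgt; apply/negP => sd.
have [F [Lb [C1 [uF FG FL C12 [lenF crossF sepF]]]]] := schottky_family proper CAT Gsub d0 cE ne s0 sd.
exact: (cantor_set_measure CAT C12 lenF crossF sepF proper Gsub FG s0 uF FL).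
Qed.

End LowerBound.

(** * The inequalities for a hierarchy *)

Theorem corollary10p5 (R : realType) (X : metricType R) (x : X)
    (Gam : set (isom X)) (delta : R) (p r : nat)
    (G : 'I_p -> set (isom X)) (b : 'I_r -> isom X) (hier : hierarchy Gam) :
  proper_space X -> CATm1 X ->
  is_subgroup Gam -> finitely_generated Gam -> discrete_group Gam ->
  0 < delta -> critical_exponent x Gam = delta%:E ->
  (2 <= p + r)%N -> grushko_decomposition G b Gam ->
  grushko_JSJ_hierarchy G hier ->
  [/\
    (* (1) *)
    \sum_(i < p) ratio1 (orbit_series x (G i `\ 1%g) delta)
      + \sum_(j < r) ratio1 (cyclic_series x (b j) delta) <= 1,
    (* (2) *)
    forall (H : set (isom X)) (D : decomposition H), node hier D ->
    forall C : {set dE D}, component x C -> has_directed_cycle (transition_rel x D) C ->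
      [/\ forall e f, e \in C -> f \in C -> rel_matrix x delta e f \is a fin_num,
          block_radius C (fun e f => fine (rel_matrix x delta e f)) <= 1 &
          forall F rep, finite_choice C F rep ->
            (critical_parameter x C F rep <= delta%:E)%E],
    (* (3) *)
    forall (H : set (isom X)) (D : decomposition H), node hier D ->
    [/\
      (* (a) *)
      forall (C : {set dE D}) F rep, component x C -> finite_choice C F rep ->
      forall (N : dE D -> dE D -> nat) (Rb : dE D -> dE D -> R),
      let retained e f := F e f != fset0 in
      (forall e f, e \in C -> f \in C -> retained e f ->
         exists S : {fset set (isom X)},
           [/\ (S `<=` F e f)%fset, #|` S| = N e f &
               forall c, c \in S -> axis_weight x (rep e f c) <= Rb e f]) ->
      let B e f : R :=
        if retained e f then (N e f)%:R * expR (- delta * Rb e f) else 0 in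
      let Nmx e f : R := if retained e f then (N e f)%:R else 0 in
      [/\ block_radius C B <= 1,
          forall R0 : R,
            (forall e f, e \in C -> f \in C -> retained e f -> Rb e f <= R0) ->
            1 < block_radius C Nmx -> ln (block_radius C Nmx) <= delta * R0 &
          forall (m : nat) (cyc : 'I_m.+1 -> dE D),
            (forall i, [/\ cyc i \in C, retained (cyc i) (cyc (ordS i)) &
                           (0 < N (cyc i) (cyc (ordS i)))%N]) ->
            \sum_(i < m.+1) ln (N (cyc i) (cyc (ordS i)))%:R
              <= delta * \sum_(i < m.+1) Rb (cyc i) (cyc (ordS i))],
      (* (b) *)
      forall f : dE D, one_edge_segment f ->
      let A := stabV (org (tG (dT D)) (liftE f)) in
      let B := stabV (ter (tG (dT D)) (liftE f)) in
      let C0 := egrp f in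
      C0 <> A -> C0 <> B ->
      [/\ (coset_series x A C0 delta < +oo)%E,
          (coset_series x B C0 delta < +oo)%E,
          (coset_series x A C0 delta * coset_series x B C0 delta <= 1)%E &
          forall (FA FB : {fset set (isom X)}) (gA gB : set (isom X) -> isom X),
            (forall c, c \in FA -> [/\ lcosets_of A C0 c, c <> C0,
                                       c (gA c) & hyperbolic (gA c)]) ->
            (forall c, c \in FB -> [/\ lcosets_of B C0 c, c <> C0,
                                       c (gB c) & hyperbolic (gB c)]) ->
            (\sum_(c <- FA) expR (- delta * axis_weight x (gA c)))
              * (\sum_(c <- FB) expR (- delta * axis_weight x (gB c))) <= 1],
      (* (c) *)
      forall f : dE D, one_edge_loop f ->
      [/\ forall e : dE D, transition_rel x D e e ->
            rel_matrix x delta e e \is a fin_num /\ (rel_matrix x delta e e <= 1)%E,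
          rel_matrix x delta f (drev f) <> 0%E ->
          rel_matrix x delta (drev f) f <> 0%E ->
            [/\ rel_matrix x delta f (drev f) \is a fin_num,
                rel_matrix x delta (drev f) f \is a fin_num &
                (rel_matrix x delta f (drev f)
                   * rel_matrix x delta (drev f) f <= 1)%E] &
          forall F rep, finite_choice [set: dE D]%SET F rep ->
            (forall e : dE D, comparison_matrix x F rep delta e e <= 1) /\
            (comparison_matrix x F rep delta f (drev f) <> 0 ->
             comparison_matrix x F rep delta (drev f) f <> 0 ->
             comparison_matrix x F rep delta f (drev f)
               * comparison_matrix x F rep delta (drev f) f <= 1)] &
      (* (d) *)
      forall (c : dE D -> dE D -> set (isom X)) (g : dE D -> dE D -> isom X),
      (forall e f, hashimoto_rel D e f ->
         relative_coset f (c e f) /\ hyperbolic_rep f (c e f) (g e f)) ->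
      let Hmx e f : R :=
        if hashimoto_rel D e f then expR (- delta * axis_weight x (g e f)) else 0 in
      let rhoY : R := block_radius [set: dE D]%SET (hashimoto D) in
      block_radius [set: dE D]%SET Hmx <= 1 /\
      forall R0 : R,
        (forall C : {set dE D},
           strong_component [set: dE D]%SET (hashimoto_rel D) C ->
           has_directed_cycle (hashimoto_rel D) C ->
           forall e f, e \in C -> f \in C -> hashimoto_rel D e f ->
             axis_weight x (g e f) <= R0) ->
        1 < rhoY -> ln rhoY <= delta * R0] &
    (* (4) *)
    non_elementary x Gam -> delta < 1 \/ convex_cobounded x Gam ->
    hausdorff_dim (bourdon_metric x) (limit_set x Gam) = critical_exponent x Gam /\
    forall (H : set (isom X)) (D : decomposition H), node hier D ->
    forall C : {set dE D}, component x C -> has_directed_cycle (transition_rel x D) C ->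
    forall F rep, finite_choice C F rep ->
      (critical_parameter x C F rep
         <= hausdorff_dim (bourdon_metric x) (limit_set x Gam))%E ].
Proof.
move=> proper CAT Gsub Gfg _ d0 cE _ gd _.
have axis g : hyperbolic g -> disp x g <= axis_weight x g by exact: disp_le_axis_weight.
have sub H (D : decomposition H) : node hier D -> is_subgroup H /\ H `<=` Gam.
  by move=> nd; exact: node_subgroup nd Gsub.
split.
- exact: (grushko_inequality Gsub d0 cE gd).
- move=> H D /sub[Hsub HG] C comp _.
  have fin e f : e \in C -> f \in C -> rel_matrix x delta e f \is a fin_num.
    exact: (component_rel_matrix Gsub d0 cE Hsub HG comp).
  split=> //.
  + exact: (block_radius_rel_matrix Gsub d0 cE Hsub HG fin).
  + by move=> F rep fc; exact: (critical_parameter_le Gsub d0 cE axis Hsub HG fc).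
- move=> H D /sub[Hsub HG]; split.
  + move=> C F rep _ fc N Rb retained NR B Nmx; split.
    * exact: (multiplicity_radius Gsub d0 cE axis Hsub HG fc NR).
    * by move=> R0; exact: (multiplicity_log Gsub d0 cE axis Hsub HG fc NR).
    * by move=> m cyc; exact: (multiplicity_cycle Gsub d0 cE axis Hsub HG fc NR).
  + move=> f _ A B C0 CA CB.
    have [fA fB le] := amalgam_series_le1 Gsub d0 cE Hsub HG CA CB; split=> // FA FB gA gB hA hB.
    exact: (amalgam_axis_le1 Gsub d0 cE axis Hsub HG hA hB).
  + move=> f _; split.
    * by move=> e _; exact: (rel_matrix_diag_le1 Gsub d0 cE Hsub HG).
    * exact: (rel_matrix_mixed_le1 Gsub d0 cE Hsub HG).
    * move=> F rep fc; split=> [e|_ _].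
        have := @comparison_cycle_le1 _ _ _ _ _ Gsub d0 cE axis _ _ Hsub HG _ _ _ 0 (fun _ => e) fc.
        by rewrite big_ord1; apply=> i; rewrite inE.
      have := @comparison_cycle_le1 _ _ _ _ _ Gsub d0 cE axis _ _ Hsub HG _ _ _ 1
        (fun i => if i == ord0 then f else drev f) fc.
      by rewrite big_ord_recl big_ord1; apply=> i; rewrite inE.
  + move=> c g cg Hmx rhoY; split.
    * exact: (hashimoto_radius_le1 Gsub d0 cE axis Hsub HG cg).
    * by move=> R0; exact: (hashimoto_log Gsub d0 cE axis Hsub HG cg).
move=> ne upper.
have dimE : hausdorff_dim (bourdon_metric x) (limit_set x Gam) = critical_exponent x Gam.
  apply/eqP; rewrite eq_le cE (hausdorff_dim_ge proper CAT Gsub d0 cE ne) andbT.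
  case: upper => [d1|cc]; first exact: (small_exponent_dim_le proper CAT Gsub Gfg cE d1).
  exact: (convex_cobounded_dim_le proper CAT Gsub cE cc).
split=> // H D /sub[Hsub HG] C _ _ F rep fc.
by rewrite dimE cE; exact: (critical_parameter_le Gsub d0 cE axis Hsub HG fc).
Qed.
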